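(* Let $d\ge1$, let $d\mu=(2\pi)^{-d/2}e^{-|x|^2/2}\,dx$ on $\mathbb R^d$, let $p\in[1,2)$, and define $$\varphi_p(x):=\frac d4\left[(1-x)^{-\frac{2p}{d(2-p)}}-1\right],\qquad x\in[0,1).$$ Assume that $u\in \mathrm H^1(\mathbb R^d,d\mu)$ is not a.e. equal to $0$ and satisfies $\int_{\mathbb R^d}|u|^2|x|^2\,d\mu=d\,\|u\|_{\mathrm L^2(\mathbb R^d,d\mu)}^2$. Then $$\int_{\mathbb R^d}|\nabla u|^2\,d\mu\;\ge\;\|u\|_{\mathrm L^2(\mathbb R^d,d\mu)}^2\;\varphi_p\left(\frac{\|u\|_{\mathrm L^2(\mathbb R^d,d\mu)}^2-\|u\|_{\mathrm L^p(\mathbb R^d,d\mu)}^2}{\|u\|_{\mathrm L^2(\mathbb R^d,d\mu)}^2}\right).$$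
   Context: $\mathrm H^1(\mathbb R^d,d\mu)$ is the space of (real-valued) functions in $\mathrm L^2(\mathbb R^d,d\mu)$ whose weak gradient is in $\mathrm L^2(\mathbb R^d,d\mu)$. *)

(* Defs.v *)
From HB Require Import structures.
From mathcomp Require Import all_boot all_order all_algebra.
From mathcomp Require Import all_classical all_reals all_analysis.
From mathcomp Require Import measurable_realfun.

Set Implicit Arguments.
Unset Strict Implicit.
Unset Printing Implicit Defensive.

Import Order.TTheory GRing.Theory Num.Theory.
Import numFieldNormedType.Exports.

Local Open Scope classical_set_scope.
Local Open Scope ring_scope.

(* Sigma-algebra generated by the coordinate maps, as the library does for
   tuples; on 'rV[R]_n with R : realType it is the Borel sigma-algebra. *)
Definition measure_rV_display : measure_display -> measure_display.
Proof. exact. Qed.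

Section measurable_rV.
Context {disp} {T : measurableType disp} {n : nat}.

Let coors : 'I_n -> 'rV[T]_n -> T := fun i x => x 0 i.

Let rV_set0 : g_sigma_preimage coors set0.
Proof. exact: sigma_algebra0. Qed.

Let rV_setC A : g_sigma_preimage coors A -> g_sigma_preimage coors (~` A).
Proof. exact: sigma_algebraC. Qed.

Let rV_bigcup (F : (set 'rV[T]_n)^nat) :
  (forall i, g_sigma_preimage coors (F i)) ->
  g_sigma_preimage coors (\bigcup_i (F i)).
Proof. exact: sigma_algebra_bigcup. Qed.

HB.instance Definition _ := @isMeasurable.Build (measure_rV_display disp)
  'rV[T]_n (g_sigma_preimage coors) rV_set0 rV_setC rV_bigcup.

End measurable_rV.

Lemma measurable_coord {disp} {T : measurableType disp} {n : nat} (i : 'I_n) :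
  measurable_fun [set: 'rV[T]_n] (fun x => x 0 i).
Proof.
move=> _ Y mY; rewrite setTI; apply: sub_sigma_algebra => /=.
rewrite -bigcup_seq/=; exists i => /=; first by rewrite mem_index_enum.
by exists Y => //; rewrite setTI.
Qed.

Lemma measurable_fun_rVP {d1 d2} {T1 : measurableType d1}
    {T2 : measurableType d2} {n : nat} (f : T1 -> 'rV[T2]_n) :
  (forall i, measurable_fun [set: T1] (fun x => f x 0 i)) ->
  measurable_fun [set: T1] f.
Proof.
move=> mf _ A mA.
have : preimage_set_system [set: T1] f
    (g_sigma_preimage (fun (i : 'I_n) (x : 'rV[T2]_n) => x 0 i))
    ([set: T1] `&` f @^-1` A) by exists A.
rewrite -g_sigma_preimage_comp; apply: smallest_sub.
  exact: sigma_algebra_measurable.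
rewrite -bigcup_seq; apply: bigcup_sub => i _ _ [B mB <-].
exact: (mf i).
Qed.

Section lebesgue_rV.
Context {R : realType}.

(* measurableTypeR R, the domain of lebesgue_measure, has the same sigma-algebra
   as R but a different display. *)
Definition rV_cons {n : nat} (p : measurableTypeR R * 'rV[R]_n) : 'rV[R]_n.+1 :=
  \row_i oapp (fun j => p.2 0 j) p.1 (unlift ord0 i).

Definition rV_uncons {n : nat} (x : 'rV[R]_n.+1) :
    measurableTypeR R * 'rV[R]_n :=
  (x 0 ord0, \row_j x 0 (lift ord0 j)).

Lemma rV_consK n : cancel (@rV_cons n) rV_uncons.
Proof.
move=> [a v]; rewrite /rV_uncons /rV_cons mxE unlift_none /=; congr pair.
by apply/rowP => j; rewrite !mxE liftK.
Qed.

Lemma measurable_rV_cons n :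
  measurable_fun [set: (measurableTypeR R * 'rV[R]_n)%type] rV_cons.
Proof.
apply: measurable_fun_rVP => i; rewrite /rV_cons.
case: (unliftP ord0 i) => [j|] ->.
  under eq_fun do rewrite mxE liftK /=.
  exact: (measurableT_comp (measurable_coord j) measurable_snd).
under eq_fun do rewrite mxE unlift_none /=.
exact: measurable_fst.
Qed.

Lemma measurable_rV_uncons n :
  measurable_fun [set: 'rV[R]_n.+1] (@rV_uncons n).
Proof.
apply/measurable_fun_pair; first exact: measurable_coord.
apply: measurable_fun_rVP => j; under eq_fun do rewrite mxE.
exact: measurable_coord.
Qed.

Section lebesgue_rV_cons.
Context {n : nat} (m : {sigma_finite_measure set 'rV[R]_n -> \bar R}).

Definition lebesgue_rV_cons : set 'rV[R]_n.+1 -> \bar R :=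
  pushforward (@lebesgue_measure R \x m)%E rV_cons.

Let lebesgue_rV_cons0 : lebesgue_rV_cons set0 = 0%E.
Proof. by rewrite /lebesgue_rV_cons /pushforward preimage_set0 measure0. Qed.

Let lebesgue_rV_cons_ge0 A : (0 <= lebesgue_rV_cons A)%E.
Proof. by rewrite /lebesgue_rV_cons /pushforward; apply: measure_ge0. Qed.

Let lebesgue_rV_cons_sigma_additive : semi_sigma_additive lebesgue_rV_cons.
Proof.
move=> F mF tF mUF; rewrite /lebesgue_rV_cons /pushforward preimage_bigcup.
have mpre B : measurable B -> measurable (@rV_cons n @^-1` B).
  by move=> mB; rewrite -[X in measurable X]setTI; exact: measurable_rV_cons.
apply: measure_semi_sigma_additive.
- by move=> k; exact: mpre.
- apply/trivIsetP => /= i j _ _ ij; rewrite -preimage_setI.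
  by move/trivIsetP : tF => /(_ _ _ _ _ ij) ->//; rewrite preimage_set0.
- by rewrite -preimage_bigcup; exact: mpre.
Qed.

HB.instance Definition _ := isMeasure.Build _ _ _ lebesgue_rV_cons
  lebesgue_rV_cons0 lebesgue_rV_cons_ge0 lebesgue_rV_cons_sigma_additive.

Let lebesgue_rV_cons_sigma_finite : sigma_finite setT lebesgue_rV_cons.
Proof.
have /sigma_finiteP[F [TF ndF Foo]] := sigma_finiteT (@lebesgue_measure R).
have /sigma_finiteP[G [TG ndG Goo]] := sigma_finiteT m.
exists (fun k => rV_uncons @^-1` (F k `*` G k)).
  rewrite -preimage_bigcup; apply/esym; rewrite -subTset => x _ /=.
  have [k _ Fk] : (\bigcup_k F k) (rV_uncons x).1 by rewrite -TF.
  have [l _ Gl] : (\bigcup_k G k) (rV_uncons x).2 by rewrite -TG.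
  exists (maxn k l) => //; split.
  - by move: Fk; exact/subsetPset/ndF/leq_maxl.
  - by move: Gl; exact/subsetPset/ndG/leq_maxr.
move=> k; have [mF Fk] := Foo k; have [mG Gk] := Goo k; split.
  rewrite -[X in measurable X]setTI.
  by apply: measurable_rV_uncons => //; exact: measurableX.
rewrite /lebesgue_rV_cons /pushforward -comp_preimage.
rewrite (_ : rV_uncons \o rV_cons = id); last first.
  by apply/funext => p /=; rewrite rV_consK.
by rewrite preimage_id product_measure1E// lte_mul_pinfty// ge0_fin_numE.
Qed.

HB.instance Definition _ := Measure_isSigmaFinite.Build _ _ _
  lebesgue_rV_cons lebesgue_rV_cons_sigma_finite.

End lebesgue_rV_cons.

(* Lebesgue measure on R^n as the n-fold product of the one on R. *)
Fixpoint lebesgue_rV (n : nat) : {sigma_finite_measure set 'rV[R]_n -> \bar R} :=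
  match n with
  | 0 => \d_(0 : 'rV[R]_0)
  | k.+1 => lebesgue_rV_cons (lebesgue_rV k)
  end.

End lebesgue_rV.

(* The library norm on 'rV[R]_n is the sup norm, hence this definition. *)
Definition sqr_enorm {R : realType} {n : nat} (x : 'rV[R]_n) : R :=
  \sum_(i < n) x 0 i ^+ 2.

Section gaussian.
Context {R : realType} (n : nat).

Definition gauss_density (x : 'rV[R]_n) : R :=
  (2 * pi) `^ (- (n%:R / 2)) * expR (- (sqr_enorm x / 2)).

Lemma gauss_density_ge0 x : 0 <= gauss_density x.
Proof. by rewrite mulr_ge0 ?powR_ge0 ?expR_ge0. Qed.

Lemma measurable_gauss_density : measurable_fun [set: 'rV[R]_n] gauss_density.
Proof.
apply: measurable_funM => //; apply: measurableT_comp => //.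
apply: measurableT_comp => //; apply: measurable_funM => //.
apply: measurable_sum => i; apply: measurable_funX; exact: measurable_coord.
Qed.

Definition gauss_measure (A : set 'rV[R]_n) : \bar R :=
  (\int[lebesgue_rV n]_(x in A) (gauss_density x)%:E)%E.

Let gauss_measure0 : gauss_measure set0 = 0%E.
Proof. exact: integral_set0. Qed.

Let gauss_measure_ge0 A : (0 <= gauss_measure A)%E.
Proof. by apply: integral_ge0 => x _; rewrite lee_fin gauss_density_ge0. Qed.

Let gauss_measure_sigma_additive : semi_sigma_additive gauss_measure.
Proof.
apply: semi_sigma_additive_nng_induced.
  by apply/measurable_EFinP; exact: measurable_gauss_density.
by move=> x; rewrite lee_fin gauss_density_ge0.
Qed.

HB.instance Definition _ := isMeasure.Build _ _ _ gauss_measure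
  gauss_measure0 gauss_measure_ge0 gauss_measure_sigma_additive.

End gaussian.
Arguments gauss_measure {R} n A.

Section sobolev.
Context {R : realType} {n : nat}.
Implicit Types (u f phi : 'rV[R]_n -> R) (G : 'rV[R]_n -> 'rV[R]_n).

Definition partial (i : 'I_n) f : 'rV[R]_n -> R := 'D_(delta_mx 0 i) f.

(* f is C^oo: s lists the directions of an iterated partial derivative. *)
Definition smooth f : Prop := forall s : seq 'I_n,
  continuous (foldr partial f s) /\
  forall (i : 'I_n) x, derivable (foldr partial f s) x (delta_mx 0 i).

Definition test_function phi : Prop :=
  smooth phi /\ compact (closure [set x | phi x != 0]).

Definition locally_integrable_rV f : Prop :=
  measurable_fun setT f /\
  forall K, compact K -> (lebesgue_rV n).-integrable K (EFin \o f).

Definition weak_gradient u G : Prop :=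
  locally_integrable_rV u /\
  forall i : 'I_n, locally_integrable_rV (fun x => G x 0 i) /\
    forall phi, test_function phi ->
      \int[lebesgue_rV n]_x (u x * partial i phi x) =
      - \int[lebesgue_rV n]_x (G x 0 i * phi x).

Definition sobolev_H1 (mu : {measure set 'rV[R]_n -> \bar R}) u : Prop :=
  u \in Lfun mu 2%:E /\
  exists2 G, weak_gradient u G & forall i, (fun x => G x 0 i) \in Lfun mu 2%:E.

End sobolev.

(* Real-valued; only meaningful when u is in L^p(mu). *)
Definition Lp_norm {R : realType} {disp} {T : measurableType disp}
    (mu : {measure set T -> \bar R}) (p : R) (u : T -> R) : R :=
  fine ('N[mu]_(p%:E)[EFin \o u]).

Definition varphi {R : realType} (d : nat) (p x : R) : R :=
  d%:R / 4 * ((1 - x) `^ (- (2 * p / (d%:R * (2 - p)))) - 1).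

(* Main.v *)
Require Import Defs.
From mathcomp Require Import all_boot all_order all_algebra.
From mathcomp Require Import all_classical all_reals all_analysis.
From mathcomp Require Import ring lra measurable_realfun.

Import Order.TTheory GRing.Theory Num.Theory.
Import numFieldNormedType.Exports.

Local Open Scope classical_set_scope.
Local Open Scope ring_scope.

(** Let gamma be the Gaussian density, m the squared L^2 norm of u for the
    Gaussian measure, I the integral of |grad u|^2 and E the entropy of u^2,
    that is the Gaussian integral of u^2 ln(u^2 / m), divided by m.  When I is
    infinite there is nothing to prove.  Otherwise two bounds on E combine.

    Upper bound (entropy_information): E <= (d/2) ln(1 + 4 I / (d m)).
    Put v = u sqrt(gamma), a function of L^2(dx) with weak derivatives
    k_i = (G_i - x_i u / 2) sqrt(gamma).  The inequality lsi says that, for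
    every s > 0,

      m E <= 2 s^2 sum_i |k_i|^2 + (1/2) sum_i |x_i v|^2 - d (1 + ln s) m,

    with norms in L^2(dx); it is the Euclidean logarithmic Sobolev inequality
    in disguise.  Integrating by parts, the integral of x_i v k_i is - m / 2
    (moment_identity); since sum_i |x_i v|^2 = d m by assumption, expanding the
    squares gives sum_i |k_i|^2 = I + d m / 4.  The choice
    s^-2 = 1 + 4 I / (d m) is then optimal.  The normalisation of the second
    moment is what replaces the linear bound E <= 2 I / m of Gross by a
    logarithmic one.

    Lower bound (entropy_Lp): by Jensen's inequality for the probability
    u^2 gamma / m, the ratio of the squared L^p and L^2 norms is at least
    exp(- (2 - p) E / p).  Eliminating E between the two bounds gives the
    theorem (powR_ratio_le).

    The inequality lsi is proved by induction on the dimension.  On the line, a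
    nonnegative absolutely continuous function M of mass m is pushed forward to
    the Gaussian by an increasing map T.  The Jacobian equation expresses ln M
    through ln T' and T^2; then ln T' <= s T' - 1 - ln s, an integration by
    parts of M T' and Young's inequality conclude (lsi1).  In dimension n + 1,
    the entropy is the entropy of the marginal of v^2 along the first
    coordinate plus the mean entropy of the slices (ent_chain).  The marginal M
    has derivative h = 2 int v k_0, and h^2 <= 4 M K with K = int k_0^2 by
    Cauchy-Schwarz: these are the hypotheses of the inequality on the line.

    Slicing a weak derivative requires care, because an identity that holds on
    almost every slice for each test function need not hold on almost every
    slice for all of them.  Weak derivatives are therefore tested on a
    countable family of products (test_fam, weak_partial), large enough for the
    fundamental lemma of the calculus of variations (fundamental_lemma) and for
    the lemma of du Bois-Reymond (du_bois_reymond), which provides absolutely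
    continuous representatives on almost every line. *)

Set Implicit Arguments.
Unset Strict Implicit.
Unset Printing Implicit Defensive.

(** * Integrable real-valued functions and Fubini's theorem *)

Section ae.
Context {d : measure_display} {T : measurableType d} {R : realType}.
Variable mu : {measure set T -> \bar R}.

Lemma ae_mono (P Q : T -> Prop) : (forall x, P x -> Q x) ->
  {ae mu, forall x, P x} -> {ae mu, forall x, Q x}.
Proof. by move=> h; apply: filterS. Qed.

Lemma ae_mono2 (P Q S : T -> Prop) : (forall x, P x -> Q x -> S x) ->
  {ae mu, forall x, P x} -> {ae mu, forall x, Q x} -> {ae mu, forall x, S x}.
Proof. by move=> h; apply: filterS2. Qed.

(** This is why the test functions are later restricted to a countable family:
    almost every slice then satisfies all the tested identities at once. *)
Lemma ae_countable (I : countType) (P : I -> T -> Prop) :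
  (forall i, {ae mu, forall x, P i x}) -> {ae mu, forall x, forall i, P i x}.
Proof.
move=> h.
have : {ae mu, forall x, forall n : nat, forall i, unpickle n = Some i -> P i x}.
  apply/ae_foralln => n.
  case e : (unpickle n) => [i|]; last exact: aeW.
  by apply: ae_mono (h i) => x Px j [<-].
by apply: ae_mono => x hx i; apply: (hx (pickle i)); rewrite pickleK.
Qed.

End ae.

Section L1.
Context {d : measure_display} {T : measurableType d} {R : realType}.
Variable mu : {measure set T -> \bar R}.
Implicit Types f g : T -> R.

Definition L1 f := mu.-integrable [set: T] (EFin \o f).

Lemma L1_meas f : L1 f -> measurable_fun setT f.
Proof. by move=> /measurable_int /measurable_EFinP. Qed.

Lemma L1_EFin f : L1 f -> (\int[mu]_x (f x)%:E)%E = (\int[mu]_x f x)%:E.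
Proof. by move=> /integrable_fin_num h; rewrite /Rintegral fineK// h. Qed.

Lemma L1_le f g : measurable_fun setT f -> L1 g -> (forall x, `|f x| <= g x) ->
  L1 f.
Proof.
move=> mf ig fg; apply: le_integrable ig => //; first exact/measurable_EFinP.
by move=> x _ /=; rewrite lee_fin (le_trans (fg x))// ler_norm.
Qed.

Lemma L1D f g : L1 f -> L1 g -> L1 (fun x => f x + g x).
Proof. by move=> h1 h2; exact: (integrableD measurableT h1 h2). Qed.

Lemma L1B f g : L1 f -> L1 g -> L1 (fun x => f x - g x).
Proof. by move=> h1 h2; exact: (integrableB measurableT h1 h2). Qed.

Lemma L1Z (c : R) f : L1 f -> L1 (fun x => c * f x).
Proof. by move=> h; exact: (integrableZl measurableT c h). Qed.

Lemma L1_sum n (F : 'I_n -> T -> R) : (forall i, L1 (F i)) ->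
  L1 (fun x => \sum_(i < n) F i x).
Proof.
move=> h; have := @integrable_sum _ _ _ mu _ measurableT _ (index_enum 'I_n) xpredT (fun i => EFin \o F i) (fun i _ => h i).
by rewrite /L1; congr integrable; apply/funext => x /=; rewrite sumEFin.
Qed.

Lemma RI_D f g : L1 f -> L1 g ->
  \int[mu]_x (f x + g x) = \int[mu]_x f x + \int[mu]_x g x.
Proof. by move=> ? ?; rewrite RintegralD. Qed.

Lemma RI_B f g : L1 f -> L1 g ->
  \int[mu]_x (f x - g x) = \int[mu]_x f x - \int[mu]_x g x.
Proof. by move=> ? ?; rewrite RintegralB. Qed.

Lemma RI_Z (c : R) f : L1 f -> \int[mu]_x (c * f x) = c * \int[mu]_x f x.
Proof. by move=> ?; rewrite RintegralZl. Qed.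

Lemma RI_sum n (F : 'I_n -> T -> R) : (forall i, L1 (F i)) ->
  \int[mu]_x (\sum_(i < n) F i x) = \sum_(i < n) \int[mu]_x F i x.
Proof.
elim: n F => [|n IH] F iF.
  rewrite big_ord0; under eq_Rintegral do rewrite big_ord0.
  by rewrite /Rintegral integral0.
rewrite big_ord_recl -IH// -RI_D//; last exact: L1_sum.
by apply: eq_Rintegral => x _; rewrite big_ord_recl.
Qed.

Lemma RI_le f g : L1 f -> L1 g -> (forall x, f x <= g x) ->
  \int[mu]_x f x <= \int[mu]_x g x.
Proof. by move=> ? ? h; apply: le_Rintegral => // x _; exact: h. Qed.

Lemma L1_ae f g : L1 f -> measurable_fun setT g ->
  {ae mu, forall x, f x = g x} -> L1 g.
Proof.
move=> i mg fg; apply/integrableP; split; first exact/measurable_EFinP.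
have /integrableP[mf ] := i.
rewrite (@ge0_ae_eq_integral _ _ _ _ _ _ (fun x => `|(g x)%:E|)%E)//.
- by apply: measurableT_comp.
- by do 2 apply: measurableT_comp => //.
- by apply: filterS fg => x /= ->.
Qed.

Lemma RI_ae f g : measurable_fun setT f -> measurable_fun setT g ->
  {ae mu, forall x, f x = g x} -> \int[mu]_x f x = \int[mu]_x g x.
Proof.
move=> mf mg fg; rewrite /Rintegral; congr fine; apply: ae_eq_integral => //.
- exact/measurable_EFinP.
- exact/measurable_EFinP.
- by apply: filterS fg => x /= ->.
Qed.

Lemma L1_Mbnd (c : R) f g : L1 f -> measurable_fun setT g ->
  (forall x, `|g x| <= c) -> L1 (fun x => f x * g x).
Proof.
move=> i mg gc; apply: (@L1_le _ (fun x => c * `|f x|)).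
- by apply: measurable_funM => //; exact: L1_meas.
- by apply: L1Z; exact: integrable_norm.
- by move=> x; rewrite normrM mulrC ler_wpM2r.
Qed.

Lemma L1_Msq f g : measurable_fun setT f -> measurable_fun setT g ->
  L1 (fun x => f x ^+ 2) -> L1 (fun x => g x ^+ 2) -> L1 (fun x => f x * g x).
Proof.
move=> mf mg f2 g2; apply: (@L1_le _ (fun x => f x ^+ 2 + g x ^+ 2)).
- exact: measurable_funM.
- exact: L1D.
- move=> x; have := sqr_ge0 (`|f x| - `|g x|).
  rewrite sqrrB !real_normK ?num_real// normrM.
  by have := normr_ge0 (f x); have := normr_ge0 (g x); nra.
Qed.

Lemma L1_abs f : L1 f -> L1 (fun x => `|f x|).
Proof. exact: integrable_norm. Qed.

Lemma RI_abs f : L1 f -> `|\int[mu]_x f x| <= \int[mu]_x `|f x|.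
Proof. by move=> i; exact: le_normr_Rintegral. Qed.

Lemma RI_ge0 f : (forall x, 0 <= f x) -> 0 <= \int[mu]_x f x.
Proof. by move=> h; apply: Rintegral_ge0. Qed.

Lemma RI0_ae f : L1 f -> (forall x, 0 <= f x) -> \int[mu]_x f x = 0 ->
  {ae mu, forall x, f x = 0}.
Proof.
move=> i f0 e; have := L1_EFin i; rewrite e => h.
have mf := L1_meas i.
have := (ae_eq_integral_abs mu measurableT (proj2 (measurable_EFinP _ _) mf)).1.
under eq_integral do rewrite gee0_abs ?lee_fin//.
by move=> /(_ h); apply: filterS => x /= /(_ I) [].
Qed.

Lemma L1_ltyP f : measurable_fun setT f -> (forall x, 0 <= f x) ->
  (\int[mu]_x (f x)%:E < +oo)%E -> L1 f.
Proof.
move=> mf f0 h; apply/integrableP; split; first exact/measurable_EFinP.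
by under eq_integral do rewrite gee0_abs ?lee_fin//.
Qed.

Lemma L1_le_ae f g : measurable_fun setT f -> L1 g ->
  {ae mu, forall x, `|f x| <= g x} -> L1 f.
Proof.
move=> mf ig fg; apply/integrableP; split; first exact/measurable_EFinP.
have ia := L1_abs ig.
apply: (@le_lt_trans _ _ (\int[mu]_x (`|g x|)%:E)%E); last first.
  by rewrite (L1_EFin ia) ltry.
apply: ae_ge0_le_integral => //.
- by apply/measurable_EFinP; apply: measurableT_comp.
- by apply/measurable_EFinP; exact: L1_meas.
- by apply: ae_mono fg => x h _; rewrite lee_fin (le_trans h)// ler_norm.
Qed.

(** The space L^1 + L^oo, up to null sets. It contains L^2, it pairs with
    bounded integrable functions, and it is stable both under almost every
    slice and under partial integration against such functions: this is the
    class in which the fundamental lemma of the calculus of variations can be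
    proved by induction on the dimension. *)
Definition L1_plus_Loo f := measurable_fun setT f /\
  exists A (c : R), [/\ L1 A, 0 <= c & {ae mu, forall x, `|f x| <= A x + c}].

Lemma L1_plus_Loo_meas f : L1_plus_Loo f -> measurable_fun setT f. Proof. by case. Qed.

Lemma L2_L1_plus_Loo f : measurable_fun setT f -> L1 (fun x => f x ^+ 2) -> L1_plus_Loo f.
Proof.
move=> mf f2; split => //; exists (fun x => f x ^+ 2), 1; split => //; apply: aeW => x.
by rewrite -real_normK ?num_real//; have := normr_ge0 (f x); nra.
Qed.

Definition L1_cap_Loo f := L1 f /\ exists c : R, forall x, `|f x| <= c.

Lemma L1_cap_Loo_meas f : L1_cap_Loo f -> measurable_fun setT f. Proof. by case=> /L1_meas. Qed.

Lemma L1_Mplus_cap f g : L1_plus_Loo f -> L1_cap_Loo g -> L1 (fun x => f x * g x).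
Proof.
move=> [mf [A [c [iA c0 fA]]]] [ig [C gC]].
apply: (@L1_le_ae _ (fun x => `|A x| * `|g x| + c * `|g x|)).
- by apply: measurable_funM => //; exact: L1_meas.
- apply: L1D; last by apply: L1Z; exact: L1_abs.
  apply: (@L1_Mbnd C); first exact: L1_abs.
    by apply: measurableT_comp => //; exact: L1_meas.
  by move=> x; rewrite normr_id.
- apply: ae_mono fA => x fA; rewrite normrM -mulrDl ler_wpM2r// (le_trans fA)// lerD2r.
  exact: ler_norm.
Qed.

End L1.

Lemma L1_prod {d1 d2 : measure_display} {T1 : measurableType d1}
  {T2 : measurableType d2} {R : realType}
  (m1 : {sigma_finite_measure set T1 -> \bar R})
  (m2 : {sigma_finite_measure set T2 -> \bar R}) (f : T1 -> R) (g : T2 -> R) :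
  L1 m1 f -> L1 m2 g -> L1 (m1 \x m2)%E (fun p => f p.1 * g p.2).
Proof.
move=> fi gi.
have mfg : measurable_fun [set: T1 * T2] (fun p => f p.1 * g p.2).
  apply: measurable_funM.
    exact: (measurableT_comp (L1_meas fi) measurable_fst).
  exact: (measurableT_comp (L1_meas gi) measurable_snd).
apply/(integrable12ltyP m1 m2) => /=; first exact/measurable_EFinP.
under eq_integral => x _.
  under eq_integral do rewrite normrM EFinM.
  rewrite ge0_integralZl//; last exact: (measurable_int _ (L1_abs gi)).
  rewrite (L1_EFin (L1_abs gi)).
  over.
rewrite /= ge0_integralZr//.
- by rewrite (L1_EFin (L1_abs fi)) -EFinM ltry.
- exact: (measurable_int _ (L1_abs fi)).
- by rewrite lee_fin; apply: RI_ge0.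
Qed.

Section fubini.
Context {d1 d2 : measure_display} {T1 : measurableType d1}
  {T2 : measurableType d2} {R : realType}.
Variables (m1 : {sigma_finite_measure set T1 -> \bar R})
  (m2 : {sigma_finite_measure set T2 -> \bar R}).
Variable f : T1 * T2 -> R.
Hypothesis fi : L1 (m1 \x m2)%E f.

Lemma L1_fubini1 : [/\ {ae m1, forall x, L1 m2 (fun y => f (x, y))},
  L1 m1 (fun x => \int[m2]_y f (x, y)) &
  \int[m1]_x (\int[m2]_y f (x, y)) = \int[(m1 \x m2)%E]_z f z].
Proof.
have iF := integrable_fubini_F fi.
have mF := measurable_fubini_F fi.
have mf : measurable_fun setT (fun x => \int[m2]_y f (x, y)).
  by apply: measurableT_comp mF.
split; first exact: (ae_integrable1 fi).
- apply: le_integrable iF => //; first exact/measurable_EFinP.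
  move=> x _ /=; rewrite /Rintegral /fubini_F /=.
  by case: integral => [r| |]//=; rewrite ?normr0 leey.
- rewrite /Rintegral -(integral12_prod_meas1 fi); congr fine.
  apply: ae_eq_integral => //; first exact/measurable_EFinP.
  apply: filterS (integrable_ae measurableT iF) => x /= /(_ I) h _.
  by rewrite /fubini_F/= fineK.
Qed.

(** The marginal of f is bounded by that of |f|, which is integrable by
    Tonelli's theorem. *)
Lemma L1_fubini2 : [/\ {ae m2, forall y, L1 m1 (fun x => f (x, y))},
  L1 m2 (fun y => \int[m1]_x f (x, y)) &
  \int[m2]_y (\int[m1]_x f (x, y)) = \int[(m1 \x m2)%E]_z f z].
Proof.
have mF := measurable_fubini_G fi.
have mf1 : measurable_fun setT (EFin \o f) := measurable_int _ fi.
have iF : m2.-integrable setT (fubini_G m1 (EFin \o f)).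
  apply/integrableP; split => //.
  apply: le_lt_trans ((integrable21ltyP m1 m2 mf1).1 fi).
  apply: ge0_le_integral => //; first exact: measurableT_comp.
    apply: (measurable_fun_fubini_tonelli_G (abse \o (EFin \o f))) => //=.
    exact: measurableT_comp.
  by move=> y _; apply: le_abse_integral => //; exact: measurableT_comp mf1 _.
have mf : measurable_fun setT (fun y => \int[m1]_x f (x, y)).
  by apply: measurableT_comp mF.
split; first exact: (ae_integrable2 fi).
- apply: le_integrable iF => //; first exact/measurable_EFinP.
  move=> x _ /=; rewrite /Rintegral /fubini_G /=.
  by case: integral => [r| |]//=; rewrite ?normr0 leey.
- rewrite /Rintegral -(integral21_prod_meas1 fi); congr fine.
  apply: ae_eq_integral => //; first exact/measurable_EFinP.
  apply: filterS (integrable_ae measurableT iF) => x /= /(_ I) h _.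
  by rewrite /fubini_G/= fineK.
Qed.
End fubini.

(** * Lebesgue measure on row vectors, slice by slice *)

Section rV_fubini.
Context {R : realType} {n : nat}.
Local Notation leb := (@lebesgue_measure R).
Local Notation Leb := (@lebesgue_rV R).

(** rV_cons with curried arguments, so that a slice is the function x |-> f
    (consv t x). *)
Definition consv (t : R) (x : 'rV[R]_n) : 'rV[R]_n.+1 := rV_cons (t, x).

Lemma consvE (p : measurableTypeR R * 'rV[R]_n) : consv p.1 p.2 = rV_cons p.
Proof. by case: p. Qed.

Lemma consv0 t x : consv t x 0 ord0 = t.
Proof. by rewrite /consv /rV_cons mxE unlift_none. Qed.

Lemma consvS t x j : consv t x 0 (lift ord0 j) = x 0 j.
Proof. by rewrite /consv /rV_cons mxE liftK. Qed.

Lemma measurable_consv (f : 'rV[R]_n.+1 -> R) : measurable_fun setT f ->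
  measurable_fun [set: measurableTypeR R * 'rV[R]_n] (fun p => f (consv p.1 p.2)).
Proof.
move=> mf; rewrite (_ : (fun _ => _) = f \o rV_cons).
  apply: (@measurableT_comp _ _ _ _ _ _ f _ _ mf); exact: measurable_rV_cons.
by apply/funext => -[].
Qed.

Lemma measurable_comp_rV_cons (f : 'rV[R]_n.+1 -> \bar R) : measurable_fun setT f ->
  measurable_fun [set: measurableTypeR R * 'rV[R]_n] (f \o rV_cons).
Proof.
move=> mf.
by apply: (@measurableT_comp _ _ _ _ _ _ f _ _ mf); exact: measurable_rV_cons.
Qed.

Lemma measurable_slice (f : 'rV[R]_n.+1 -> R) t : measurable_fun setT f ->
  measurable_fun setT (fun x => f (consv t x)).
Proof.
move=> /measurable_consv mf.
exact: (measurableT_comp mf (@pair1_measurable _ _ (measurableTypeR R) _ t)).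
Qed.

Lemma measurable_line (f : 'rV[R]_n.+1 -> R) x : measurable_fun setT f ->
  measurable_fun [set: measurableTypeR R] (fun t => f (consv t x)).
Proof.
move=> /measurable_consv mf.
exact: (measurableT_comp mf (@pair2_measurable _ _ (measurableTypeR R) _ x)).
Qed.

Lemma ge0_integral_rV_cons (f : 'rV[R]_n.+1 -> \bar R) :
  measurable_fun setT f -> (forall x, 0 <= f x)%E ->
  (\int[Leb n.+1]_x f x = \int[(leb \x Leb n)%E]_p f (rV_cons p))%E.
Proof.
move=> mf f0.
have := @ge0_integral_pushforward _ _ _ _ R _ (@measurable_rV_cons R n) (leb \x Leb n)%E setT f measurableT mf.
rewrite preimage_setT => <-//.
Qed.

Lemma L1_consv (f : 'rV[R]_n.+1 -> R) : measurable_fun setT f ->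
  L1 (Leb n.+1) f <-> L1 (leb \x Leb n)%E (fun p => f (consv p.1 p.2)).
Proof.
move=> mf; have mf' := measurable_consv mf.
have mk : measurable_fun setT (fun x => `|(EFin \o f) x|)%E.
  by apply: measurableT_comp => //; exact/measurable_EFinP.
split=> /integrableP[_ h]; apply/integrableP; split; try exact/measurable_EFinP.
- under eq_integral do rewrite /= consvE.
  by move: h; rewrite (ge0_integral_rV_cons mk).
- by rewrite (ge0_integral_rV_cons mk).
Qed.

Lemma RI_consv (f : 'rV[R]_n.+1 -> R) : L1 (Leb n.+1) f ->
  \int[Leb n.+1]_x f x = \int[(leb \x Leb n)%E]_p f (consv p.1 p.2).
Proof.
move=> fi; have mf := L1_meas fi.
have fi' := (L1_consv mf).1 fi.
have := @integral_pushforward _ _ _ _ R _ (@measurable_rV_cons R n) (leb \x Leb n)%E setT (EFin \o f).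
rewrite preimage_setT /Rintegral => h; congr fine; apply: h => //.
exact/measurable_EFinP.
Qed.

Lemma fubini_slice (f : 'rV[R]_n.+1 -> R) : L1 (Leb n.+1) f ->
  [/\ {ae leb, forall t, L1 (Leb n) (fun x => f (consv t x))},
  L1 leb (fun t => \int[Leb n]_x f (consv t x)) &
  \int[leb]_t (\int[Leb n]_x f (consv t x)) = \int[Leb n.+1]_z f z].
Proof.
move=> fi; have mf := L1_meas fi; have fi' := (L1_consv mf).1 fi.
by have [h1 h2 h3] := L1_fubini1 fi'; split=> //; rewrite h3 -RI_consv.
Qed.

Lemma fubini_line (f : 'rV[R]_n.+1 -> R) : L1 (Leb n.+1) f ->
  [/\ {ae Leb n, forall x, L1 leb (fun t => f (consv t x))},
  L1 (Leb n) (fun x => \int[leb]_t f (consv t x)) &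
  \int[Leb n]_x (\int[leb]_t f (consv t x)) = \int[Leb n.+1]_z f z].
Proof.
move=> fi; have mf := L1_meas fi; have fi' := (L1_consv mf).1 fi.
by have [h1 h2 h3] := L1_fubini2 fi'; split=> //; rewrite h3 -RI_consv.
Qed.

Lemma tonelli_slice (f : 'rV[R]_n.+1 -> \bar R) :
  measurable_fun setT f -> (forall x, 0 <= f x)%E ->
  (\int[Leb n.+1]_x f x = \int[leb]_t \int[Leb n]_x f (consv t x))%E.
Proof.
move=> mf f0; rewrite ge0_integral_rV_cons//.
exact: (fubini_tonelli1 (f \o rV_cons) (measurable_comp_rV_cons mf) (fun=> f0 _)).
Qed.

Lemma measurable_tonelli_slice (f : 'rV[R]_n.+1 -> \bar R) :
  measurable_fun setT f -> (forall x, 0 <= f x)%E ->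
  measurable_fun [set: measurableTypeR R] (fun t => \int[Leb n]_x f (consv t x))%E.
Proof.
move=> mf f0.
exact: (measurable_fun_fubini_tonelli_F (f \o rV_cons) (measurable_comp_rV_cons mf) (fun=> f0 _)).
Qed.

(** Tonelli for |f - g|. *)
Lemma ae_eq_of_slices (f g : 'rV[R]_n.+1 -> R) :
  measurable_fun setT f -> measurable_fun setT g ->
  {ae leb, forall t, {ae Leb n, forall x, f (consv t x) = g (consv t x)}} ->
  {ae Leb n.+1, forall x, f x = g x}.
Proof.
move=> mf mg h.
pose k x := `|f x - g x|.
have mk : measurable_fun setT k by apply: measurableT_comp => //; exact: measurable_funB.
have i0 : (\int[Leb n.+1]_x (k x)%:E = 0)%E.
  have mk' : measurable_fun setT (EFin \o k) by exact/measurable_EFinP.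
  rewrite (tonelli_slice mk')//; last by move=> x; exact: normr_ge0.
  rewrite (@ge0_ae_eq_integral _ _ _ _ _ _ (fun=> 0%E))// ?integral0//.
  - exact: (measurable_tonelli_slice (f := EFin \o k) mk' (fun=> normr_ge0 _)).
  - by move=> t _; apply: integral_ge0 => x _; exact: normr_ge0.
  apply: ae_mono h => t ht /= _.
  rewrite (@ge0_ae_eq_integral _ _ _ _ _ _ (fun=> 0%E))// ?integral0//.
  - by apply/measurable_EFinP; exact: measurable_slice.
  - by move=> x _; exact: normr_ge0.
  by apply: ae_mono ht => x /= e _; rewrite /k e subrr normr0.
have ki : L1 (Leb n.+1) k by apply: L1_ltyP => //; [move=> x; exact: normr_ge0|rewrite i0].
have := RI0_ae ki (fun=> normr_ge0 _).
rewrite {1}/Rintegral i0 => /(_ erefl); apply: ae_mono => x /eqP.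
by rewrite normr_eq0 subr_eq0 => /eqP.
Qed.

(** Fubini for |f - g|, which has integral 0. *)
Lemma ae_eq_slices (f g : 'rV[R]_n.+1 -> R) :
  measurable_fun setT f -> measurable_fun setT g ->
  {ae Leb n.+1, forall x, f x = g x} ->
  {ae leb, forall t, {ae Leb n, forall x, f (consv t x) = g (consv t x)}}.
Proof.
move=> mf mg h.
pose k x := `|f x - g x|.
have mk : measurable_fun setT k by apply: measurableT_comp => //; exact: measurable_funB.
have k0 : {ae Leb n.+1, forall x, 0 = k x}.
  by apply: ae_mono h => x /= e; rewrite /k e subrr normr0.
have k1 : L1 (Leb n.+1) (fun=> 0 : R) by exact: integrable0.
have ik := L1_ae k1 mk k0.
have [h1 h2 h3] := fubini_slice ik.
have e0 : \int[Leb n.+1]_z k z = 0.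
  rewrite -(RI_ae _ mk k0)//.
  by rewrite /Rintegral integral0.
move: h3; rewrite e0 => h3.
have := RI0_ae h2 (fun=> RI_ge0 _ (fun=> normr_ge0 _)) h3.
apply: ae_mono2 h1 => t i1 i2.
have := RI0_ae i1 (fun=> normr_ge0 _) i2.
apply: ae_mono => x /eqP.
by rewrite normr_eq0 subr_eq0 => /eqP.
Qed.

End rV_fubini.

(** * Primitives of integrable functions on the line *)

Section prim.
Context {R : realType}.
Local Notation leb := (@lebesgue_measure R).
Local Notation IR := (@Rintegral _ (measurableTypeR R) R (@lebesgue_measure R) setT).
Implicit Types f g h : R -> R.

Definition prim g (x : R) : R := \int[leb]_(t in `]-oo, x]) g t.

Lemma L1_within g (D : set R) : measurable D -> L1 leb g ->
  leb.-integrable D (EFin \o g).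
Proof. by move=> mD; apply: integrableS. Qed.

Lemma primB g a b : L1 leb g -> a <= b ->
  prim g b - prim g a = \int[leb]_(t in `]a, b]) g t.
Proof.
move=> ig ab; rewrite /prim Rintegral_itvB//=.
exact: L1_within.
Qed.

Lemma primTB g a : L1 leb g ->
  \int[leb]_t g t - prim g a = \int[leb]_(t in `]a, +oo[) g t.
Proof.
move=> ig; rewrite /prim -set_itvNyy Rintegral_itvB//=.
exact: L1_within.
Qed.

Lemma prim_dist g a b : L1 leb g -> a <= b ->
  `|prim g b - prim g a| <= \int[leb]_(t in `]a, b]) `|g t|.
Proof.
by move=> ig ab; rewrite primB//; apply: le_normr_Rintegral => //; exact: L1_within.
Qed.

Lemma prim_continuous g : L1 leb g -> continuous (prim g).
Proof.
move=> ig x; apply/cvgrPdist_lt => /= e e0.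
have [dl [dl0 hd]] := integral_normr_continuous ig e0.
near=> y.
have dxy : `|x - y| < dl by near: y; apply/nbhs_ballP; exists dl.
have key a b : a <= b -> b - a < dl -> `|prim g b - prim g a| < e.
  move=> ab abd; apply: le_lt_trans (prim_dist ig ab) _.
  apply: hd => //=.
  rewrite lebesgue_measure_itv/= lte_fin; case: ifPn => // _.
have [xy|yx] := leP x y.
  by rewrite distrC; apply: key => //; rewrite -[_ - _]ger0_norm ?subr_ge0// distrC.
by apply: key => //; [exact: ltW|rewrite -[_ - _]gtr0_norm ?subr_gt0].
Unshelve. all: by end_near. Qed.

Lemma prim_measurable g : L1 leb g -> measurable_fun [set: measurableTypeR R] (prim g).
Proof. by move=> ig; apply: continuous_measurable_fun; exact: prim_continuous. Qed.

Lemma prim_le g x : L1 leb g -> `|prim g x| <= \int[leb]_t `|g t|.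
Proof.
move=> ig; apply: (@le_trans _ _ (\int[leb]_(t in `]-oo, x]) `|g t|)).
  by apply: le_normr_Rintegral => //; exact: L1_within.
apply: fine_le.
- by apply: integrable_fin_num => //; apply: L1_within => //; exact: L1_abs.
- by apply: integrable_fin_num => //; apply: L1_within => //; exact: L1_abs.
- apply: ge0_subset_integral => //.
  by apply/measurable_EFinP; apply: L1_meas (L1_abs ig).
Qed.

Lemma prim_derive g (x : R) : L1 leb g -> continuous g -> is_derive x 1 (prim g) (g x).
Proof.
move=> ig cg.
have xx1 : x < x + 1 by rewrite ltrDl.
have [||h1 h2] := @continuous_FTC1 _ g -oo%O x (x + 1) xx1 _ _ (cg x).
- exact: L1_within.
- by rewrite ltNyr.
by apply: DeriveDef; [exact: h1|rewrite -derive1E].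
Qed.

Lemma prim_derive_ae g : L1 leb g ->
  {ae leb, forall x : R, derivable (prim g) x 1 /\ (prim g)^`()%classic x = g x}.
Proof.
move=> ig; apply: FTC1Ny.
- by move=> y; exact: L1_within.
- have := integrable_locally measurableT ig.
  by rewrite patch_setT.
Qed.

Lemma patchE_mul (D : set R) g t : (g \_ D) t = g t * (t \in D)%:R.
Proof. by rewrite patchE; case: (t \in D); rewrite ?mulr1 ?mulr0. Qed.

Lemma primE g x : prim g x = IR (fun t : R => g t * (t <= x)%R%:R).
Proof.
rewrite /prim Rintegral_mkcond; apply: eq_Rintegral => t _.
by rewrite patchE_mul mem_setE in_itv.
Qed.

Lemma measurable_bool_R (b : R -> bool) : measurable [set x | b x] ->
  measurable_fun [set: measurableTypeR R] (fun x => (b x)%:R : R).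
Proof.
move=> mb; rewrite (_ : (fun _ => _) = \1_[set x | b x]).
  exact: measurable_indic.
by apply/funext => x; rewrite indicE mem_setE.
Qed.

Lemma L1_Mle g x : L1 leb g -> L1 leb (fun t : R => g t * (t <= x)%R%:R).
Proof.
move=> ig; apply: (@L1_Mbnd _ _ _ _ 1) => //.
  apply: measurable_bool_R.
  by rewrite [X in measurable X](_ : _ = `]-oo, x]%classic)// set_itvE.
by move=> t; case: (t <= x)%R; rewrite ?normr1// normr0.
Qed.

Lemma L1_Mprim g h : L1 leb g -> L1 leb h -> L1 leb (fun t => g t * prim h t).
Proof.
move=> ig ih; apply: (@L1_Mbnd _ _ _ _ (\int[leb]_t `|h t|)) => //.
  exact: prim_measurable.
by move=> x; exact: prim_le.
Qed.

(** Product rule for primitives, without any differentiation: the square ]-oo,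
    x]^2 is cut along its diagonal and Fubini is applied to each triangle. *)
Lemma prim_mul g h x : L1 leb g -> L1 leb h ->
  prim g x * prim h x = prim (fun t => g t * prim h t + h t * prim g t) x.
Proof.
move=> ig ih.
pose gx t := g t * (t <= x)%R%:R; pose hx t := h t * (t <= x)%R%:R.
have igx : L1 leb gx by exact: L1_Mle.
have ihx : L1 leb hx by exact: L1_Mle.
pose I (b : bool) : R := b%:R.
pose K1 (p : measurableTypeR R * measurableTypeR R) := gx p.1 * hx p.2 * I (p.2 <= p.1).
pose K2 (p : measurableTypeR R * measurableTypeR R) := gx p.1 * hx p.2 * I (p.1 < p.2).
have mI1 : measurable_fun [set: measurableTypeR R * measurableTypeR R]
    (fun p => I (p.2 <= p.1)).
  apply: (measurableT_comp (f := I)) => //.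
  exact: measurable_fun_ler.
have mI2 : measurable_fun [set: measurableTypeR R * measurableTypeR R]
    (fun p => I (p.1 < p.2)).
  apply: (measurableT_comp (f := I)) => //.
  exact: measurable_fun_ltr.
have I1 b : `|I b| <= 1 by rewrite /I; case: b; rewrite ?normr1// normr0.
have iK1 : L1 (leb \x leb)%E K1.
  apply: (@L1_Mbnd _ _ _ _ 1) => //; exact: L1_prod.
have iK2 : L1 (leb \x leb)%E K2.
  apply: (@L1_Mbnd _ _ _ _ 1) => //; exact: L1_prod.
have [_ i1 e1] := L1_fubini1 iK1.
have [_ i2 e2] := L1_fubini2 iK2.
have [_ _ e2'] := L1_fubini1 iK2.
have -> : prim g x * prim h x = \int[(leb \x leb)%E]_p (K1 p + K2 p).
  rewrite (_ : (fun p => _) = (fun p => gx p.1 * hx p.2)); last first.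
    apply/funext => p; rewrite /K1 /K2 -mulrDr leNgt.
    by rewrite /I; case: (p.1 < p.2); rewrite ?add0r ?addr0 mulr1.
  have [_ _ <-] := L1_fubini1 (L1_prod igx ihx).
  rewrite /= !primE.
  under [RHS]eq_Rintegral do rewrite RI_Z// mulrC.
  by rewrite RI_Z// mulrC.
rewrite RI_D// -e1 -e2 primE.
have s1 (s : R) : IR (fun t : R => K1 (s, t)) = g s * prim h s * (s <= x)%R%:R.
  rewrite (_ : (fun t => _) = (fun t : R => gx s * (h t * (t <= s)%R%:R))); last first.
    apply/funext => t; rewrite /K1/= /gx /hx /I.
    have [sx|sx] := leP s x; last by rewrite !(mulr0, mul0r).
    have [ts|ts] := leP t s; last by rewrite !mulr0.
    by rewrite (le_trans ts sx) !mulr1.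
  rewrite RI_Z; last exact: L1_Mle.
  by rewrite -primE mulrAC.
have s2 (t : R) : IR (fun s : R => K2 (s, t)) = h t * prim g t * (t <= x)%R%:R.
  rewrite (_ : (fun s => _) = (fun s : R => hx t * (g s * (s < t)%R%:R))); last first.
    apply/funext => s; rewrite /K2/= /gx /hx /I.
    have [tx|tx] := leP t x; last by rewrite !(mulr0, mul0r).
    have [st|st] := ltP s t; last by rewrite !mulr0.
    by rewrite (le_trans (ltW st) tx) !mulr1 mulrC.
  have e : (fun s : R => g s * (s < t)%R%:R) = g \_ `]-oo, t[.
    by apply/funext => s; rewrite patchE_mul mem_setE in_itv.
  rewrite RI_Z; last first.
    apply: (@L1_Mbnd _ _ _ _ 1) => //.
      apply: measurable_bool_R.
      by rewrite [X in measurable X](_ : _ = `]-oo, t[%classic)// set_itvE.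
    by move=> s; case: (s < t)%R; rewrite ?normr1// normr0.
  rewrite e -Rintegral_mkcond Rintegral_itv_bndo_bndc; last exact: L1_within.
  by rewrite mulrAC.
under eq_Rintegral do rewrite s1.
under [X in _ + X = _]eq_Rintegral do rewrite s2.
rewrite -RI_D.
- by apply: eq_Rintegral => t _; rewrite mulrDl.
- by apply: L1_Mle; exact: L1_Mprim.
- by apply: L1_Mle; exact: L1_Mprim.
Qed.

Lemma L1_large_bounded f (S : set R) (e : R) : L1 leb f -> measurable S ->
  leb S = +oo%E -> 0 < e -> ~ (forall x, S x -> e <= `|f x|).
Proof.
move=> fi mS Soo e0 h.
have /integrableP[_] := L1_within mS fi.
rewrite ltNge => /negP; apply.
have -> : (+oo = e%:E * leb S)%E by rewrite Soo gt0_muley.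
rewrite -integral_cst//; apply: ge0_le_integral => //=.
- by move=> x _; rewrite lee_fin ltW.
- apply: measurable_funTS.
  by apply/measurable_EFinP; exact: L1_meas (L1_abs fi).
Qed.

Lemma RI_dominated (F : nat -> R -> R) f g :
  (forall n, measurable_fun [set: measurableTypeR R] (F n)) ->
  measurable_fun [set: measurableTypeR R] f -> L1 leb g ->
  (forall n x, `|F n x| <= g x) -> (forall x, F n x @[n --> \oo] --> f x) ->
  IR (F n) @[n --> \oo] --> IR f.
Proof.
move=> mF mf gi Fg Ff.
have Ffe (x : R) : ((F n x)%:E @[n --> \oo] --> (f x)%:E)%E.
  by apply: cvg_EFin; [exact: nearW|exact: Ff].
have h : (\int[leb]_x (F n x)%:E @[n --> \oo] --> \int[leb]_x (f x)%:E)%E.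
  apply: (@dominated_cvg _ _ _ leb setT measurableT (fun n => EFin \o F n) (EFin \o f) (EFin \o g)).
  - by move=> n; exact: (proj2 (measurable_EFinP _ _) (mF n)).
  - by move=> x _; exact: Ffe.
  - by [].
  - by [].
  - by move=> n x _; rewrite lee_fin.
have fi : L1 leb f.
  apply: (L1_le mf gi) => x.
  exact: (ler_cvg_to (cvg_norm (Ff x)) (cvg_cst (g x)) (nearW _ (fun n => Fg n x))).
by apply: fine_cvg; rewrite -/(IR f) -(L1_EFin fi).
Qed.

Lemma prim_cvgy g : L1 leb g -> prim g n%:R @[n --> \oo] --> IR g.
Proof.
move=> ig; under eq_cvg do rewrite primE.
apply: (@RI_dominated _ _ (fun x => `|g x|)).
- by move=> n; apply: L1_meas; exact: L1_Mle.
- exact: L1_meas ig.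
- exact: L1_abs.
- move=> n x; rewrite normrM; case: (x <= _)%R; rewrite ?normr1 ?mulr1// normr0 mulr0.
  exact: normr_ge0.
move=> x; apply: cvg_near_cst; near=> n.
rewrite (_ : (x <= n%:R)%R = true) ?mulr1//.
by near: n; exact: nbhs_infty_ger.
Unshelve. all: by end_near. Qed.

Lemma prim_cvgNy g : L1 leb g -> prim g (- n%:R) @[n --> \oo] --> 0.
Proof.
move=> ig.
have e0 : IR (fun=> 0) = 0 by rewrite /Rintegral integral0.
suff : prim g (- n%:R) @[n --> \oo] --> IR (fun=> 0) by rewrite e0.
under eq_cvg do rewrite primE.
apply: (@RI_dominated _ _ (fun x => `|g x|)).
- by move=> n; apply: L1_meas; exact: L1_Mle.
- by [].
- exact: L1_abs.
- move=> n x; rewrite normrM; case: (x <= _)%R; rewrite ?normr1 ?mulr1// normr0 mulr0.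
  exact: normr_ge0.
move=> x; apply: cvg_near_cst; near=> n.
rewrite (_ : (x <= - n%:R)%R = false) ?mulr0//.
apply/negbTE; rewrite -ltNge ltrNl.
by near: n; exact: nbhs_infty_gtr.
Unshelve. all: by end_near. Qed.

Lemma prim_nondecreasing g a b : L1 leb g -> (forall x, 0 <= g x) -> a <= b ->
  prim g a <= prim g b.
Proof.
by move=> ig g0 ab; rewrite -subr_ge0 primB//; apply: Rintegral_ge0.
Qed.

Lemma primT_dist g a : L1 leb g ->
  `|IR g - prim g a| <= IR (fun x => `|g x|) - prim (fun x => `|g x|) a.
Proof.
move=> ig; rewrite !primTB//; last exact: L1_abs.
by apply: le_normr_Rintegral => //; exact: L1_within.
Qed.

(** An integrable function with an integrable derivative vanishes at both
    ends: its limits at -oo and +oo are c and c + IR g, and a nonzero limit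
    would prevent integrability. Every integration by parts on the line below
    is an instance. *)
Lemma AC_L1_zero (c : R) g : L1 leb g -> L1 leb (fun x => c + prim g x) ->
  c = 0 /\ IR g = 0.
Proof.
move=> ig fi.
have ag := L1_abs ig.
suff [c0 cg] : c = 0 /\ c + IR g = 0 by split=> //; rewrite c0 add0r in cg.
split; apply: contrapT => /eqP; rewrite -normr_gt0 => L0.
- have e0 : 0 < `|c| / 2 by lra.
  have /cvgrPdist_lt/(_ _ e0)[N _ hN] := prim_cvgNy ag.
  have {}hN := hN N (leqnn N).
  apply: (@L1_large_bounded _ `]-oo, - N%:R] _ fi _ _ e0) => //.
    by rewrite lebesgue_measure_itv/= ?ltNyr ?ltry /=.
  move=> x /=; rewrite in_itv/= => xN.
  have h1 : `|prim g x| <= prim (fun x => `|g x|) x.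
    by apply: le_normr_Rintegral => //; exact: L1_within.
  have h2 := prim_nondecreasing ag (fun=> normr_ge0 _) xN.
  move: hN; rewrite sub0r normrN ger0_norm; last by apply: Rintegral_ge0.
  have := lerB_normD c (prim g x); lra.
- have e0 : 0 < `|c + IR g| / 2 by lra.
  have /cvgrPdist_lt/(_ _ e0)[N _ hN] := prim_cvgy ag.
  have {}hN := hN N (leqnn N).
  apply: (@L1_large_bounded _ `[N%:R, +oo[ _ fi _ _ e0) => //.
    by rewrite lebesgue_measure_itv/= ?ltNyr ?ltry /=.
  move=> x /=; rewrite in_itv/= andbT => xN.
  have h1 := primT_dist x ig.
  have h2 := prim_nondecreasing ag (fun=> normr_ge0 _) xN.
  have h3 := ler_norm (IR (fun x => `|g x|) - prim (fun x => `|g x|) N%:R).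
  have := lerB_normD (c + IR g) (- (IR g - prim g x)); rewrite normrN.
  rewrite (_ : c + IR g + - _ = c + prim g x); last by ring.
  move: hN h1 h2 h3; lra.
Qed.

Lemma C1_prim f f' : (forall x : R, is_derive x 1 f (f' x)) -> continuous f' ->
  L1 leb f' -> forall x, f x = (f 0 - prim f' 0) + prim f' x.
Proof.
move=> df cf' if' x.
have dF (y : R) : is_derive y 1 (f \- prim f') 0.
  have := prim_derive y if' cf'; have := df y => h1 h2.
  by rewrite -(subrr (f' y)); exact: is_deriveB.
have /= <- := @is_derive_0_is_cst _ (f \- prim f') x 0 dF.
by ring.
Qed.

End prim.

(** * A class of smooth functions of one variable *)

Section flat.
Context {R : realType}.

(** flat 0 is the classical smooth function exp(-1/x) on ]0, +oo[, extended by
    0. The factor x^-n makes the family stable under differentiation. *)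
Definition flat n (x : R) : R := if 0 < x then x^-1 ^+ n * expR (- x^-1) else 0.

Lemma flat_ge0 n x : 0 <= flat n x.
Proof.
by rewrite /flat; case: ifPn => // x0; rewrite mulr_ge0 ?expR_ge0// exprn_ge0// invr_ge0 ltW.
Qed.

(** Quantitative flatness at 0, from the Taylor bound for exp. *)
Lemma flat_le n x : flat n x <= n.+1`!%:R * `|x|.
Proof.
rewrite /flat; case: ifPn => x0; last by rewrite mulr_ge0.
rewrite (gtr0_norm x0).
have y0 : 0 < x^-1 by rewrite invr_gt0.
have h : x^-1 ^+ n.+1 / n.+1`!%:R <= expR x^-1.
  by have := expR_ge1Dxn n (ltW y0); lra.
have f0 : 0 < n.+1`!%:R :> R by rewrite ltr0n fact_gt0.
rewrite expRN ler_pdivrMr ?expR_gt0//.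
move: h; rewrite ler_pdivrMr// exprS => h.
rewrite -(ler_pM2l y0) (le_trans h)// mulrCA mulrA.
rewrite [X in _ <= X](_ : _ = (x^-1 * x) * (expR x^-1 * n.+1`!%:R)); last by ring.
by rewrite mulVf ?mul1r// gt_eqF.
Qed.

Lemma flat_pos n x : 0 < x -> flat n x = x^-1 ^+ n * expR (- x^-1).
Proof. by rewrite /flat => ->. Qed.

Lemma flat_neg n x : x <= 0 -> flat n x = 0.
Proof. by rewrite /flat ltNge => ->. Qed.

Lemma flat_derive n (x : R) :
  is_derive x 1 (flat n) (flat n.+2 x - n%:R * flat n.+1 x).
Proof.
have [x0|x0|->] := ltgtP x 0.
- rewrite !(flat_neg _ (ltW x0)) mulr0 subr0.
  apply: (@near_eq_is_derive _ _ _ (cst 0)).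
  near=> y; rewrite flat_neg// ltW//.
  by near: y; exact: lt_nbhsl.
- rewrite !flat_pos//.
  apply: (@near_eq_is_derive _ _ _ (fun y : R => y^-1 ^+ n * expR (- y^-1) : R)).
    near=> y; rewrite flat_pos//.
    by rewrite -oppr_lt0; near: y; apply: Nlt_nbhsl; rewrite oppr_lt0.
  have xn0 : x != 0 by rewrite gt_eqF.
  have dV : is_derive x 1 (fun y : R => y^-1) (- x ^- 2).
    apply: (is_derive_eq (@is_deriveV _ id x 1 1 xn0 _)).
    by rewrite -[LHS]/(_ * _) mulr1.
  have dh : is_derive (x^-1) 1 (fun y : R => y ^+ n * expR (- y))
      ((n%:R * x^-1 ^+ n.-1 - x^-1 ^+ n) * expR (- x^-1)).
    have d2 : is_derive (x^-1) 1 (fun y : R => expR (- y)) (expR (- x^-1) * -1).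
      by apply: is_derive1_comp.
    have d1 : is_derive (x^-1) 1 (fun y : R => y ^+ n) (n%:R * x^-1 ^+ n.-1).
      rewrite (_ : (fun y => _) = id ^+ n); last by rewrite exprfctE.
      apply: (is_derive_eq (@is_deriveX _ _ id n (x^-1) 1 1 _)).
      by rewrite -[LHS]/(_ * _) mulr1.
    apply: (is_derive_eq (is_deriveM d1 d2)).
    rewrite -![_ *: _]/(_ * _); ring.
  apply: (is_derive_eq (@is_derive1_comp _ _ _ _ _ _ dh dV)).
  rewrite -exprVn; case: n {dh} => [|n]/=; rewrite ?exprS; ring.
- rewrite !flat_neg// mulr0 subr0.
  have h0 : (fun h : R => h^-1 *: (flat n (h + 0) - flat n 0)) @ 0^' --> (0 : R).
    apply/cvgrPdist_le => /= e e0; near=> h.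
    have hn0 : h != 0 by near: h; exact: nbhs_dnbhs_neq.
    rewrite addr0 (flat_neg n (lexx 0)) subr0 sub0r normrN.
    have -> : h^-1 *: flat n h = flat n.+1 h.
      have [hp|hp] := ltP 0 h; last by rewrite !flat_neg// scaler0.
      by rewrite !flat_pos// -[LHS]/(_ * _) exprS mulrA.
    rewrite ger0_norm ?flat_ge0// (le_trans (flat_le _ _))//.
    rewrite mulrC -ler_pdivlMr ?ltr0n ?fact_gt0//.
    near: h; apply: dnbhs0_le; rewrite divr_gt0// ltr0n fact_gt0//.
  apply: DeriveDef.
    by apply/cvg_ex; exists 0; rewrite /= ; under eq_fun do rewrite [_%:A]mulr1.
  by apply/cvg_lim => //; under eq_fun do rewrite [_%:A]mulr1.
Unshelve. all: by end_near. Qed.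

(** Smoothness is encoded by the operations that generate the functions in
    use. Stability under products and composition then holds by construction,
    and stability under differentiation by a single induction, whereas for
    C^oo functions these are inductions on the order of differentiation. *)
Inductive smooth1 : (R -> R) -> Prop :=
| smooth1_cst c : smooth1 (fun=> c)
| smooth1_id : smooth1 id
| smooth1_flat n : smooth1 (flat n)
| smooth1_exp : smooth1 (@expR R)
| smooth1_add f g : smooth1 f -> smooth1 g -> smooth1 (fun x => f x + g x)
| smooth1_mul f g : smooth1 f -> smooth1 g -> smooth1 (fun x => f x * g x)
| smooth1_comp f g : smooth1 f -> smooth1 g -> smooth1 (fun x => f (g x))
| smooth1_antiderivative f f' : (forall x : R, is_derive x 1 f (f' x)) ->
   smooth1 f' -> smooth1 f.

Lemma smooth1_derive f : smooth1 f ->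
  exists2 f', smooth1 f' & forall x : R, is_derive x 1 f (f' x).
Proof.
elim=> {f}.
- by move=> c; exists (fun=> 0); [exact: smooth1_cst|move=> x; exact: is_derive_cst].
- by exists (fun=> 1); [exact: smooth1_cst|move=> x; exact: is_derive_id].
- move=> n; exists (fun x => flat n.+2 x + (- n%:R) * flat n.+1 x).
    apply: smooth1_add; first exact: smooth1_flat.
    by apply: smooth1_mul; [exact: smooth1_cst|exact: smooth1_flat].
  by move=> x; rewrite mulNr; exact: flat_derive.
- by exists expR; [exact: smooth1_exp|move=> x; exact: is_derive_expR].
- move=> f g _ [f' sf df] _ [g' sg dg]; exists (fun x => f' x + g' x).
    exact: smooth1_add.
  by move=> x; exact: (is_deriveD (df x) (dg x)).
- move=> f g sf [f' sf' df] sg [g' sg' dg].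
  exists (fun x => f x * g' x + g x * f' x).
    by apply: smooth1_add; apply: smooth1_mul.
  by move=> x; exact: (is_deriveM (df x) (dg x)).
- move=> f g sf [f' sf' df] sg [g' sg' dg].
  exists (fun x => f' (g x) * g' x).
    by apply: smooth1_mul => //; exact: smooth1_comp.
  by move=> x; exact: (is_derive1_comp (df (g x)) (dg x)).
- by move=> f f' df sf' _; exists f'.
Qed.

Lemma smooth1_derivable f (x : R) : smooth1 f -> derivable f x 1.
Proof. by move=> /smooth1_derive[f' _ df]; exact: ex_derive. Qed.

Lemma smooth1_is_derive f (x : R) : smooth1 f -> is_derive x 1 f (derive1 f x).
Proof.
by move=> sf; rewrite derive1E; apply/derivableP; exact: smooth1_derivable.
Qed.

Lemma smooth1_derive1 f : smooth1 f -> smooth1 (derive1 f).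
Proof.
move=> /smooth1_derive[f' sf' df]; rewrite (_ : derive1 f = f')//.
by apply/funext => x; rewrite derive1E; exact: derive_val.
Qed.

Lemma smooth1_continuous f : smooth1 f -> continuous f.
Proof.
move=> sf x; apply: differentiable_continuous; apply/derivable1_diffP.
exact: smooth1_derivable.
Qed.

End flat.

(** * Test functions on the line *)

Section test1.
Context {R : realType}.
Local Notation leb := (@lebesgue_measure R).
Local Notation IR := (@Rintegral _ (measurableTypeR R) R (@lebesgue_measure R) setT).
Implicit Types f g h : R -> R.

Definition test1 f := smooth1 f /\ exists A : R, forall x, A <= `|x| -> f x = 0.

Lemma measurable_of_continuous f : continuous f -> measurable_fun [set: measurableTypeR R] f.
Proof. exact: continuous_measurable_fun. Qed.

Lemma test1_continuous f : test1 f -> continuous f.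
Proof. by move=> [/smooth1_continuous]. Qed.

Lemma test1_bounded f : test1 f -> exists c, forall x, `|f x| <= c.
Proof.
move=> tf; have cf := test1_continuous tf; have [_ [A fA]] := tf.
have cn : {within `[- `|A|, `|A|], continuous (fun x => `|f x|)}.
  by apply: continuous_subspaceT => x; apply: cvg_norm; exact: cf.
have AA : - `|A| <= `|A| by have := normr_ge0 A; lra.
have [c _ hc] := EVT_max AA cn.
exists `|f c| => x; have [xA|xA] := leP A `|x|; first by rewrite fA// normr0.
apply: hc; rewrite in_itv/= -ler_norml.
by rewrite (le_trans (ltW xA))// ler_norm.
Qed.

Definition box (M : R) (x : R) : R := (`|x| <= M)%R%:R.

Lemma box_ge0 M x : 0 <= box M x. Proof. by rewrite /box; case: (`|x| <= M)%R. Qed.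
Lemma box_le1 M x : `|box M x| <= 1.
Proof. by rewrite /box; case: (`|x| <= M)%R; rewrite ?normr1 ?normr0. Qed.

Lemma box_in M x : `|x| <= M -> box M x = 1. Proof. by rewrite /box => ->. Qed.

Lemma boxE M : box M = \1_(`[- M, M] : set R).
Proof. by apply/funext => x; rewrite indicE mem_setE in_itv/= -ler_norml. Qed.

Lemma measurable_box M : measurable_fun [set: measurableTypeR R] (box M).
Proof. by rewrite boxE; exact: measurable_indic. Qed.

Lemma L1_box M : L1 leb (box M).
Proof.
rewrite boxE; have := integrable_indic_itv (- M) M true false.
by apply: eq_integrable.
Qed.

Lemma L1_supp f (M c : R) : measurable_fun [set: measurableTypeR R] f ->
  (forall x, `|f x| <= c) -> (forall x, M <= `|x| -> f x = 0) -> L1 leb f.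
Proof.
move=> mf fc fM; apply: (L1_le mf (L1Z c (L1_box M))) => x.
 have [xM|xM] := leP M `|x|.
  rewrite fM// normr0 mulr_ge0 ?box_ge0// (le_trans _ (fc x))//.
by rewrite box_in ?mulr1// ltW.
Qed.

Lemma test1_L1_cap_Loo f : test1 f -> L1_cap_Loo leb f.
Proof.
move=> tf; have [c fc] := test1_bounded tf; split; last by exists c.
have [_ [A fA]] := tf.
by apply: (L1_supp _ fc fA); apply: measurable_of_continuous; exact: test1_continuous.
Qed.

Lemma test1_derive f : test1 f -> test1 (derive1 f).
Proof.
move=> [sf [A fA]]; split; first exact: smooth1_derive1.
exists (`|A| + 1) => x xA.
have Ax : `|A| < `|x| by lra.
rewrite derive1E (@near_eq_derive _ _ _ _ (cst 0)) ?derive_cst//.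
near=> y; apply: fA; apply: (le_trans (ler_norm A)).
near: y; exact: (@cvgr_norm_ge _ _ _ _ _ id x cvg_id `|A| Ax).
Unshelve. all: by end_near. Qed.

Lemma test1_mul f g : test1 f -> smooth1 g -> test1 (fun x => f x * g x).
Proof.
move=> [sf [A fA]] sg; split; first exact: smooth1_mul.
by exists A => x xA; rewrite fA// mul0r.
Qed.

Lemma primD g h x : L1 leb g -> L1 leb h ->
  prim (fun t => g t + h t) x = prim g x + prim h x.
Proof.
move=> ig ih; rewrite /prim RintegralD//; exact: L1_within.
Qed.

Lemma primZ (c : R) g x : L1 leb g -> prim (fun t => c * g t) x = c * prim g x.
Proof. by move=> ig; rewrite /prim RintegralZl//; exact: L1_within. Qed.

(** Product rule for the absolutely continuous functions c1 + prim g and c2 +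
    prim h. *)
Lemma AC_mul c1 c2 g h x : L1 leb g -> L1 leb h ->
  (c1 + prim g x) * (c2 + prim h x) =
  c1 * c2 + prim (fun t => g t * (c2 + prim h t) + h t * (c1 + prim g t)) x.
Proof.
move=> ig ih.
have -> : (fun t => g t * (c2 + prim h t) + h t * (c1 + prim g t)) =
   (fun t => (c2 * g t + c1 * h t) + (g t * prim h t + h t * prim g t)).
  by apply/funext => t; ring.
rewrite primD; last 2 first.
- by apply: L1D; exact: L1Z.
- by apply: L1D; exact: L1_Mprim.
rewrite -prim_mul// primD ?primZ//; try exact: L1Z.
by ring.
Qed.

Lemma L1_AC c g h : L1 leb g -> L1 leb h -> L1 leb (fun t => g t * (c + prim h t)).
Proof.
move=> ig ih; under eq_fun do rewrite mulrDr mulrC.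
by apply: L1D; [exact: L1Z|exact: L1_Mprim].
Qed.

Lemma test1_prim f : test1 f -> forall x, f x = prim (derive1 f) x.
Proof.
move=> tf x; have [sf [A fA]] := tf.
have [i' _] := test1_L1_cap_Loo (test1_derive tf).
have cf' := test1_continuous (test1_derive tf).
have e := C1_prim (fun x => smooth1_is_derive x sf) cf' i'.
have [c0 _] : f 0 - prim (derive1 f) 0 = 0 /\ IR (derive1 f) = 0.
  apply: AC_L1_zero => //.
  by have [i _] := test1_L1_cap_Loo tf; apply: eq_integrable i => // y _ /=; rewrite -e.
by rewrite e c0 add0r.
Qed.

Lemma prim_by_parts c g f : L1 leb g -> test1 f ->
  IR (fun t => (c + prim g t) * derive1 f t + g t * f t) = 0.
Proof.
move=> ig tf.
have [i' _] := test1_L1_cap_Loo (test1_derive tf).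
have e := test1_prim tf.
have [i b] := test1_L1_cap_Loo tf.
pose k t := g t * (0 + prim (derive1 f) t) + derive1 f t * (c + prim g t).
have ik : L1 leb k by apply: L1D; exact: L1_AC.
have [] := @AC_L1_zero _ (c * 0) k ik.
  rewrite (_ : (fun x => _) = (fun t => f t * (c + prim g t))); first exact: L1_AC.
  apply/funext => t; rewrite e.
  by have := @AC_mul c 0 g (derive1 f) t ig i'; rewrite add0r mulrC => ->.
move=> _ <-; apply: eq_Rintegral => t _.
by rewrite /k add0r -e mulrC addrC.
Qed.

End test1.

(** * A countable family of test functions *)

Section bump.
Context {R : realType}.
Local Notation leb := (@lebesgue_measure R).
Local Notation IR := (@Rintegral _ (measurableTypeR R) R (@lebesgue_measure R) setT).
Implicit Types f g h w : R -> R.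

Definition bump_index : countType := (rat * rat * nat)%type.

(** For the index (a, b, n), a smooth function supported in [a, b] that
    increases to the indicator of ]a, b[ as n grows; the end points are
    rational to keep the family countable. *)
Definition bump (k : bump_index) (x : R) : R :=
  flat 0 (k.2.+1%:R * (x - ratr k.1.1)) * flat 0 (k.2.+1%:R * (ratr k.1.2 - x)).

Lemma smooth1_affine (a b : R) : smooth1 (fun x => a * x + b).
Proof.
apply: smooth1_add; last exact: smooth1_cst.
by apply: smooth1_mul; [exact: smooth1_cst|exact: smooth1_id].
Qed.

Lemma flat0_le1 (x : R) : flat 0 x <= 1.
Proof.
have [x0|x0] := ltP 0 x; last by rewrite flat_neg.
by rewrite flat_pos// expr0 mul1r expR_le1 oppr_le0 invr_ge0 ltW.
Qed.

Lemma smooth1_bump k : smooth1 (bump k).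
Proof.
apply: smooth1_mul.
- rewrite (_ : (fun x => _) = (fun x => flat 0 (k.2.+1%:R * x + (- (k.2.+1%:R * ratr k.1.1))))).
    by apply: (@smooth1_comp _ (flat 0)); [exact: smooth1_flat|exact: smooth1_affine].
  by apply/funext => x; rewrite mulrBr.
- rewrite (_ : (fun x => _) = (fun x => flat 0 (- k.2.+1%:R * x + k.2.+1%:R * ratr k.1.2))).
    by apply: (@smooth1_comp _ (flat 0)); [exact: smooth1_flat|exact: smooth1_affine].
  by apply/funext => x; rewrite mulrBr mulNr addrC.
Qed.

Lemma bump_ge0 k x : 0 <= bump k x.
Proof. by rewrite mulr_ge0 ?flat_ge0. Qed.

Lemma bump_le1 k x : bump k x <= 1.
Proof.
by rewrite -[leRHS]mulr1; apply: ler_pM; rewrite ?flat_ge0 ?flat0_le1.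
Qed.

Lemma bump_out k x : ~~ ((ratr k.1.1 < x) && (x < ratr k.1.2)) -> bump k x = 0.
Proof.
rewrite negb_and -!leNgt /bump => /orP[h|h].
  by rewrite flat_neg ?mul0r// pmulr_rle0 ?subr_le0.
by rewrite mulrC flat_neg ?mul0r// pmulr_rle0 ?subr_le0.
Qed.

Lemma test1_bump k : test1 (bump k).
Proof.
split; first exact: smooth1_bump.
exists (Num.max `|ratr k.1.1| `|ratr k.1.2|) => x; rewrite ge_max => /andP[h1 h2].
apply: bump_out; apply/negP => /andP[h3 h4].
have := ler_norm (ratr k.1.2 : R); have := ler_norm (- ratr k.1.1 : R); rewrite normrN.
have [x0|x0] := leP 0 x.
  by rewrite (ger0_norm x0) in h2; lra.
by rewrite (ltr0_norm x0) in h1; lra.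
Qed.

Lemma bump_cvg a b (x : R) :
  bump (a, b, n) x @[n --> \oo] --> (((ratr a < x) && (x < ratr b))%R%:R : R).
Proof.
have [/andP[ax xb]|h] := boolP (_ && _); last first.
  by under eq_cvg do rewrite bump_out//; exact: cvg_cst.
have key (y : R) : 0 < y -> flat 0 (n.+1%:R * y) @[n --> \oo] --> (1 : R).
  move=> y0; have : expR (- y^-1 * (n.+1%:R)^-1) @[n --> \oo] --> expR (- y^-1 * 0).
    apply: continuous_cvg; first exact: continuous_expR.
    by apply: cvgMr; exact: cvg_harmonic.
  rewrite mulr0 expR0; apply: cvg_trans; apply: near_eq_cvg; near=> n.
  by rewrite flat_pos ?mulr_gt0// expr0 mul1r invfM mulNr mulrC.
have xa : 0 < x - ratr a by rewrite subr_gt0.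
have bx : 0 < ratr b - x by rewrite subr_gt0.
have := cvgM (key _ xa) (key _ bx); rewrite mulr1 => h; exact: h.
Unshelve. all: by end_near. Qed.

Definition bump_mass k := IR (bump k).

Lemma bump_mass_gt0 (a b : rat) n : (ratr a : R) < ratr b -> 0 < bump_mass (a, b, n).
Proof.
move=> ab; rewrite lt0r RI_ge0 ?andbT; last exact: bump_ge0.
apply/eqP => e0.
have [i _] := test1_L1_cap_Loo (test1_bump (a, b, n)).
have := RI0_ae i (bump_ge0 _) e0.
have hp : forall x, (ratr a < x) && (x < ratr b) -> 0 < bump (a, b, n) x.
  move=> x /andP[ax xb].
  have fp (y : R) : 0 < y -> 0 < flat 0 y.
    by move=> y0; rewrite flat_pos// mulr_gt0 ?expR_gt0.
  by rewrite /bump /=; apply: mulr_gt0; apply: fp; rewrite mulr_gt0// subr_gt0.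
move=> [N [mN N0 hN]].
have : (leb `]ratr a, ratr b[ <= leb N)%E.
  apply: le_measure => //; rewrite ?inE//.
  move=> x /=; rewrite in_itv/= => xab; apply: hN => /= e1.
  by have := hp _ xab; rewrite e1 ltxx.
by rewrite N0 lebesgue_measure_itv/= lte_fin ab -EFinB lee_fin subr_le0 leNgt ab.
Qed.

Lemma RI_bump k : IR (bump k) = bump_mass k.
Proof. by []. Qed.

Definition test_index : countType := (bump_index + bump_index * bump_index)%type.

(** A combination of two bumps with integral 0, so that its primitive is again
    compactly supported. *)
Definition bump_diff (k l : bump_index) (x : R) := bump k x * bump_mass l - bump l x * bump_mass k.

(** The bumps serve the fundamental lemma. The primitives of bump_diff serve
    the lemma of du Bois-Reymond: testing a weak derivative on them shows that
    the function minus a primitive of its derivative has proportional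
    integrals against all bumps. *)
Definition test_fam (i : test_index) : R -> R :=
  match i with inl k => bump k | inr (k, l) => prim (bump_diff k l) end.

Lemma test1_bump_diff k l : test1 (bump_diff k l).
Proof.
have [_ [A hA]] := test1_bump k; have [_ [B hB]] := test1_bump l.
split.
  rewrite (_ : bump_diff k l = (fun x => bump k x * bump_mass l + bump l x * (- bump_mass k))).
    by apply: smooth1_add; apply: smooth1_mul; (exact: smooth1_cst || exact: smooth1_bump).
  by apply/funext => x; rewrite /bump_diff mulrN.
exists (Num.max A B) => x; rewrite ge_max => /andP[hx1 hx2].
by rewrite /bump_diff hA// hB// !mul0r subr0.
Qed.

Lemma L1_bump k : L1 leb (bump k).
Proof. by have [] := test1_L1_cap_Loo (test1_bump k). Qed.

Lemma RI_bump_diff k l : IR (bump_diff k l) = 0.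
Proof.
rewrite /bump_diff; under eq_Rintegral do rewrite mulrC [X in _ - X]mulrC.
rewrite RI_B; try by apply: L1Z; exact: L1_bump.
rewrite !RI_Z; try exact: L1_bump.
by rewrite !RI_bump mulrC subrr.
Qed.

Lemma test1_test_fam i : test1 (test_fam i).
Proof.
case: i => [k|[k l]] /=; first exact: test1_bump.
have td := test1_bump_diff k l; have [id _] := test1_L1_cap_Loo td.
have [sd [A hA]] := td.
split.
  apply: (smooth1_antiderivative _ sd) => x.
  by apply: prim_derive => //; exact: test1_continuous.
exists `|A| => x xA; have [x0|x0] := leP 0 x.
- have : IR (bump_diff k l) - prim (bump_diff k l) x = 0.
    rewrite primTB// (@eq_Rintegral _ _ _ _ _ (fun=> 0)) ?Rintegral_cst ?mul0r//.
    move=> t; rewrite inE/= in_itv/= andbT => xt; apply: hA.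
    rewrite (le_trans (ler_norm A))// (le_trans xA)// (ger0_norm x0).
    by rewrite (le_trans (ltW xt))// ler_norm.
  by rewrite RI_bump_diff sub0r => /eqP; rewrite oppr_eq0 => /eqP.
- rewrite /prim (@eq_Rintegral _ _ _ _ _ (fun=> 0)) ?Rintegral_cst ?mul0r//.
  move=> t; rewrite inE/= in_itv/= => xt; apply: hA.
  rewrite (le_trans (ler_norm A))// (le_trans xA)//.
  by rewrite (ltr0_norm x0) ler0_norm ?lerN2// (le_trans xt)// ltW.
Qed.

Lemma test_fam_derive k l x : derive1 (test_fam (inr (k, l))) x = bump_diff k l x.
Proof.
have td := test1_bump_diff k l; have [id _] := test1_L1_cap_Loo td.
rewrite derive1E; have h := prim_derive x id (test1_continuous td).
by apply: derive_val.
Qed.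

End bump.

(** * The fundamental lemma of the calculus of variations on the line *)

Section fundamental.
Context {R : realType}.
Local Notation leb := (@lebesgue_measure R).
Local Notation IR := (@Rintegral _ (measurableTypeR R) R (@lebesgue_measure R) setT).
Implicit Types f g h w : R -> R.

Definition loc_int w := measurable_fun [set: measurableTypeR R] w /\
  forall M : R, L1 leb (fun t => w t * box M t).

Lemma L1_cap_Loo_box (M : R) : L1_cap_Loo leb (box M).
Proof. by split; [exact: L1_box|exists 1; exact: box_le1]. Qed.

Lemma L1_plus_Loo_loc w : L1_plus_Loo leb w -> loc_int w.
Proof.
by move=> hw; split; [exact: L1_plus_Loo_meas hw|move=> M; apply: L1_Mplus_cap hw _; exact: L1_cap_Loo_box].
Qed.

Lemma loc_intB f g : loc_int f -> loc_int g -> loc_int (fun t => f t - g t).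
Proof.
move=> [mf fl] [mg gl]; split; first exact: measurable_funB.
by move=> M; under eq_fun do rewrite mulrBl; exact: L1B.
Qed.

Lemma loc_int_cst c : loc_int (fun=> c).
Proof. by split => // M; apply: L1Z; exact: L1_box. Qed.

Lemma L1_loc_int_test w f : loc_int w -> test1 f -> L1 leb (fun t => w t * f t).
Proof.
move=> [mw wl] tf; have [c fc] := test1_bounded tf; have [_ [A fA]] := tf.
rewrite (_ : (fun _ => _) = (fun t => w t * box A t * f t)); last first.
  apply/funext => t; have [tA|tA] := leP A `|t|; first by rewrite fA// !mulr0.
  by rewrite box_in ?mulr1// ltW.
apply: (L1_Mbnd (wl A) _ fc); apply: measurable_of_continuous; exact: test1_continuous.
Qed.

(** The bumps over ]a, b[ converge to its indicator, and the truncation of w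
    to a box dominates. *)
Lemma RI_rat_itv0 w (a b : rat) : loc_int w ->
  (forall k, IR (fun t => w t * bump k t) = 0) ->
  \int[leb]_(t in `](ratr a : R), ratr b[) w t = 0.
Proof.
move=> lw h.
have [mw wl] := lw.
pose M : R := Num.max `|ratr a| `|ratr b|.
have bM n t : `|bump (a, b, n) t| <= box M t.
  rewrite ger0_norm ?bump_ge0//.
  have [/andP[at_ tb]|] := boolP ((ratr a < t) && (t < ratr b)); last first.
    by move=> /(@bump_out _ (a, b, n)) ->; rewrite box_ge0.
  rewrite box_in ?bump_le1// /M le_max; have [t0|t0] := leP 0 t.
    by rewrite (ger0_norm t0) (le_trans (ltW tb) (ler_norm _)) orbT.
  rewrite (ltr0_norm t0) -normrN (le_trans _ (ler_norm (- _)))//.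
  by rewrite lerN2 ltW.
have : IR (fun t => w t * bump (a, b, n) t) @[n --> \oo] -->
       IR (fun t : R => w t * ((ratr a < t) && (t < ratr b))%R%:R).
  apply: (@RI_dominated _ _ _ (fun t => `|w t * box M t|)).
  - move=> n; apply: measurable_funM => //; apply: measurable_of_continuous; apply: test1_continuous.
    exact: test1_bump.
  - apply: measurable_funM => //; apply: measurable_bool_R.
    by rewrite [X in measurable X](_ : _ = `]ratr a, ratr b[%classic)// set_itvE.
  - by apply: L1_abs; exact: wl.
  - move=> n x; rewrite normrM [leRHS]normrM; apply: ler_wpM2l => //.
    by rewrite [leRHS](ger0_norm (box_ge0 _ _)); exact: bM.
  - move=> x; apply: cvgMr; exact: bump_cvg.
under eq_cvg do rewrite h.
move=> /(cvg_unique (@Rhausdorff R) (cvg_cst _)) e.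
rewrite Rintegral_mkcond e; apply: eq_Rintegral => t _.
by rewrite patchE_mul mem_setE in_itv.
Qed.

(** On the interval of truncation, the primitive of a truncation of w vanishes
    at all rationals, hence everywhere by continuity; by Lebesgue's
    differentiation theorem its derivative is w almost everywhere there. *)
Lemma fundamental_lemma1 w : loc_int w -> (forall k, IR (fun t => w t * bump k t) = 0) ->
  {ae leb, forall t, w t = 0}.
Proof.
move=> lw h; have [mw wl] := lw.
have hn : {ae leb, forall t, forall n : nat, `|t| < n%:R -> w t = 0}.
  apply/ae_foralln => n.
  pose W t := w t * box n%:R t.
  have iW : L1 leb W by exact: wl.
  have p0 : prim W (- n%:R) = 0.
    rewrite /prim -Rintegral_itv_bndo_bndc; last exact: L1_within.
    rewrite (@eq_Rintegral _ _ _ _ _ (fun=> 0)) ?Rintegral_cst ?mul0r//.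
    move=> t; rewrite inE/= in_itv/= => tn.
    rewrite /W /box (_ : (`|t| <= n%:R) = false) ?mulr0//.
    by apply/negbTE; rewrite -ltNge -normrN (lt_le_trans _ (ler_norm _))// ltrNr.
  have pq (q : rat) : `|ratr q : R| < n%:R -> prim W (ratr q) = 0.
    move=> qn; move: (qn); rewrite ltr_norml => /andP[nq qn'].
    rewrite -[LHS]subr0 -[in X in _ - X]p0 primB// ?ltW//.
    rewrite -Rintegral_itv_bndo_bndc; last exact: L1_within.
    have := @RI_rat_itv0 _ (- n%:R) q lw h.
    rewrite rmorphN/= ratr_nat => e; rewrite -[RHS]e.
    apply: eq_Rintegral => t; rewrite inE/= in_itv/= => /andP[t1 t2].
    rewrite /W box_in ?mulr1// ler_norml (ltW t1)/=.
    by rewrite (le_trans (ltW t2))// ltW.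
  have pz (x : R) : `|x| < n%:R -> prim W x = 0.
    move=> xn; apply: contrapT => /eqP px.
    have cp := @prim_continuous _ _ iW x.
    have n1 : \forall y \near x, prim W y != 0.
      by apply: (cvgr_neq0 _ cp).
    have n2 : \forall y \near x, `|y| < n%:R.
      exact: (@cvgr_norm_lt _ _ _ _ _ id x cvg_id n%:R xn).
    have [e /= e0 he] := (filterI n1 n2 : \forall y \near x, _ /\ _).
    have /rat_in_itvoo[q] : x < x + e by rewrite ltrDl.
    rewrite in_itv/= => /andP[q1 q2].
    have [] := he (ratr q).
      by rewrite /= distrC ger0_norm ?subr_ge0 ?ltW// ltrBlDl.
    by move=> /eqP + qn; rewrite pq.
  apply: ae_mono (prim_derive_ae iW) => x [_ dx] xn.
  have : (prim W)^`()%classic x = 0.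
    rewrite derive1E (@near_eq_derive _ _ _ _ (cst 0)) ?derive_cst//.
    have : \forall y \near x, `|y| < n%:R.
      exact: (@cvgr_norm_lt _ _ _ _ _ id x cvg_id n%:R xn).
    by apply: filterS => y; exact: pz.
  by rewrite dx /W box_in ?mulr1// ltW.
apply: ae_mono hn => t; apply; exact: (truncnS_gt `|t|).
Qed.

End fundamental.

(** * Weak derivatives on the line *)

Section weak1.
Context {R : realType}.
Local Notation leb := (@lebesgue_measure R).
Local Notation IR := (@Rintegral _ (measurableTypeR R) R (@lebesgue_measure R) setT).
Implicit Types f g h w : R -> R.

(** The primitive that vanishes at 0, defined for locally integrable
    functions, whereas prim integrates from -oo. *)
Definition prim0 g (x : R) : R :=
  if 0 <= x then \int[leb]_(t in `]0, x]) g t else - \int[leb]_(t in `]x, 0]) g t.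

Lemma prim0E g (M x : R) : loc_int g -> `|x| <= M ->
  prim0 g x = prim (fun t => g t * box M t) x - prim (fun t => g t * box M t) 0.
Proof.
move=> [mg gl] xM; rewrite /prim0; move: xM; rewrite ler_norml => /andP[x1 x2].
have [x0|x0] := leP 0 x.
- rewrite primB//; apply: eq_Rintegral => t; rewrite inE/= in_itv/= => /andP[t1 t2].
  by rewrite box_in ?mulr1// ler_norml; apply/andP; split; lra.
- rewrite -opprB primB// ?ltW//; congr (- _).
  apply: eq_Rintegral => t; rewrite inE/= in_itv/= => /andP[t1 t2].
  by rewrite box_in ?mulr1// ler_norml; apply/andP; split; lra.
Qed.

Lemma prim0_L1 g x : L1 leb g -> prim0 g x = prim g x - prim g 0.
Proof.
move=> ig; rewrite /prim0; have [x0|x0] := leP 0 x; first by rewrite primB.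
by rewrite -opprB primB// ltW.
Qed.

Lemma prim0_continuous g : loc_int g -> continuous (prim0 g).
Proof.
move=> lg x; have [mg gl] := lg.
have xn : `|x| < `|x| + 1 by rewrite ltrDl.
have := @prim_continuous _ _ (gl (`|x| + 1)) x.
set G := prim _ => cG.
have cG' : {for x, continuous (fun y => G y - G 0)}.
  by apply: cvgB => //; exact: cvg_cst.
have e : \forall y \near x, G y - G 0 = prim0 g y.
  have : \forall y \near x, `|y| < `|x| + 1.
    exact: (@cvgr_norm_lt _ _ _ _ _ id x cvg_id _ xn).
  by apply: filterS => y yn; rewrite (@prim0E _ (`|x| + 1))// ltW.
rewrite /continuous_at (@prim0E _ (`|x| + 1)) ?ltW//.
by apply: cvg_trans cG'; apply: near_eq_cvg.
Qed.

Lemma loc_int_prim0 g : loc_int g -> loc_int (prim0 g).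
Proof.
move=> lg; have mo := measurable_of_continuous (prim0_continuous lg); split => // M.
pose gM t := g t * box M t.
have iM : L1 leb gM by exact: lg.2.
rewrite (_ : (fun _ => _) = (fun t => box M t * (- prim gM 0 + prim gM t))).
  by apply: L1_AC => //; exact: L1_box.
apply/funext => t; rewrite /box; have [tM|tM] := leP `|t| M; last by rewrite mulr0 mul0r.
by rewrite (prim0E lg tM) mulr1 mul1r addrC.
Qed.

(** g is the weak derivative of f. The two pairings are put under one
    integral, so that Fubini is applied to a single integrand. *)
Definition weak_deriv f g := forall i, IR (fun t => f t * derive1 (test_fam i) t + g t * test_fam i t) = 0.

(** Subtract from f the primitive of g: the remainder w is orthogonal to all
    bump_diff, so w - c is orthogonal to all bumps, where c is the ratio of
    the integrals of w and of 1 against a fixed bump. *)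
Lemma du_bois_reymond f g : loc_int f -> loc_int g -> weak_deriv f g ->
  exists c, {ae leb, forall t, f t = c + prim0 g t}.
Proof.
move=> lf lg h; have lo := loc_int_prim0 lg.
pose w t := f t - prim0 g t.
have lw : loc_int w by exact: loc_intB.
have ort k l : IR (fun t => w t * bump_diff k l t) = 0.
  have tP := @test1_test_fam R (inr (k, l)); have td := test1_derive tP.
  have eP : derive1 (@test_fam R (inr (k, l))) = bump_diff k l by apply/funext; exact: test_fam_derive.
  move: (h (inr (k, l))); rewrite eP in td *; move: tP td eP.
  set P := test_fam _ => tP td eP h0.
  have [_ [A hA]] := tP; have [_ [B hB]] := td.
  pose M := Num.max A B.
  have hPo : IR (fun t => prim0 g t * bump_diff k l t + g t * P t) = 0.
    have := @prim_by_parts _ (- prim (fun t => g t * box M t) 0) _ P (lg.2 M) tP.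
    rewrite eP => e; rewrite -[RHS]e; apply: eq_Rintegral => t _.
    have [tM|tM] := leP M `|t|.
      by move: tM; rewrite ge_max => /andP[/hA -> /hB ->]; rewrite !mulr0.
    by rewrite (prim0E lg (ltW tM)) (box_in (ltW tM)) mulr1; congr (_ * _ + _); rewrite addrC.
  rewrite (_ : (fun t => _) = (fun t => (f t * bump_diff k l t + g t * P t) -
     (prim0 g t * bump_diff k l t + g t * P t))); last by apply/funext => t; rewrite /w; ring.
  rewrite RI_B ?h0 ?hPo ?subrr//; by apply: L1D; exact: L1_loc_int_test.
(* Any bump of positive mass serves to normalise; here the one over ]-1,
   1[. *)
pose k0 : bump_index := (- 1%:Q, 1%:Q, 0%N).
have J0 : 0 < bump_mass k0 :> R by apply: bump_mass_gt0; rewrite rmorphN rmorph1; lra.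
pose c := IR (fun t => w t * bump k0 t) / bump_mass k0.
exists c.
have lc : loc_int (fun t => w t - c) by apply: loc_intB => //; exact: loc_int_cst.
have : forall k, IR (fun t => (w t - c) * bump k t) = 0.
  move=> k.
  have iw l : L1 leb (fun t => w t * bump l t) by apply: L1_loc_int_test => //; exact: test1_bump.
  rewrite (_ : (fun t => _) = (fun t => w t * bump k t - c * bump k t)); last first.
    by apply/funext => t; rewrite mulrBl.
  rewrite RI_B ?RI_Z//; try exact: L1_bump; last by apply: L1Z; exact: L1_bump.
  have := ort k k0.
  rewrite (_ : (fun t => _) = (fun t => bump_mass k0 * (w t * bump k t) - bump_mass k * (w t * bump k0 t))); last first.
    by apply/funext => t; rewrite /bump_diff; ring.
  rewrite RI_B ?RI_Z//; try exact: L1Z.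
  rewrite RI_bump /c => /eqP; rewrite subr_eq0 => /eqP e.
  rewrite mulrAC mulrC [X in _ - _ * X]mulrC -e mulrA mulVf ?mul1r ?subrr//.
  by rewrite gt_eqF.
move=> /(fundamental_lemma1 lc); apply: ae_mono => t; rewrite /w => e; lra.
Qed.

(** Both f and its square are replaced by absolutely continuous
    representatives, for which the product rule holds. *)
Lemma weak_deriv_sq f g : measurable_fun [set: measurableTypeR R] f ->
  measurable_fun [set: measurableTypeR R] g ->
  L1 leb (fun t => f t ^+ 2) -> L1 leb (fun t => g t ^+ 2) ->
  weak_deriv f g -> weak_deriv (fun t => f t ^+ 2) (fun t => 2 * (f t * g t)).
Proof.
move=> mf mg f2 g2 h i.
have lf := L1_plus_Loo_loc (L2_L1_plus_Loo mf f2); have lg := L1_plus_Loo_loc (L2_L1_plus_Loo mg g2).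
have [c hc] := du_bois_reymond lf lg h.
have tP := @test1_test_fam R i; have td := test1_derive tP.
have [_ [A hA]] := tP; have [_ [B hB]] := td.
pose M := Num.max A B.
pose G t := g t * box M t.
have iG : L1 leb G := lg.2 M.
(* F is f on [-M, M], outside which the test function and its derivative
   vanish; truncating g to that interval makes its primitive globally
   defined. *)
pose F t := (c - prim G 0) + prim G t.
have cF : continuous F.
  by move=> t; apply: cvgD; [exact: cvg_cst|exact: (prim_continuous iG)].
have iH : L1 leb (fun t => G t * F t + G t * F t) by apply: L1D; exact: L1_AC.
have := prim_by_parts ((c - prim G 0) * (c - prim G 0)) iH tP.
set K := (fun t => _ + _) => eK; rewrite -[RHS]eK.
have eF t : F t * F t = (c - prim G 0) * (c - prim G 0) +
    prim (fun t => G t * F t + G t * F t) t by exact: AC_mul.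
have mT := measurable_of_continuous (test1_continuous tP); have mD := measurable_of_continuous (test1_continuous td).
apply: RI_ae.
- apply: measurable_funD; apply: measurable_funM => //; first exact: measurable_funX.
  by apply: measurable_funM => //; exact: measurable_funM.
- apply: measurable_funD; apply: measurable_funM => //.
    by apply: measurable_funD => //; exact: prim_measurable.
  exact: L1_meas iH.
apply: ae_mono hc => t ft; rewrite /K -eF.
have [tM|tM] := leP M `|t|.
  by move: tM; rewrite ge_max => /andP[/hA -> /hB ->]; rewrite !mulr0.
have -> : F t = f t by rewrite ft (prim0E lg (ltW tM)) /F; ring.
by rewrite /G box_in ?ltW// mulr1; ring.
Qed.

Lemma weak_deriv_prim f g : L1 leb f -> L1 leb g -> weak_deriv f g ->
  exists c, {ae leb, forall t, f t = c + prim g t}.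
Proof.
move=> fi gi h.
have Lo w : L1 leb w -> loc_int w.
  move=> iw; split; first exact: L1_meas iw.
  by move=> M; apply: (L1_Mbnd iw (measurable_box M) (@box_le1 _ M)).
have [c hc] := du_bois_reymond (Lo _ fi) (Lo _ gi) h.
exists (c - prim g 0); apply: ae_mono hc => t ->; rewrite prim0_L1//; ring.
Qed.

End weak1.

(** * The standard Gaussian on the line *)

Section gauss1.
Context {R : realType}.
Local Notation leb := (@lebesgue_measure R).
Local Notation IR := (@Rintegral _ (measurableTypeR R) R (@lebesgue_measure R) setT).

Definition gauss1 (t : R) : R := (2 * pi) `^ (- (1 / 2)) * expR (- (t ^+ 2 / 2)).

Lemma gauss1_cst_gt0 : 0 < (2 * pi : R) `^ (- (1 / 2)).
Proof. by rewrite powR_gt0// mulr_gt0// pi_gt0. Qed.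

Lemma gauss1_gt0 t : 0 < gauss1 t.
Proof. by rewrite mulr_gt0 ?gauss1_cst_gt0 ?expR_gt0. Qed.

Lemma gauss1_normal : gauss1 = normal_pdf 0 1.
Proof.
apply/funext => t; rewrite normal_pdfE ?oner_neq0//.
rewrite /gauss1 /normal_peak /normal_fun subr0 expr1n mul1r; congr (_ * expR _).
  rewrite powRN mul1r powR12_sqrt; last by rewrite mulr_ge0// pi_ge0.
  by rewrite mulr_natl.
by rewrite mulNr.
Qed.

Lemma L1_gauss1 : L1 leb gauss1.
Proof. rewrite gauss1_normal; apply: integrable_normal_pdf; exact: oner_neq0. Qed.

Lemma RI_gauss1 : IR gauss1 = 1.
Proof. by rewrite gauss1_normal /Rintegral integral_normal_pdf// oner_neq0. Qed.

Lemma gauss1_continuous : continuous gauss1.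
Proof. by rewrite gauss1_normal; apply: continuous_normal_pdf; exact: oner_neq0. Qed.

Lemma ln_gauss1 t : ln (gauss1 t) = ln (gauss1 0) - t ^+ 2 / 2.
Proof.
rewrite /gauss1 !lnM ?posrE ?expR_gt0 ?gauss1_cst_gt0// !expRK expr0n/=.
by rewrite mul0r oppr0 addr0.
Qed.

Definition gauss_cdf := prim gauss1.

Lemma gauss_cdf_derive (y : R) : is_derive y 1 gauss_cdf (gauss1 y).
Proof. by apply: prim_derive; [exact: L1_gauss1|exact: gauss1_continuous]. Qed.

Lemma gauss_cdf_continuous : continuous gauss_cdf.
Proof. exact: prim_continuous L1_gauss1. Qed.

Lemma gauss_cdf_lt a b : a < b -> gauss_cdf a < gauss_cdf b.
Proof.
move=> ab.
have [x _ e] := @MVT _ gauss_cdf gauss1 a b ab (fun x _ => gauss_cdf_derive x)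
  (continuous_subspaceT gauss_cdf_continuous).
by rewrite -subr_gt0 e mulr_gt0 ?gauss1_gt0 ?subr_gt0.
Qed.

Lemma gauss_cdf_inj : injective gauss_cdf.
Proof.
move=> x y e; apply: contrapT => /eqP.
by rewrite neq_lt => /orP[] /gauss_cdf_lt; rewrite e ltxx.
Qed.

Lemma gauss_cdf_surj z : 0 < z < 1 -> exists y, gauss_cdf y = z.
Proof.
move=> /andP[z0 z1].
have [a ha] : exists a, gauss_cdf a < z.
  have /cvgrPdist_lt/(_ _ z0)[N _ hN] := @prim_cvgNy _ _ L1_gauss1.
  exists (- N%:R); have := hN N (leqnn N).
  by rewrite sub0r normrN; apply: le_lt_trans; exact: ler_norm.
have [b hb] : exists b, z < gauss_cdf b.
  have e0 : 0 < 1 - z by rewrite subr_gt0.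
  have /cvgrPdist_lt/(_ _ e0)[N _ hN] := @prim_cvgy _ _ L1_gauss1.
  exists N%:R; have := hN N (leqnn N).
  rewrite RI_gauss1 => h; have := le_lt_trans (ler_norm _) h.
  by rewrite /gauss_cdf; lra.
have ab : a <= b.
  rewrite leNgt; apply/negP => /gauss_cdf_lt; lra.
have hv : Num.min (gauss_cdf a) (gauss_cdf b) <= z <= Num.max (gauss_cdf a) (gauss_cdf b).
  by rewrite ge_min le_max (ltW ha) (ltW hb) orbT.
have [c _ <-] := IVT ab (continuous_subspaceT gauss_cdf_continuous) hv.
by exists c.
Qed.

(** The inverse of the distribution function, with the default value 0 outside
    ]0, 1[. *)
Definition gauss_quantile (z : R) : R := xget 0 [set y | gauss_cdf y = z].

Lemma gauss_cdfK : cancel gauss_cdf gauss_quantile.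
Proof.
move=> y; rewrite /gauss_quantile; case: xgetP => [x _ /= /gauss_cdf_inj//|].
by move=> /(_ y) [].
Qed.

Lemma gauss_quantileK z : 0 < z < 1 -> gauss_cdf (gauss_quantile z) = z.
Proof. by move=> /gauss_cdf_surj[y <-]; rewrite gauss_cdfK. Qed.

Lemma gauss_quantile_derive (z : R) : 0 < z < 1 -> is_derive z 1 gauss_quantile (gauss1 (gauss_quantile z))^-1.
Proof.
move=> z01; rewrite -{1}(gauss_quantileK z01); apply: (@is_derive_inverse _ gauss_cdf).
- by near=> x; exact: gauss_cdfK.
- by near=> x; exact: gauss_cdf_continuous.
- exact: gauss_cdf_derive.
- by rewrite gt_eqF// gauss1_gt0.
Unshelve. all: by end_near. Qed.

Lemma gauss_quantile_le a b : 0 < a -> b < 1 -> a <= b -> gauss_quantile a <= gauss_quantile b.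
Proof.
move=> a0 b1 ab; rewrite leNgt; apply/negP => /gauss_cdf_lt.
rewrite !gauss_quantileK; last 2 first.
- by apply/andP; split; lra.
- by apply/andP; split; lra.
by lra.
Qed.

Lemma gauss1_inv_le (B x : R) : `|x| <= B -> (gauss1 x)^-1 <= (gauss1 B)^-1.
Proof.
move=> xB; rewrite lef_pV2 ?posrE ?gauss1_gt0// ler_pM2l ?gauss1_cst_gt0// ler_expR.
rewrite lerN2 ler_pM2r ?invr_gt0//.
by rewrite -(real_normK (num_real x)) ler_sqr ?nnegrE// (le_trans _ xB).
Qed.

End gauss1.

(** * The logarithmic Sobolev inequality on the line *)

Section ent.
Context {R : realType}.

(** The integrand a ln(a / b) - a + b of relative entropy. It is nonnegative
    for nonnegative a and positive b (entE); the maximum with 0 makes it so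
    everywhere, so that its integral is always defined, finite or not. *)
Definition ent (a b : R) : R := Num.max 0 (a * (ln a - ln b) - a + b).

Lemma ent_ge0 a b : 0 <= ent a b. Proof. by rewrite le_max lexx. Qed.

Lemma ln_le_sub1 (x : R) : 0 < x -> ln x <= x - 1.
Proof. by move=> x0; have := @le_ln1Dx R (x - 1); rewrite subrKC; apply; lra. Qed.

Lemma entE a b : 0 <= a -> 0 < b -> ent a b = a * (ln a - ln b) - a + b.
Proof.
rewrite le_eqVlt => /predU1P[<- b0|a0 b0].
  by rewrite /ent mul0r subr0 add0r; apply/max_idPr; exact: ltW.
apply/max_idPr.
have ba : 0 < b / a by rewrite divr_gt0.
have := ln_le_sub1 ba; rewrite ln_div ?posrE// => h.
have : a * (ln b - ln a) <= a * (b / a - 1) by rewrite ler_pM2l.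
have -> : a * (b / a - 1) = b - a by field; rewrite gt_eqF.
by rewrite !mulrBr; lra.
Qed.

Lemma measurable_ent d (T : measurableType d) (f g : T -> R) :
  measurable_fun setT f -> measurable_fun setT g ->
  measurable_fun setT (fun x => ent (f x) (g x)).
Proof.
move=> mf mg; apply: measurable_maxr => //.
have ml (h : T -> R) : measurable_fun setT h -> measurable_fun setT (fun x => ln (h x)).
  by move=> mh; apply: (measurableT_comp (@measurable_ln R) mh).
apply: measurable_funD => //; apply: measurable_funB => //; apply: measurable_funM => //.
by apply: measurable_funB; exact: ml.
Qed.

Lemma ge0_integral_le_RI d (T : measurableType d) (mu : {measure set T -> \bar R})
    (f : T -> \bar R) (g : T -> R) :
  measurable_fun setT f -> (forall x, 0 <= f x)%E -> L1 mu g ->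
  {ae mu, forall x, (f x <= (g x)%:E)%E} ->
  (\int[mu]_x f x <= (\int[mu]_x g x)%:E)%E.
Proof.
move=> mf f0 ig fg; have mg := L1_meas ig.
have mm : measurable_fun setT (fun x => Num.max 0 (g x)) by exact: measurable_maxr.
have e : {ae mu, forall x, g x = Num.max 0 (g x)}.
  by apply: ae_mono fg => x h; apply/esym/max_idPr; rewrite -lee_fin; exact: le_trans h.
rewrite (RI_ae mg mm e) -(L1_EFin (L1_ae ig mm e)).
apply: ae_ge0_le_integral => //.
- by move=> x _; rewrite lee_fin le_max lexx.
- exact/measurable_EFinP.
- by apply: ae_mono fg => x h _; rewrite (le_trans h)// lee_fin le_max lexx orbT.
Qed.

Lemma ge0_integral_le_RI_real d (T : measurableType d) (mu : {measure set T -> \bar R}) (f g : T -> R) :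
  measurable_fun setT f -> (forall x, 0 <= f x) -> L1 mu g ->
  {ae mu, forall x, f x <= g x} -> (\int[mu]_x (f x)%:E <= (\int[mu]_x g x)%:E)%E.
Proof.
move=> mf f0 ig fg; apply: ge0_integral_le_RI => //; first exact/measurable_EFinP.
Qed.

End ent.

Section lsi1.
Context {R : realType}.
Local Notation leb := (@lebesgue_measure R).
Local Notation IR := (@Rintegral _ (measurableTypeR R) R (@lebesgue_measure R) setT).
Variables (c : R) (h K : R -> R) (s : R).
Let M t := c + prim h t.
Hypothesis (hi : L1 leb h) (Mi : L1 leb M) (M0 : forall t, 0 <= M t).
Hypothesis (Ki : L1 leb K).
Hypothesis hK : {ae leb, forall t, forall tau, h t * tau <= M t * tau ^+ 2 / 2 + 2 * K t}.
Hypothesis (Mi2 : L1 leb (fun t => t ^+ 2 * M t)) (s0 : 0 < s).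
Let m := IR M.
Hypothesis m0 : 0 < m.

Let M_continuous : continuous M.
Proof. by move=> x; apply: cvgD; [exact: cvg_cst|exact: prim_continuous]. Qed.

Section transport.
Variables (al be : R).
Hypothesis (al0 : 0 < al) (albe : al < be) (be1 : be < 1).
Let Z := be - al.
Let z x := al + Z / m * prim M x.
Let Z0 : 0 < Z. Proof. by rewrite subr_gt0. Qed.

Let zP x : al <= z x <= be.
Proof.
have p0 : 0 <= prim M x by apply: Rintegral_ge0 => t _; exact: M0.
have pm : prim M x <= m.
  by rewrite -subr_ge0 primTB//; apply: Rintegral_ge0 => t _; exact: M0.
have Zm : 0 < Z / m by rewrite divr_gt0.
apply/andP; split; first by rewrite lerDl mulr_ge0// ltW.
rewrite /z -lerBrDl -/Z mulrAC ler_pdivrMr// ler_pM2l//.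
Qed.

Let z01 x : 0 < z x < 1.
Proof. by have /andP[h1 h2] := zP x; rewrite (lt_le_trans al0 h1) (le_lt_trans h2 be1). Qed.

(** The increasing map that pushes M / m forward to the Gaussian conditioned
    on the interval between its quantiles al and be. Away from the extreme
    quantiles T is bounded, which makes the integration by parts legitimate; Z
    is the mass of that interval. *)
Let T x := gauss_quantile (z x).
Let T' x := (gauss1 (T x))^-1 * (Z / m * M x).

Let T_derive (x : R) : is_derive x 1 T (T' x).
Proof.
have dz : is_derive x 1 z (Z / m * M x).
  have dp := prim_derive x Mi M_continuous.
  apply: (is_derive_eq (is_deriveD (is_derive_cst al x 1) (is_deriveZ (Z / m) dp))).
  by rewrite add0r.
exact: is_derive1_comp (gauss_quantile_derive (z01 x)) dz.
Qed.

Let T_continuous : continuous T.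
Proof.
move=> x; apply: differentiable_continuous; apply/derivable1_diffP.
by have := T_derive x => d; exact: ex_derive.
Qed.

Let B := `|gauss_quantile al| + `|gauss_quantile be|.

Let T_bound x : `|T x| <= B.
Proof.
have /andP[h1 h2] := zP x.
have l1 : gauss_quantile al <= T x by apply: gauss_quantile_le => //; exact: le_lt_trans h2 be1.
have l2 : T x <= gauss_quantile be by apply: gauss_quantile_le => //; exact: lt_le_trans al0 h1.
have := ler_norm (gauss_quantile be); have := ler_norm (- gauss_quantile al); rewrite normrN => n1 n2.
have := normr_ge0 (gauss_quantile al); have := normr_ge0 (gauss_quantile be).
by rewrite ler_norml /B => n3 n4; apply/andP; split; lra.
Qed.

Let T'_continuous : continuous T'.
Proof.
move=> x; apply: cvgM; last by apply: cvgMr; exact: M_continuous.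
apply: cvgV; first by rewrite gt_eqF// gauss1_gt0.
exact: (continuous_comp (@T_continuous x) (@gauss1_continuous R (T x))).
Qed.

Let T'_L1 : L1 leb T'.
Proof.
rewrite /T'; under eq_fun do rewrite mulrC.
apply: (@L1_Mbnd _ _ _ _ (gauss1 B)^-1).
- exact: L1Z.
- apply: measurable_of_continuous => x; apply: cvgV; first by rewrite gt_eqF// gauss1_gt0.
  exact: (continuous_comp (@T_continuous x) (@gauss1_continuous R (T x))).
- move=> x; rewrite ger0_norm; last by rewrite invr_ge0 ltW// gauss1_gt0.
  by apply: gauss1_inv_le; exact: T_bound.
Qed.

Let mT : measurable_fun [set: measurableTypeR R] T.
Proof. exact: measurable_of_continuous T_continuous. Qed.

Let hT_L1 : L1 leb (fun t => h t * T t).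
Proof. exact: L1_Mbnd hi mT T_bound. Qed.

Let TM_L1 : L1 leb (fun t => T' t * M t).
Proof. exact: L1_AC. Qed.

(** The function M T is integrable because T is bounded, so its derivative has
    integral 0. *)
Let RI_parts : IR (fun t => h t * T t + T' t * M t) = 0.
Proof.
have eT := C1_prim T_derive T'_continuous T'_L1.
set c2 := T 0 - prim T' 0 in eT.
have e : (fun t => h t * T t + T' t * M t) =
  (fun t => h t * (c2 + prim T' t) + T' t * (c + prim h t)).
  by apply/funext => t; rewrite eT.
have i : L1 leb (fun t => h t * T t + T' t * M t) by exact: L1D.
have [] := @AC_L1_zero _ (c * c2) _ i; last by [].
rewrite e; under eq_fun do rewrite -AC_mul//.
under eq_fun do rewrite -eT.
exact: L1_Mbnd Mi mT T_bound.
Qed.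

Let RHS t := s * (h t * T t + T' t * M t) + 2 * s ^+ 2 * K t + 2^-1 * (t ^+ 2 * M t)
  - (2 + ln s + ln Z) * M t + m * gauss1 t.

Let RHS_L1 : L1 leb RHS.
Proof.
apply: L1D; last by apply: L1Z; exact: L1_gauss1.
apply: L1B; last exact: L1Z.
apply: L1D; last exact: L1Z.
by apply: L1D; apply: L1Z => //; exact: L1D.
Qed.

Let RI_RHS : IR RHS = 2 * s ^+ 2 * IR K + 2^-1 * IR (fun t => t ^+ 2 * M t)
  - (1 + ln s + ln Z) * m.
Proof.
have i1 : L1 leb (fun t => h t * T t + T' t * M t) by exact: L1D.
rewrite RI_D; last 2 first.
- by apply: L1B; [apply: L1D; [apply: L1D|]|]; exact: L1Z.
- by apply: L1Z; exact: L1_gauss1.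
rewrite RI_B; last 2 first.
- by apply: L1D; [apply: L1D|]; exact: L1Z.
- exact: L1Z.
rewrite RI_D; last 2 first.
- by apply: L1D; exact: L1Z.
- exact: L1Z.
rewrite RI_D; try exact: L1Z.
rewrite (RI_Z m L1_gauss1) (RI_Z s i1) (RI_Z _ Ki) (RI_Z _ Mi2) (RI_Z _ Mi).
by rewrite RI_parts RI_gauss1 -/m; ring.
Qed.

(** The Jacobian equation gives ln M - ln m - ln (gauss1 t) = ln T' - T^2 / 2
    + t^2 / 2 - ln Z. The term in ln T' is bounded by the tangent of the
    logarithm at 1 / s, and Young's inequality bounds - s h T by M T^2 / 2 + 2
    s^2 K, whose first term cancels - M T^2 / 2. *)
Let ent_RHS t : (forall tau, h t * tau <= M t * tau ^+ 2 / 2 + 2 * K t) ->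
  ent (M t) (m * gauss1 t) <= RHS t.
Proof.
move=> hk.
have mg : 0 < m * gauss1 t by rewrite mulr_gt0 ?gauss1_gt0.
rewrite entE//.
have hT : - (s * (h t * T t)) <= 2^-1 * (M t * T t ^+ 2) + 2 * s ^+ 2 * K t.
  (* The choice of tau for which the hypothesis is Young's inequality. *)
  have := hk (- (T t / s)).
  have -> : h t * - (T t / s) = - (s * (h t * T t)) / s ^+ 2 by field; rewrite gt_eqF.
  have -> : M t * (- (T t / s)) ^+ 2 / 2 + 2 * K t =
    (2^-1 * (M t * T t ^+ 2) + 2 * s ^+ 2 * K t) / s ^+ 2 by field; rewrite gt_eqF.
  by rewrite ler_pM2r// invr_gt0 exprn_gt0.
have [e|M0'] : M t = 0 \/ 0 < M t.
  by have := M0 t; rewrite le_eqVlt => /predU1P[<-|]; [left|right].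
  rewrite /RHS e in hT *.
  rewrite !(mulr0, mul0r, addr0, add0r, subr0) in hT *.
  rewrite lerDr; lra.
have T'0 : 0 < T' t by rewrite /T' mulr_gt0 ?invr_gt0 ?gauss1_gt0// mulr_gt0// divr_gt0.
have gT := gauss1_gt0 (T t).
have eM : ln (M t) = ln (T' t) + ln (gauss1 (T t)) + ln m - ln Z.
  have -> : M t = T' t * gauss1 (T t) * m / Z.
    by rewrite /T'; field; rewrite !gt_eqF.
  move: T'0 gT; set a := T' t; set b := gauss1 (T t) => a0 b0.
  have ab0 : 0 < a * b by rewrite mulr_gt0.
  have abm0 : 0 < a * b * m by rewrite mulr_gt0.
  by rewrite ln_div ?posrE// lnM ?posrE// (@lnM _ a b) ?posrE.
have lT : ln (T' t) <= s * T' t - 1 - ln s.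
  have := @ln_le_sub1 R (s * T' t); rewrite lnM ?posrE// mulr_gt0// => /(_ isT); lra.
have lT2 : M t * ln (T' t) <= M t * (s * T' t - 1 - ln s) by rewrite ler_pM2l.
rewrite eM (@lnM _ m (gauss1 t)) ?posrE ?gauss1_gt0// (ln_gauss1 (T t)) (ln_gauss1 t) /RHS.
move: hT lT2; set Tt := T t; set T't := T' t; lra.
Qed.

(** The inequality with the additional error - m ln Z due to the
    conditioning. *)
Lemma lsi1_transport :
  (\int[leb]_t (ent (M t) (m * gauss1 t))%:E <=
   (2 * s ^+ 2 * IR K + 2^-1 * IR (fun t => (t ^+ 2 * M t)%R) - (1 + ln s + ln (be - al)) * m)%:E)%E.
Proof.
rewrite -/Z -RI_RHS; apply: ge0_integral_le_RI_real => //.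
- apply: measurable_ent; first exact: L1_meas Mi.
  by apply: measurable_funM => //; exact: L1_meas L1_gauss1.
- by move=> t; exact: ent_ge0.
- by apply: ae_mono hK => t; exact: ent_RHS.
Qed.

End transport.

(** Let the two quantiles tend to 0 and 1, that is Z to 1. *)
Lemma lsi1 :
  (\int[leb]_t (ent (M t) (m * gauss1 t))%:E <=
   (2 * s ^+ 2 * IR K + 2^-1 * IR (fun t => (t ^+ 2 * M t)%R) - (1 + ln s) * m)%:E)%E.
Proof.
apply/lee_addgt0Pr => e e0.
(* The central interval of mass Z lies between the quantiles (1 - Z) / 2 and
   (1 + Z) / 2; for this Z the error - m ln Z is exactly e. *)
pose Z := expR (- (e / m)).
have Z0 : 0 < Z by exact: expR_gt0.
have Z1 : Z < 1 by rewrite expR_lt1 oppr_lt0 divr_gt0.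
have a0 : 0 < (1 - Z) / 2 by lra.
have ab : (1 - Z) / 2 < (1 + Z) / 2 by lra.
have b1 : (1 + Z) / 2 < 1 by lra.
apply: (le_trans (lsi1_transport a0 ab b1)).
rewrite (_ : (1 + Z) / 2 - (1 - Z) / 2 = Z); last by field.
rewrite -EFinD lee_fin /Z expRK.
rewrite [X in _ <= X](_ : _ = 2 * s ^+ 2 * IR K + 2^-1 * IR (fun t => (t ^+ 2 * M t)%R) - (1 + ln s) * m + e / m * m).
  lra.
by rewrite divfK// gt_eqF.
Qed.

End lsi1.

Section weak_densities.
Context {R : realType}.
Local Notation leb := (@lebesgue_measure R).
Local Notation IR := (@Rintegral _ (measurableTypeR R) R (@lebesgue_measure R) setT).
Implicit Types f g h : R -> R.

(** Needed because the representative c + prim h agrees with the nonnegative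
    function M only almost everywhere. *)
Lemma continuous_ae_ge0 f : continuous f -> {ae leb, forall t, 0 <= f t} ->
  forall t, 0 <= f t.
Proof.
move=> cf [N [mN N0 hN]] t; rewrite leNgt; apply/negP => ft.
have : \forall y \near t, f y < 0 by exact: (@cvgr_lt _ _ _ _ f (f t) (cf t) 0 ft).
move=> [e /= e0 he].
have : (leb `](t - e)%R, (t + e)%R[ <= leb N)%E.
  apply: le_measure => //; rewrite ?inE// => y /=; rewrite in_itv/= => /andP[y1 y2].
  apply: hN => /=; apply/negP; rewrite -ltNge; apply: he => /=.
  by rewrite ltr_norml; apply/andP; split; lra.
rewrite N0 lebesgue_measure_itv/= lte_fin ifT; last by lra.
by rewrite -EFinB lee_fin leNgt; apply/negP/negPn; lra.
Qed.

(** The hypothesis relating h, M and K says that h^2 <= 4 M K, in the form of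
    a family of linear inequalities in (M, h, K); this form survives
    integration over slices and needs no division by M. *)
Lemma lsi1_weak (M h K : R -> R) s : L1 leb M -> L1 leb h -> L1 leb K ->
  (forall t, 0 <= M t) ->
  {ae leb, forall t, forall tau, h t * tau <= M t * tau ^+ 2 / 2 + 2 * K t} ->
  L1 leb (fun t => t ^+ 2 * M t) -> 0 < s -> 0 < IR M -> weak_deriv M h ->
  (\int[leb]_t (ent (M t) (IR M * gauss1 t))%:E <=
   (2 * s ^+ 2 * IR K + 2^-1 * IR (fun t => (t ^+ 2 * M t)%R) - (1 + ln s) * IR M)%:E)%E.
Proof.
move=> iM ih iK M0 hK iM2 s0 m0 wMh.
have [c hc] := weak_deriv_prim iM ih wMh.
pose F t := c + prim h t.
have cF : continuous F.
  by move=> t; apply: cvgD; [exact: cvg_cst|exact: (prim_continuous ih)].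
have mF := measurable_of_continuous cF; have mM := L1_meas iM.
have iF : L1 leb F := L1_ae iM mF hc.
have eF : IR M = IR F := RI_ae mM mF hc.
have F0 : forall t, 0 <= F t.
  by apply: continuous_ae_ge0 => //; apply: ae_mono hc => t e; rewrite /F -e.
have mt : measurable_fun [set: measurableTypeR R] (fun t : R => t ^+ 2).
  by apply: measurable_of_continuous; exact: exprn_continuous.
have hc2 : {ae leb, forall t : R, t ^+ 2 * M t = t ^+ 2 * F t}.
  by apply: ae_mono hc => t ->.
have mF2 : measurable_fun [set: measurableTypeR R] (fun t => t ^+ 2 * F t).
  exact: measurable_funM.
have hKF : {ae leb, forall t, forall tau, h t * tau <= F t * tau ^+ 2 / 2 + 2 * K t}.
  by apply: ae_mono2 hc hK => t e1 e2 tau; rewrite /F -e1; exact: e2.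
have m0F : 0 < IR F by rewrite -eF.
have := lsi1 ih iF F0 iK hKF (L1_ae iM2 mF2 hc2) s0 m0F.
rewrite -eF -(RI_ae (L1_meas iM2) mF2 hc2); apply: le_trans.
have mg f : measurable_fun [set: measurableTypeR R] f ->
    measurable_fun [set: measurableTypeR R] (fun t => (ent (f t) (IR M * gauss1 t))).
  move=> mf; apply: measurable_ent => //.
  by apply: measurable_funM => //; exact: L1_meas L1_gauss1.
rewrite (@ae_eq_integral _ _ _ leb setT (fun t => (ent (F t) (IR M * gauss1 t))%:E)) //.
- by apply/measurable_EFinP; exact: (mg _ mM).
- by apply/measurable_EFinP; exact: (mg _ mF).
- by apply: ae_mono hc => t -> _.
Qed.

(** The identity truncated at -N and N, as a primitive of an integrable
    function. *)
Let clip (N : R) (t : R) := prim (box N) t - prim (box N) 0.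

Let clip_le N t : `|clip N t| <= `|t|.
Proof.
have key a b : a <= b -> `|prim (box N) b - prim (box N) a| <= b - a.
  move=> ab; apply: le_trans (prim_dist (L1_box N) ab) _.
  rewrite (_ : b - a = \int[leb]_(x in `]a, b]) (fun=> 1) x); last first.
    rewrite Rintegral_cst//= lebesgue_measure_itv/= lte_fin mul1r.
    by case: ifPn => [//|]; rewrite -leNgt => ba /=; apply/eqP; rewrite subr_eq0 eq_le ab ba.
  apply: le_Rintegral => //.
  - by apply: L1_within => //; apply: L1_abs; exact: L1_box.
  - apply/integrableP; split; first exact/measurable_EFinP.
    rewrite /= normr1 integral_cst//= mul1e lebesgue_measure_itv/=.
    by case: ifP; rewrite ?ltry// -EFinB ltry.
  - by move=> x _; exact: box_le1.
have [t0|t0] := leP 0 t.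
  by rewrite (ger0_norm t0) -[leRHS]subr0; exact: key.
by rewrite (ltr0_norm t0) distrC -[leRHS]add0r; apply: key; exact: ltW.
Qed.

Let clip_in (N t : R) : `|t| <= N -> clip N t = t.
Proof.
move=> tN; have := @prim0E R (fun=> 1) N t (loc_int_cst 1) tN.
rewrite (_ : (fun x : R => 1 * box N x) = box N); last by apply/funext => x; rewrite mul1r.
rewrite -/(clip N t) => <-; rewrite /prim0.
have [t0|t0] := leP 0 t; rewrite Rintegral_cst//= lebesgue_measure_itv/= lte_fin mul1r.
- case: ifPn => [|]; first by rewrite -EFinB/= subr0.
  by rewrite -leNgt => t0'; apply/eqP; rewrite eq_le t0 t0'.
- by rewrite t0 -EFinB/= sub0r opprK.
Qed.

(** Integration by parts of t h(t). The weight t is first truncated to clip N,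
    since AC_L1_zero requires integrable functions; then N tends to
    infinity. *)
Lemma moment_identity1 (M h : R -> R) : L1 leb M -> L1 leb h -> weak_deriv M h ->
  L1 leb (fun t => t * h t) -> L1 leb (fun t => t ^+ 2 * M t) ->
  IR (fun t => t * h t) = - IR M.
Proof.
move=> iM ih wMh ith iM2.
have [c hc] := weak_deriv_prim iM ih wMh.
pose F t := c + prim h t.
have cF : continuous F.
  by move=> t; apply: cvgD; [exact: cvg_cst|exact: (prim_continuous ih)].
have mF := measurable_of_continuous cF; have mM := L1_meas iM.
have iF : L1 leb F := L1_ae iM mF hc.
have eF : IR M = IR F := RI_ae mM mF hc.
pose k (N : nat) t := h t * (- prim (box N%:R) 0 + prim (box N%:R) t) + box N%:R t * F t.
have kE N t : k N t = h t * clip N%:R t + box N%:R t * F t by rewrite /k /clip; ring.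
have mD N : measurable_fun [set: measurableTypeR R] (clip N).
  apply: measurable_funB => //; apply: prim_measurable; exact: L1_box.
have k0 N : IR (k N) = 0.
  have ik : L1 leb (k N).
    by apply: L1D; apply: L1_AC => //; exact: L1_box.
  have [] := @AC_L1_zero _ (c * (- prim (box N%:R) 0)) _ ik; last by [].
  rewrite (_ : (fun x => _) = (fun t => F t * (- prim (box N%:R) 0 + prim (box N%:R) t))); last first.
    by apply/funext => t; rewrite /F AC_mul//; exact: L1_box.
  have DC (t : R) : `|- prim (box N%:R) 0 + prim (box N%:R) t| <=
      `|prim (box N%:R : R -> R) 0| + IR (fun t => `|box N%:R t|).
    rewrite (le_trans (ler_normD _ _))// normrN lerD2l; apply: prim_le; exact: L1_box.
  apply: (L1_Mbnd iF _ DC); apply: measurable_funD => //; apply: prim_measurable.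
  exact: L1_box.
have : IR (k N) @[N --> \oo] --> IR (fun t => h t * t + F t).
  apply: (@RI_dominated _ _ _ (fun t => `|t * h t| + `|F t|)).
  - by move=> N; apply: L1_meas; apply: L1D; apply: L1_AC => //; exact: L1_box.
  - apply: measurable_funD => //; under eq_fun do rewrite mulrC; exact: L1_meas ith.
  - by apply: L1D; exact: L1_abs.
  - move=> N t; rewrite kE (le_trans (ler_normD _ _))// lerD//.
      by rewrite !normrM mulrC ler_wpM2r.
    by rewrite normrM ler_piMl// box_le1.
  - move=> t; apply: cvg_near_cst; near=> N.
    have tN : `|t| <= N%:R by near: N; exact: nbhs_infty_ger.
    by rewrite kE clip_in// box_in// mul1r.
under eq_cvg do rewrite k0.
move=> /(cvg_unique (@Rhausdorff R) (cvg_cst _)).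
rewrite RI_D//; last by under eq_fun do rewrite mulrC.
move=> e; rewrite (_ : (fun t => t * h t) = (fun t => h t * t)); last first.
  by apply/funext => t; rewrite mulrC.
by rewrite eF; apply/eqP; rewrite -addr_eq0 -e.
Unshelve. all: by end_near. Qed.

End weak_densities.

(** * Slices and tensor products *)

Section slices.
Context {R : realType} {n : nat}.
Local Notation leb := (@lebesgue_measure R).
Local Notation Leb := (@lebesgue_rV R).
Local Notation IR := (@Rintegral _ (measurableTypeR R) R (@lebesgue_measure R) setT).

Lemma measurable_RI_slice (f : 'rV[R]_n.+1 -> R) : measurable_fun setT f ->
  measurable_fun [set: measurableTypeR R] (fun t => \int[Leb n]_x f (consv t x)).
Proof.
move=> mf; apply: (measurableT_comp (f := fine)) => //.
have mf' : measurable_fun setT (EFin \o f) by exact/measurable_EFinP.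
rewrite (_ : (fun t => _) = (fun t => \int[Leb n]_x (EFin \o f)^\+%E (consv t x) -
    \int[Leb n]_x (EFin \o f)^\-%E (consv t x))%E); last first.
  apply/funext => t; rewrite integralE.
  by rewrite -[fun x => (f (consv t x))%:E]/((EFin \o f) \o consv t) funepos_comp funeneg_comp.
apply: emeasurable_funB; apply: measurable_tonelli_slice => //.
  exact: measurable_funepos.
exact: measurable_funeneg.
Qed.

Lemma measurable_RI_line (f : 'rV[R]_n.+1 -> R) : measurable_fun setT f ->
  measurable_fun setT (fun x => IR (fun t => f (consv t x))).
Proof.
move=> mf; apply: (measurableT_comp (f := fine)) => //.
have mf' : measurable_fun setT (EFin \o f) by exact/measurable_EFinP.
have tm (g : 'rV[R]_n.+1 -> \bar R) : measurable_fun setT g -> (forall x, 0 <= g x)%E ->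
    measurable_fun setT (fun x => \int[leb]_t g (consv t x))%E.
  move=> mg g0.
  exact: (measurable_fun_fubini_tonelli_G (g \o rV_cons) (measurable_comp_rV_cons mg) (fun=> g0 _)).
rewrite (_ : (fun t => _) = (fun x => \int[leb]_t (EFin \o f)^\+%E (consv t x) -
    \int[leb]_t (EFin \o f)^\-%E (consv t x))%E); last first.
  apply/funext => x; rewrite integralE.
  by rewrite -[fun t => (f (consv t x))%:E]/((EFin \o f) \o (consv ^~ x)) funepos_comp funeneg_comp.
apply: emeasurable_funB; apply: tm => //.
  exact: measurable_funepos.
exact: measurable_funeneg.
Qed.

Lemma ae_le_slices (f g : 'rV[R]_n.+1 -> R) :
  measurable_fun setT f -> measurable_fun setT g ->
  {ae Leb n.+1, forall x, f x <= g x} ->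
  {ae leb, forall t, {ae Leb n, forall x, f (consv t x) <= g (consv t x)}}.
Proof.
move=> mf mg h.
have mm : measurable_fun setT (fun x => Num.max (f x) (g x)) by exact: measurable_maxr.
have := @ae_eq_slices _ _ _ _ mm mg.
have -> : {ae Leb n.+1, forall x, Num.max (f x) (g x) = g x} = True.
  by rewrite propeqE; split => // _; apply: ae_mono h => x /max_idPr.
by move=> /(_ Logic.I); apply: ae_mono => t; apply: ae_mono => x /max_idPr.
Qed.

Lemma L1_plus_Loo_slice (w : 'rV[R]_n.+1 -> R) : L1_plus_Loo (Leb n.+1) w ->
  {ae leb, forall t, L1_plus_Loo (Leb n) (fun x => w (consv t x))}.
Proof.
move=> [mw [A [c [iA c0 wA]]]].
have mA := L1_meas iA.
have [iAt _ _] := fubini_slice iA.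
have mw' : measurable_fun setT (fun x => `|w x|) by apply: measurableT_comp.
have mA' : measurable_fun setT (fun x => A x + c) by exact: measurable_funD.
apply: ae_mono2 iAt (ae_le_slices mw' mA' wA) => t iAt h.
split; first exact: measurable_slice.
by exists (fun x => A (consv t x)), c; split.
Qed.

Lemma L1_plus_Loo_RI_slice (w : 'rV[R]_n.+1 -> R) (psi : 'rV[R]_n -> R) :
  L1_plus_Loo (Leb n.+1) w -> L1_cap_Loo (Leb n) psi ->
  L1_plus_Loo leb (fun t => \int[Leb n]_x (w (consv t x) * psi x)).
Proof.
move=> hw [ipsi [C hC]]; have mpsi := L1_meas ipsi.
have [mw [A [c [iA c0 wA]]]] := hw.
have mA := L1_meas iA; have iA' := L1_abs iA.
have mw' : measurable_fun setT (fun x => `|w x|) by apply: measurableT_comp.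
have mA' : measurable_fun setT (fun x => A x + c) by exact: measurable_funD.
split.
  pose u (x : 'rV[R]_n.+1) := psi (\row_j x 0 (lift ord0 j)).
  have mu : measurable_fun [set: 'rV[R]_n.+1] u.
    apply: (measurableT_comp (f := psi)) => //.
    apply: measurable_fun_rVP => j; under eq_fun do rewrite mxE.
    exact: measurable_coord.
  have := @measurable_RI_slice (fun x : 'rV[R]_n.+1 => w x * u x) (measurable_funM mw mu).
  congr measurable_fun; apply/funext => t; apply: eq_Rintegral => x _.
  by congr (_ * psi _); apply/rowP => j; rewrite mxE consvS.
have [iAt iA2 _] := fubini_slice iA'.
exists (fun t => C * \int[Leb n]_x `|A (consv t x)|), (c * \int[Leb n]_x `|psi x|).
split; first exact: L1Z.
  by rewrite mulr_ge0// RI_ge0.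
apply: ae_mono2 iAt (ae_le_slices mw' mA' wA) => t iAt h.
have ij : L1 (Leb n) (fun x => C * `|A (consv t x)| + c * `|psi x|).
  by apply: L1D; apply: L1Z => //; exact: L1_abs.
have hb : {ae Leb n, forall x, `|w (consv t x) * psi x| <= C * `|A (consv t x)| + c * `|psi x|}.
  apply: ae_mono h => x hx; rewrite normrM.
  apply: (@le_trans _ _ ((`|A (consv t x)| + c) * `|psi x|)).
    by rewrite ler_wpM2r// (le_trans hx)// lerD2r ler_norm.
  by rewrite mulrDl lerD2r mulrC ler_wpM2r.
have mwp : measurable_fun setT (fun x => w (consv t x) * psi x).
  by apply: measurable_funM => //; exact: measurable_slice.
have iw : L1 (Leb n) (fun x => w (consv t x) * psi x) := L1_le_ae mwp ij hb.
apply: le_trans (RI_abs iw) _.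
rewrite -lee_fin.
have mab : measurable_fun setT (fun x => `|w (consv t x) * psi x|) by apply: measurableT_comp.
have := ge0_integral_le_RI_real mab (fun=> normr_ge0 _) ij hb.
rewrite (L1_EFin (L1_abs iw)) => /le_trans; apply.
rewrite lee_fin RI_D ?RI_Z//; try exact: L1_abs.
- by apply: L1Z.
- by apply: L1Z; exact: L1_abs.
Qed.

End slices.

Section products.
Context {R : realType}.
Local Notation leb := (@lebesgue_measure R).
Local Notation Leb := (@lebesgue_rV R).
Local Notation IR := (@Rintegral _ (measurableTypeR R) R (@lebesgue_measure R) setT).

Definition prodf n (F : 'I_n -> R -> R) (x : 'rV[R]_n) : R :=
  \prod_(i < n) F i (x 0 i).

Lemma prodf_consv n (F : 'I_n.+1 -> R -> R) t (x : 'rV[R]_n) :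
  prodf F (consv t x) = F ord0 t * prodf (fun j => F (lift ord0 j)) x.
Proof.
rewrite /prodf big_ord_recl consv0; congr (_ * _).
by apply: eq_bigr => j _; rewrite consvS.
Qed.

Lemma RI_Leb0 (f : 'rV[R]_0 -> R) : measurable_fun setT f ->
  L1 (Leb 0) f /\ \int[Leb 0]_x f x = f 0.
Proof.
move=> mf; have mf' : measurable_fun setT (EFin \o f) by exact/measurable_EFinP.
split.
  apply/integrableP; split=> //; rewrite integral_dirac//=; last first.
    by apply/measurable_EFinP; apply: measurableT_comp.
  by rewrite diracT mul1e ltry.
by rewrite /Rintegral integral_dirac// diracT mul1e.
Qed.

Lemma L1_cap_Loo_consv n (f : R -> R) (g : 'rV[R]_n -> R) (h : 'rV[R]_n.+1 -> R) :
  L1_cap_Loo leb f -> L1_cap_Loo (Leb n) g -> (forall t x, h (consv t x) = f t * g x) ->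
  measurable_fun setT h -> L1_cap_Loo (Leb n.+1) h.
Proof.
move=> [fi [cf hf]] [gi [cg hg]] hE mh; split.
  apply/(L1_consv mh); have := L1_prod fi gi.
  by congr L1; apply/funext => -[t x]; rewrite hE.
exists (cf * cg) => x; have -> : x = consv (rV_uncons x).1 (rV_uncons x).2.
  apply/rowP => i; case: (unliftP ord0 i) => [j|] ->; first by rewrite consvS mxE.
  by rewrite consv0.
by rewrite hE normrM ler_pM.
Qed.

Lemma measurable_prodf n (F : 'I_n -> R -> R) :
  (forall i, measurable_fun [set: measurableTypeR R] (F i)) -> measurable_fun setT (prodf F).
Proof.
move=> mF; apply: measurable_prod => i _.
exact: (measurableT_comp (mF i) (measurable_coord i)).
Qed.

Lemma L1_cap_Loo_prodf n (F : 'I_n -> R -> R) : (forall i, L1_cap_Loo leb (F i)) -> L1_cap_Loo (Leb n) (prodf F).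
Proof.
elim: n F => [|n IH] F bF.
  have [i _] := RI_Leb0 (measurable_prodf (fun i => L1_cap_Loo_meas (bF i))).
  split => //; exists 1 => x; by rewrite /prodf big_ord0 normr1.
apply: (L1_cap_Loo_consv (bF ord0) (IH (fun j => F (lift ord0 j)) _)).
- by move=> j; exact: bF.
- by move=> t x; exact: prodf_consv.
- by apply: measurable_prodf => i; exact: L1_cap_Loo_meas (bF i).
Qed.

End products.

(** * Weak partial derivatives against product test functions *)

Section weakn.
Context {R : realType}.
Local Notation leb := (@lebesgue_measure R).
Local Notation Leb := (@lebesgue_rV R).
Local Notation IR := (@Rintegral _ (measurableTypeR R) R (@lebesgue_measure R) setT).

Definition test_prod n (ka : n.-tuple test_index) : 'rV[R]_n -> R :=
  prodf (fun j => test_fam (tnth ka j)).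
Definition dtest_prod n (i : 'I_n) (ka : n.-tuple test_index) : 'rV[R]_n -> R :=
  prodf (fun j => if j == i then derive1 (test_fam (tnth ka j)) else test_fam (tnth ka j)).

Lemma test_prod_consv n a (ka : n.-tuple test_index) t x :
  test_prod [tuple of a :: ka] (consv t x) = test_fam a t * test_prod ka x.
Proof.
rewrite /test_prod prodf_consv tnth0; congr (_ * prodf _ _).
by apply/funext => j; rewrite tnthS.
Qed.

Lemma dtest_prod_consv0 n a (ka : n.-tuple test_index) t x :
  dtest_prod ord0 [tuple of a :: ka] (consv t x) = derive1 (test_fam a) t * test_prod ka x.
Proof.
rewrite /dtest_prod prodf_consv tnth0 eqxx; congr (_ * prodf _ _).
by apply/funext => j; rewrite tnthS.
Qed.

Lemma dtest_prod_consvS n i a (ka : n.-tuple test_index) t x :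
  dtest_prod (lift ord0 i) [tuple of a :: ka] (consv t x) = test_fam a t * dtest_prod i ka x.
Proof.
rewrite /dtest_prod prodf_consv tnth0; congr (_ * prodf _ _).
by apply/funext => j; rewrite tnthS (inj_eq lift_inj).
Qed.

Lemma L1_cap_Loo_test_prod n (ka : n.-tuple test_index) : L1_cap_Loo (Leb n) (test_prod ka).
Proof. by apply: L1_cap_Loo_prodf => j; apply: test1_L1_cap_Loo; exact: test1_test_fam. Qed.

Lemma L1_cap_Loo_dtest_prod n i (ka : n.-tuple test_index) : L1_cap_Loo (Leb n) (dtest_prod i ka).
Proof.
apply: L1_cap_Loo_prodf => j; case: ifP => _; apply: test1_L1_cap_Loo; last exact: test1_test_fam.
by apply: test1_derive; exact: test1_test_fam.
Qed.

(** By induction on n: for each of countably many test products in the last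
    coordinates, the partial integral vanishes for almost every t by the lemma
    on the line. *)
Lemma fundamental_lemma n (w : 'rV[R]_n -> R) : L1_plus_Loo (Leb n) w ->
  (forall ka, \int[Leb n]_x (w x * test_prod ka x) = 0) -> {ae Leb n, forall x, w x = 0}.
Proof.
elim: n w => [|n IH] w lw h.
  apply: aeW => x; rewrite (thinmx0 x).
  have [i b] := L1_cap_Loo_test_prod [tuple].
  have := h [tuple]; have [_ ->] := RI_Leb0 (measurable_funM (L1_plus_Loo_meas lw) (L1_meas i)).
  by rewrite /= /test_prod /prodf big_ord0 mulr1.
have mw := L1_plus_Loo_meas lw.
apply: ae_eq_of_slices => //.
(* The exceptional null sets of t, one for each ka, are gathered by
   countability. *)
have key : {ae leb, forall t, forall ka : n.-tuple test_index,
    \int[Leb n]_x (w (consv t x) * test_prod ka x) = 0}.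
  apply: ae_countable => ka; apply: fundamental_lemma1.
    by apply: L1_plus_Loo_loc; apply: L1_plus_Loo_RI_slice => //; exact: L1_cap_Loo_test_prod.
  move=> k; have := h [tuple of inl k :: ka].
  have iw := L1_Mplus_cap lw (L1_cap_Loo_test_prod [tuple of inl k :: ka]).
  have [it i2 <-] := fubini_slice iw.
  move=> <-; apply: RI_ae.
  - apply: measurable_funM.
      by apply: L1_plus_Loo_meas; apply: L1_plus_Loo_RI_slice lw _; exact: L1_cap_Loo_test_prod.
    by apply: measurable_of_continuous; apply: test1_continuous; exact: test1_bump.
  - exact: L1_meas i2.
  apply: ae_mono (L1_plus_Loo_slice lw) => t lt.
  have il := L1_Mplus_cap lt (L1_cap_Loo_test_prod ka).
  rewrite mulrC -RI_Z//; apply: eq_Rintegral => x _.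
  by rewrite test_prod_consv mulrCA.
by apply: ae_mono2 (L1_plus_Loo_slice lw) key => t lt ht; exact: IH.
Qed.

(** k is the i-th weak partial derivative of v, tested on the countable family
    of products. *)
Definition weak_partial n (i : 'I_n) (v k : 'rV[R]_n -> R) := forall ka,
  \int[Leb n]_x (v x * dtest_prod i ka x + k x * test_prod ka x) = 0.

Lemma L1_weak_partial n (i : 'I_n) ka (v k : 'rV[R]_n -> R) : L1_plus_Loo (Leb n) v -> L1_plus_Loo (Leb n) k ->
  L1 (Leb n) (fun x => v x * dtest_prod i ka x + k x * test_prod ka x).
Proof.
by move=> lv lk; apply: L1D; apply: L1_Mplus_cap => //; [exact: L1_cap_Loo_dtest_prod|exact: L1_cap_Loo_test_prod].
Qed.

(** A test product splits into a function of the first coordinate and a test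
    product of the last ones; the fundamental lemma on the line removes the
    former. *)
Lemma weak_partial_slice n (j : 'I_n) (v k : 'rV[R]_n.+1 -> R) :
  L1_plus_Loo (Leb n.+1) v -> L1_plus_Loo (Leb n.+1) k -> weak_partial (lift ord0 j) v k ->
  {ae leb, forall t, weak_partial j (fun x => v (consv t x)) (fun x => k (consv t x))}.
Proof.
move=> lv lk h; apply: ae_countable => ka.
pose V t := \int[Leb n]_x (v (consv t x) * dtest_prod j ka x).
pose U t := \int[Leb n]_x (k (consv t x) * test_prod ka x).
have lV : L1_plus_Loo leb V by apply: L1_plus_Loo_RI_slice => //; exact: L1_cap_Loo_dtest_prod.
have lU : L1_plus_Loo leb U by apply: L1_plus_Loo_RI_slice => //; exact: L1_cap_Loo_test_prod.
have LLD : loc_int (fun t => V t + U t).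
  have [mV hV] := L1_plus_Loo_loc lV; have [mU hU] := L1_plus_Loo_loc lU.
  split; first exact: measurable_funD.
  by move=> M; under eq_fun do rewrite mulrDl; exact: L1D.
have e : {ae leb, forall t, V t + U t = 0}.
  apply: fundamental_lemma1 => // b.
  have [it i2 e2] := fubini_slice (L1_weak_partial (lift ord0 j) [tuple of inl b :: ka] lv lk).
  rewrite -[RHS](h [tuple of inl b :: ka]) -e2; apply: RI_ae.
  - apply: measurable_funM; first exact: LLD.1.
    by apply: measurable_of_continuous; apply: test1_continuous; exact: test1_bump.
  - exact: L1_meas i2.
  apply: ae_mono2 (L1_plus_Loo_slice lv) (L1_plus_Loo_slice lk) => t lvt lkt.
  have il := L1_Mplus_cap lvt (L1_cap_Loo_dtest_prod j ka); have il' := L1_Mplus_cap lkt (L1_cap_Loo_test_prod ka).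
  rewrite /V /U -RI_D// mulrC -RI_Z//; last exact: L1D.
  by apply: eq_Rintegral => x _; rewrite test_prod_consv dtest_prod_consvS /=; ring.
have lvk := ae_mono2 (fun t => @conj _ _) (L1_plus_Loo_slice lv) (L1_plus_Loo_slice lk).
apply: ae_mono2 e lvk => t <- [lvt lkt].
by rewrite RI_D//; apply: L1_Mplus_cap => //; [exact: L1_cap_Loo_dtest_prod|exact: L1_cap_Loo_test_prod].
Qed.

Section head.
Variables (n : nat) (v k : 'rV[R]_n.+1 -> R).
Hypothesis (mv : measurable_fun setT v) (mk : measurable_fun setT k).
Hypothesis (v2 : L1 (Leb n.+1) (fun x => v x ^+ 2)) (k2 : L1 (Leb n.+1) (fun x => k x ^+ 2)).
Hypothesis hw : weak_partial ord0 v k.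

Let good x := [/\ measurable_fun [set: measurableTypeR R] (fun t => v (consv t x)),
  measurable_fun [set: measurableTypeR R] (fun t => k (consv t x)),
  L1 leb (fun t => v (consv t x) ^+ 2) & L1 leb (fun t => k (consv t x) ^+ 2)].

Let good_ae : {ae Leb n, forall x, good x}.
Proof.
have [h1 _ _] := fubini_line v2; have [h2 _ _] := fubini_line k2.
by apply: ae_mono2 h1 h2 => x ? ?; split=> //; exact: measurable_line.
Qed.

(** As for slices, with the roles of the first and of the last coordinates
    exchanged: here the fundamental lemma in n variables removes the test
    product. *)
Lemma weak_deriv_line : {ae Leb n, forall x, weak_deriv (fun t => v (consv t x)) (fun t => k (consv t x))}.
Proof.
apply: ae_countable => i.
have lv := L2_L1_plus_Loo mv v2; have lk := L2_L1_plus_Loo mk k2.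
have tT := @test1_test_fam R i; have tD := test1_derive tT.
have bT := test1_L1_cap_Loo tT; have bD := test1_L1_cap_Loo tD.
pose E x := IR (fun t => v (consv t x) * derive1 (test_fam i) t + k (consv t x) * test_fam i t).
pose t0 (x : 'rV[R]_n.+1) : R := x 0 ord0.
have mt0 (f : R -> R) : measurable_fun [set: measurableTypeR R] f ->
    measurable_fun [set: 'rV[R]_n.+1] (fun x => f (t0 x)).
  by move=> mf; rewrite /t0; apply: (measurableT_comp mf); exact: measurable_coord.
have mE : measurable_fun setT E.
  pose F (x : 'rV[R]_n.+1) := v x * derive1 (test_fam i) (t0 x) + k x * test_fam i (t0 x).
  rewrite (_ : E = (fun x => IR (fun t => F (consv t x)))); last first.
    by apply/funext => x; apply: eq_Rintegral => t _; rewrite /F /t0 consv0.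
  apply: measurable_RI_line.
  apply: measurable_funD; apply: measurable_funM => //; apply: mt0.
    exact: L1_cap_Loo_meas bD.
  exact: L1_cap_Loo_meas bT.
have [i1 j1 _] := fubini_line v2; have [i2 j2 _] := fubini_line k2.
have lE : L1_plus_Loo (Leb n) E.
  split => //.
  have [c1 hc1] := bD.2; have [c2 hc2] := bT.2.
  pose a := IR (fun t => `|derive1 (test_fam i) t|); pose b := IR (fun t => `|test_fam i t|).
  exists (fun x => `|c1| * IR (fun t => v (consv t x) ^+ 2) + `|c2| * IR (fun t => k (consv t x) ^+ 2)), (a + b).
  split; first by apply: L1D; exact: L1Z.
    by apply: addr_ge0; apply: RI_ge0.
  apply: ae_mono good_ae => x [mvx mkx v2x k2x].
  have il : L1 leb (fun t => v (consv t x) * derive1 (test_fam i) t) by apply: L1_Mplus_cap => //; exact: L2_L1_plus_Loo.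
  have il' : L1 leb (fun t => k (consv t x) * test_fam i t) by apply: L1_Mplus_cap => //; exact: L2_L1_plus_Loo.
  apply: (le_trans (RI_abs (L1D il il'))).
  have id := L1_abs bD.1; have it := L1_abs bT.1.
  have aux (w y c : R) : `|y| <= c -> `|w * y| <= `|c| * w ^+ 2 + `|y|.
    move=> yc; rewrite normrM -(real_normK (num_real w)).
    apply: (@le_trans _ _ ((`|w| ^+ 2 + 1) * `|y|)).
      by rewrite ler_wpM2r//; have := normr_ge0 w; nra.
    rewrite mulrDl mul1r lerD2r mulrC ler_wpM2r ?sqr_ge0//.
    by rewrite (le_trans yc)// ler_norm.
  apply: (@le_trans _ _ (IR (fun t => (`|c1| * v (consv t x) ^+ 2 + `|c2| * k (consv t x) ^+ 2) + (`|derive1 (test_fam i) t| + `|test_fam i t|)))).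
    apply: RI_le.
    - by apply: L1_abs; exact: L1D.
    - by apply: L1D; apply: L1D => //; exact: L1Z.
    - move=> t; apply: le_trans (ler_normD _ _) _.
      by rewrite addrACA lerD// aux.
  rewrite !RI_D ?RI_Z//; try exact: L1Z; by apply: L1D => //; exact: L1Z.
apply: fundamental_lemma lE _ => ka.
have iw := L1_weak_partial ord0 [tuple of i :: ka] lv lk.
have [it iE e] := fubini_line iw.
rewrite -[RHS](hw [tuple of i :: ka]) -e; apply: RI_ae.
- by apply: measurable_funM => //; exact: L1_cap_Loo_meas (L1_cap_Loo_test_prod ka).
- exact: L1_meas iE.
apply: ae_mono good_ae => x [mvx mkx v2x k2x].
have il : L1 leb (fun t => v (consv t x) * derive1 (test_fam i) t) by apply: L1_Mplus_cap => //; exact: L2_L1_plus_Loo.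
have il' : L1 leb (fun t => k (consv t x) * test_fam i t) by apply: L1_Mplus_cap => //; exact: L2_L1_plus_Loo.
rewrite /E mulrC -RI_Z//; last exact: L1D.
by apply: eq_Rintegral => t _; rewrite test_prod_consv dtest_prod_consv0; ring.
Qed.

(** On almost every line v is absolutely continuous, so v^2 has weak
    derivative 2 v k there; integrate over the lines. *)
Lemma weak_marginal : weak_deriv (fun t => \int[Leb n]_x (v (consv t x) ^+ 2))
  (fun t => \int[Leb n]_x (2 * (v (consv t x) * k (consv t x)))).
Proof.
move=> i.
have tT := @test1_test_fam R i; have tD := test1_derive tT.
have bT := test1_L1_cap_Loo tT; have bD := test1_L1_cap_Loo tD.
pose t0 (x : 'rV[R]_n.+1) : R := x 0 ord0.
have mt0 (f : R -> R) : measurable_fun [set: measurableTypeR R] f ->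
    measurable_fun [set: 'rV[R]_n.+1] (fun x => f (t0 x)).
  by move=> mf; rewrite /t0; apply: (measurableT_comp mf); exact: measurable_coord.
have [c1 hc1] := bD.2; have [c2 hc2] := bT.2.
have ivk : L1 (Leb n.+1) (fun x => 2 * (v x * k x)) by apply: L1Z; exact: L1_Msq.
have iq : L1 (Leb n.+1) (fun x => v x ^+ 2 * derive1 (test_fam i) (t0 x) + 2 * (v x * k x) * test_fam i (t0 x)).
  apply: L1D.
    apply: (L1_Mbnd v2 (c := c1)) => //; apply: mt0; exact: L1_cap_Loo_meas bD.
  apply: (L1_Mbnd ivk (c := c2)) => //; apply: mt0; exact: L1_cap_Loo_meas bT.
have [i1 j1 e1] := fubini_slice iq; have [i2 j2 e2] := fubini_line iq.
have [iv _ _] := fubini_slice v2; have [ik _ _] := fubini_slice ivk.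
transitivity (\int[Leb n.+1]_x (v x ^+ 2 * derive1 (test_fam i) (t0 x) + 2 * (v x * k x) * test_fam i (t0 x))).
  rewrite -e1; apply: RI_ae.
  - apply: measurable_funD; apply: measurable_funM.
    + by apply: (@measurable_RI_slice R n (fun x => v x ^+ 2)); exact: L1_meas v2.
    + exact: L1_cap_Loo_meas bD.
    + by apply: (@measurable_RI_slice R n (fun x => 2 * (v x * k x))); exact: L1_meas ivk.
    + exact: L1_cap_Loo_meas bT.
  - exact: L1_meas j1.
  apply: ae_mono2 iv ik => t ivt ikt.
  rewrite mulrC [X in _ + X]mulrC -!RI_Z// -RI_D; try exact: L1Z.
  by apply: eq_Rintegral => x _; rewrite /t0 consv0; ring.
rewrite -e2 (@RI_ae _ _ _ _ _ (fun=> 0)) //.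
- by rewrite /Rintegral integral0.
- exact: L1_meas j2.
apply: ae_mono2 good_ae weak_deriv_line => x [mvx mkx v2x k2x] h.
rewrite -[RHS](weak_deriv_sq mvx mkx v2x k2x h i).
by apply: eq_Rintegral => t _; rewrite /t0 consv0.
Qed.

End head.
End weakn.

(** * The logarithmic Sobolev inequality in several variables *)

Section lsin.
Context {R : realType}.
Local Notation leb := (@lebesgue_measure R).
Local Notation Leb := (@lebesgue_rV R).
Local Notation IR := (@Rintegral _ (measurableTypeR R) R (@lebesgue_measure R) setT).

Lemma sqr_enorm_consv n t (x : 'rV[R]_n) : sqr_enorm (consv t x) = t ^+ 2 + sqr_enorm x.
Proof.
rewrite /sqr_enorm big_ord_recl consv0; congr (_ + _).
by apply: eq_bigr => j _; rewrite consvS.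
Qed.

Lemma gauss_density_consv n t (x : 'rV[R]_n) :
  gauss_density (consv t x) = gauss1 t * gauss_density x.
Proof.
rewrite /gauss_density /gauss1 sqr_enorm_consv (mulrDl (t ^+ 2)) (opprD (t ^+ 2 / 2)) expRD.
rewrite (_ : - (n.+1%:R / 2) = - (1 / 2) - n%:R / 2 :> R); last by rewrite -natr1; field.
rewrite powRD; last by apply/implyP => _; rewrite gt_eqF// mulr_gt0// pi_gt0.
by ring.
Qed.

Lemma gauss_density_gt0 n (x : 'rV[R]_n) : 0 < gauss_density x.
Proof. by rewrite mulr_gt0 ?expR_gt0// powR_gt0// mulr_gt0// pi_gt0. Qed.

Lemma gauss_density_RI n : L1 (Leb n) (@gauss_density R n) /\
  \int[Leb n]_x gauss_density x = 1.
Proof.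
elim: n => [|n [iH eH]].
  have [i e] := RI_Leb0 (@measurable_gauss_density R 0); split => //.
  by rewrite e /gauss_density /sqr_enorm big_ord0 !mul0r oppr0 powRr0 expR0 mulr1.
have e1 : (fun p : measurableTypeR R * 'rV[R]_n => gauss_density (consv p.1 p.2)) =
    (fun p => gauss1 p.1 * gauss_density p.2).
  by apply/funext => p; rewrite gauss_density_consv.
have i1 : L1 (Leb n.+1) (@gauss_density R n.+1).
  apply/L1_consv; first exact: measurable_gauss_density.
  by rewrite e1; apply: L1_prod => //; exact: L1_gauss1.
split => //; have [_ _ <-] := fubini_slice i1.
rewrite -[RHS]RI_gauss1; apply: eq_Rintegral => t _.
under eq_Rintegral do rewrite gauss_density_consv.
by rewrite RI_Z// eH mulr1.
Qed.

(** Integration by parts of x_i v^2. For the first coordinate it is the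
    identity on the line for the marginal of v^2; the other coordinates follow
    from the slices. *)
Lemma moment_identity n (i : 'I_n) (v k : 'rV[R]_n -> R) :
  measurable_fun setT v -> measurable_fun setT k ->
  L1 (Leb n) (fun x => v x ^+ 2) -> L1 (Leb n) (fun x => k x ^+ 2) ->
  L1 (Leb n) (fun x => (x 0 i * v x) ^+ 2) -> weak_partial i v k ->
  \int[Leb n]_x (x 0 i * v x * k x) = - 2^-1 * \int[Leb n]_x (v x ^+ 2).
Proof.
elim: n i v k => [[]//|n IH] i v k mv mk v2 k2 xv2 hw.
have mxv : measurable_fun setT (fun x : 'rV[R]_n.+1 => x 0 i * v x).
  by apply: measurable_funM => //; exact: measurable_coord.
have ixvk : L1 (Leb n.+1) (fun x => x 0 i * v x * k x) by exact: L1_Msq.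
have ivk : L1 (Leb n.+1) (fun x => 2 * (v x * k x)) by apply: L1Z; exact: L1_Msq.
have [iv iM eM] := fubini_slice v2.
have [ia ja ea] := fubini_slice ixvk.
have [iv' ih eh] := fubini_slice ivk.
have [ix2 iM2 _] := fubini_slice xv2.
case: (unliftP ord0 i) => [j|] ei; rewrite ei in hw mxv ixvk xv2 ia ja ea ix2 iM2 *.
- rewrite -ea -eM -RI_Z//; apply: RI_ae; [exact: L1_meas ja|exact: L1_meas (L1Z _ iM)|].
  have [ik _ _] := fubini_slice k2.
  have hws := weak_partial_slice (L2_L1_plus_Loo mv v2) (L2_L1_plus_Loo mk k2) hw.
  have h1 := ae_mono2 (fun t => @conj _ _) iv ik.
  have h2 := ae_mono2 (fun t => @conj _ _) ix2 hws.
  apply: ae_mono2 h1 h2 => t [ivt ikt] [ixt hwt].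
  under eq_Rintegral do rewrite consvS.
  apply: IH => //; try exact: measurable_slice.
  by apply: eq_integrable ixt => // x _ /=; rewrite consvS.
- have wM := weak_marginal mv mk v2 k2 hw.
  set M := (fun t => \int[Leb n]_x (v (consv t x) ^+ 2)) in wM iM eM.
  set h := (fun t => \int[Leb n]_x (2 * (v (consv t x) * k (consv t x)))) in wM ih eh.
  have mM := L1_meas iM; have mh := L1_meas ih.
  have mt2 : measurable_fun [set: measurableTypeR R] (fun t : R => t ^+ 2).
    by apply: measurable_of_continuous; exact: exprn_continuous.
  have e1 : {ae leb, forall t, 2 * \int[Leb n]_x (consv t x 0 ord0 * v (consv t x) * k (consv t x)) = t * h t}.
    apply: ae_mono2 ia iv' => t iat ivt.
    rewrite /h -!RI_Z//; apply: eq_Rintegral => x _; rewrite consv0; ring.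
  have e2 : {ae leb, forall t, \int[Leb n]_x ((consv t x 0 ord0 * v (consv t x)) ^+ 2) = t ^+ 2 * M t}.
    by apply: ae_mono iv => t ivt; rewrite /M -RI_Z//; apply: eq_Rintegral => x _; rewrite consv0; ring.
  have mth : measurable_fun [set: measurableTypeR R] (fun t => t * h t).
    by apply: measurable_funM => //; apply: measurable_of_continuous => x; exact: cvg_id.
  have mtM : measurable_fun [set: measurableTypeR R] (fun t => t ^+ 2 * M t) by exact: measurable_funM.
  have ja2 := L1Z 2 ja.
  have := moment_identity1 iM ih wM (L1_ae ja2 mth e1) (L1_ae iM2 mtM e2).
  rewrite -(RI_ae (L1_meas ja2) mth e1) RI_Z// ea eM => e.
  by rewrite mulNr -mulrN -e mulrA mulVf ?mul1r // pnatr_eq0.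
Qed.

Definition admissible n (v : 'rV[R]_n -> R) (k : 'I_n -> 'rV[R]_n -> R) : Prop :=
  [/\ measurable_fun setT v, L1 (Leb n) (fun x => v x ^+ 2),
    forall i, L1 (Leb n) (fun x => (x 0 i * v x) ^+ 2) &
    forall i, [/\ measurable_fun setT (k i), L1 (Leb n) (fun x => k i x ^+ 2) &
      weak_partial i v (k i)]].

Definition lsi_bound n (v : 'rV[R]_n -> R) (k : 'I_n -> 'rV[R]_n -> R) (s : R) : R :=
  2 * s ^+ 2 * \sum_(i < n) \int[Leb n]_x (k i x ^+ 2)
  + 2^-1 * \sum_(i < n) \int[Leb n]_x ((x 0 i * v x) ^+ 2)
  - n%:R * (1 + ln s) * \int[Leb n]_x (v x ^+ 2).

Lemma admissible_slice n (v : 'rV[R]_n.+1 -> R) k : admissible v k ->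
  {ae leb, forall t, admissible (fun x : 'rV[R]_n => v (consv t x))
    (fun j x => k (lift ord0 j) (consv t x))}.
Proof.
move=> [mv v2 xv2 hk].
have [iv _ _] := fubini_slice v2.
have hx : {ae leb, forall t, forall j : 'I_n, L1 (Leb n) (fun x => (x 0 j * v (consv t x)) ^+ 2)}.
  apply: ae_countable => j; have [i _ _] := fubini_slice (xv2 (lift ord0 j)).
  apply: ae_mono i => t it.
  by apply: eq_integrable it => // x _ /=; rewrite consvS.
have hk' : {ae leb, forall t, forall j : 'I_n, L1 (Leb n) (fun x => k (lift ord0 j) (consv t x) ^+ 2) /\
    weak_partial j (fun x => v (consv t x)) (fun x => k (lift ord0 j) (consv t x))}.
  apply: ae_countable => j; have [mk k2 hw] := hk (lift ord0 j).
  have [i _ _] := fubini_slice k2.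
  exact: ae_mono2 (fun t => @conj _ _) i (weak_partial_slice (L2_L1_plus_Loo mv v2) (L2_L1_plus_Loo mk k2) hw).
have h1 := ae_mono2 (fun t => @conj _ _) iv hx.
apply: ae_mono2 h1 hk' => t [ivt ixt] hkt; split => //; first exact: measurable_slice.
move=> j; have [] := hkt j; split => //.
by have [mk _ _] := hk (lift ord0 j); exact: (measurable_slice t mk).
Qed.

End lsin.

Section tensorization.
Context {R : realType}.
Local Notation leb := (@lebesgue_measure R).
Local Notation Leb := (@lebesgue_rV R).
Local Notation IR := (@Rintegral _ (measurableTypeR R) R (@lebesgue_measure R) setT).

Lemma ent_diag (a : R) : 0 <= a -> ent a a = 0.
Proof.
rewrite le_eqVlt => /predU1P[<-|a0]; first by rewrite /ent mul0r subr0 addr0 maxxx.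
by rewrite entE ?ltW// subrr mulr0 sub0r addNr.
Qed.

Lemma ent_mass0 n (v : 'rV[R]_n -> R) : measurable_fun setT v ->
  L1 (Leb n) (fun x => v x ^+ 2) -> \int[Leb n]_x (v x ^+ 2) = 0 ->
  {ae Leb n, forall x, v x = 0}.
Proof.
move=> mv v2 h; apply: ae_mono (RI0_ae v2 (fun=> sqr_ge0 _) h) => x /eqP.
by rewrite sqrf_eq0 => /eqP.
Qed.

(** Chain rule of relative entropy for the slice at one value of the first
    coordinate, w being the slice, M its mass and g the one-dimensional
    Gaussian density: passing from the reference mass M to m g adds ent M (m
    g), and the linear terms integrate exactly since gauss_density has mass
    1. *)
Lemma ent_chain n (w : 'rV[R]_n -> R) (m g b : R) :
  measurable_fun setT w -> L1 (Leb n) (fun x => w x ^+ 2) -> 0 < m -> 0 < g ->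
  (\int[Leb n]_x (ent (w x ^+ 2) ((\int[Leb n]_x (w x ^+ 2)) * gauss_density x))%:E <= b%:E)%E ->
  (\int[Leb n]_x (ent (w x ^+ 2) (m * (g * gauss_density x)))%:E
    <= (b + ent (\int[Leb n]_x (w x ^+ 2)) (m * g))%:E)%E.
Proof.
move=> mw w2 m0 g0 hb; set M := \int[Leb n]_x (w x ^+ 2) in hb *.
have [ig eg] := @gauss_density_RI R n.
have mg := @measurable_gauss_density R n.
have M0 : 0 <= M by apply: RI_ge0 => x; exact: sqr_ge0.
have mw2 : measurable_fun setT (fun x => w x ^+ 2) by exact: measurable_funX.
have ment (c : R) : measurable_fun setT (fun x => ent (w x ^+ 2) (c * gauss_density x)).
  by apply: measurable_ent => //; exact: measurable_funM.
have mg0 : 0 < m * g by rewrite mulr_gt0.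
under eq_integral do rewrite mulrA.
have i1 : L1 (Leb n) (fun x => ent (w x ^+ 2) (M * gauss_density x)).
  apply: L1_ltyP => //; first by move=> x; exact: ent_ge0.
  by rewrite (le_lt_trans hb)// ltry.
move: (hb); rewrite (L1_EFin i1) lee_fin => hb'.
have {M0}[M0|M0] : M = 0 \/ 0 < M.
  by move: M0; rewrite le_eqVlt => /predU1P[<-|]; [left|right].
(* On a slice of mass 0 both sides are explicit. *)
- have w0 := ent_mass0 mw w2 M0.
  have b0 : 0 <= b by rewrite (le_trans _ hb')// RI_ge0// => x; exact: ent_ge0.
  have i2 : L1 (Leb n) (fun x => m * g * gauss_density x) by exact: L1Z.
  apply: (le_trans (ge0_integral_le_RI_real (ment _) (fun=> ent_ge0 _ _) i2 _)).
    apply: ae_mono w0 => x ->; rewrite expr0n/= entE// ?mul0r ?subr0 ?add0r//.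
    by rewrite mulr_gt0// gauss_density_gt0.
  by rewrite lee_fin RI_Z// eg mulr1 M0 entE// mul0r subr0 add0r lerDr.
- pose c := ln M - ln (m * g).
  have E x : ent (w x ^+ 2) (m * g * gauss_density x) =
      ent (w x ^+ 2) (M * gauss_density x) + (c * w x ^+ 2 + (m * g - M) * gauss_density x).
    have gx := @gauss_density_gt0 R n x.
    have a1 := mulr_gt0 mg0 gx; have a2 := mulr_gt0 M0 gx.
    rewrite (entE (sqr_ge0 _) a1) (entE (sqr_ge0 _) a2) /c.
    by rewrite (@lnM _ (m * g) _ mg0 gx) (@lnM _ M _ M0 gx); ring.
  have i2 : L1 (Leb n) (fun x => c * w x ^+ 2 + (m * g - M) * gauss_density x).
    by apply: L1D; exact: L1Z.
  under eq_integral do rewrite E.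
  rewrite (L1_EFin (L1D i1 i2)) lee_fin RI_D// lerD//.
  rewrite RI_D; [|exact: L1Z|exact: L1Z].
  rewrite (RI_Z c w2) (RI_Z _ ig).
  by rewrite eg -/M mulr1 (entE (ltW M0) mg0) /c; lra.
Qed.

(** The logarithmic Sobolev inequality at scale s. The bound is additive over
    the coordinates: the first one contributes the inequality on the line for
    the marginal, the others the induction hypothesis on slices, both at the
    same scale s. *)
Lemma lsi n (v : 'rV[R]_n -> R) k s : admissible v k -> 0 < s ->
  (\int[Leb n]_x (ent (v x ^+ 2) ((\int[Leb n]_x (v x ^+ 2)) * gauss_density x))%:E
   <= (lsi_bound v k s)%:E)%E.
Proof.
move=> + s0; elim: n v k => [|n IH] v k adm.
  have [mv v2 _ _] := adm; set m := \int[_]_x _.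
  have [_ em] := RI_Leb0 (L1_meas v2).
  have h (x : 'rV[R]_0) : ent (v x ^+ 2) (m * gauss_density x) = 0.
    rewrite (thinmx0 x) /m em /gauss_density /sqr_enorm big_ord0 !mul0r oppr0 powRr0 expR0.
    by rewrite !mulr1 ent_diag// sqr_ge0.
  under eq_integral do rewrite h.
  by rewrite integral0 /lsi_bound !big_ord0 !mulr0 mul0r mul0r subr0 addr0.
have [mv v2 xv2 hk] := adm; set m := \int[_]_x _.
have mgd := @measurable_gauss_density R n.+1.
have ment : measurable_fun setT (fun x => ent (v x ^+ 2) (m * gauss_density x)).
  by apply: measurable_ent; [exact: measurable_funX|exact: measurable_funM].
have : 0 <= m by apply: RI_ge0 => x; exact: sqr_ge0.
rewrite le_eqVlt => /predU1P[m0|m0].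
  have v0 := ent_mass0 mv v2 (esym m0).
  have i0 : L1 (Leb n.+1) (fun=> 0 : R) by exact: integrable0.
  apply: (le_trans (ge0_integral_le_RI_real ment (fun=> ent_ge0 _ _) i0 _)).
    by apply: ae_mono v0 => x ->; rewrite -m0 expr0n/= mul0r ent_diag.
  rewrite {1}/Rintegral integral0/= lee_fin /lsi_bound -/m -m0 mulr0 subr0.
  apply: addr_ge0; apply: mulr_ge0 => //; first by rewrite mulr_ge0// sqr_ge0.
    by apply: sumr_ge0 => i _; apply: RI_ge0 => x; exact: sqr_ge0.
  by apply: sumr_ge0 => i _; apply: RI_ge0 => x; exact: sqr_ge0.
have [iv iM eM] := fubini_slice v2.
have [mk0 k02 hw] := hk ord0.
have [ik iK eK] := fubini_slice k02.
have ivk : L1 (Leb n.+1) (fun x => 2 * (v x * k ord0 x)) by apply: L1Z; exact: L1_Msq.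
have [ivk' ih _] := fubini_slice ivk.
have wM := weak_marginal mv mk0 v2 k02 hw.
have [ix2 iX eX] := fubini_slice (xv2 ord0).
set M := (fun t => \int[Leb n]_x (v (consv t x) ^+ 2)) in wM iM eM.
set h := (fun t => \int[Leb n]_x (2 * (v (consv t x) * k ord0 (consv t x)))) in wM ih.
set K := (fun t => \int[Leb n]_x (k ord0 (consv t x) ^+ 2)) in iK eK.
have M0 t : 0 <= M t by apply: RI_ge0 => x; exact: sqr_ge0.
have mM := L1_meas iM.
(* Cauchy-Schwarz on the slice at t, as the integral of (v tau - 2 k)^2 >=
   0. *)
have hK : {ae leb, forall t, forall tau, h t * tau <= M t * tau ^+ 2 / 2 + 2 * K t}.
  have h1 := ae_mono2 (fun t => @conj _ _) iv ik.
  apply: ae_mono2 h1 ivk' => t [ivt ikt] ivkt tau.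
  rewrite /h /M /K mulrC -RI_Z//.
  rewrite (_ : \int[Leb n]_x v (consv t x) ^+ 2 * tau ^+ 2 / 2 = tau ^+ 2 / 2 * \int[Leb n]_x (v (consv t x) ^+ 2)); last by ring.
  rewrite -!RI_Z// -RI_D; try exact: L1Z.
  apply: RI_le; first exact: L1Z.
    by apply: L1D; exact: L1Z.
  move=> x; move: (v _) (k _ _) => a b.
  by clear; have := sqr_ge0 (a * tau - 2 * b); nra.
have e2 : {ae leb, forall t, \int[Leb n]_x ((consv t x 0 ord0 * v (consv t x)) ^+ 2) = t ^+ 2 * M t}.
  by apply: ae_mono iv => t ivt; rewrite /M -RI_Z//; apply: eq_Rintegral => x _; rewrite consv0; ring.
have mtM : measurable_fun [set: measurableTypeR R] (fun t => t ^+ 2 * M t).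
  by apply: measurable_funM => //; apply: measurable_of_continuous; exact: exprn_continuous.
have l1 := lsi1_weak iM ih iK M0 hK (L1_ae iX mtM e2) s0.
rewrite eM -(RI_ae (L1_meas iX) mtM e2) eX eK -/m in l1.
have {}l1 := l1 m0 wM.
pose E t := ent (M t) (m * gauss1 t).
have mE : measurable_fun [set: measurableTypeR R] E.
  apply: measurable_ent => //; apply: measurable_funM => //; exact: L1_meas L1_gauss1.
have iE : L1 leb E.
  apply: L1_ltyP => //; first by move=> t; exact: ent_ge0.
  by rewrite (le_lt_trans l1)// ltry.
rewrite (L1_EFin iE) lee_fin in l1.
pose r t := 2 * s ^+ 2 * (\sum_(j < n) \int[Leb n]_x (k (lift ord0 j) (consv t x) ^+ 2))
  + 2^-1 * (\sum_(j < n) \int[Leb n]_x ((consv t x 0 (lift ord0 j) * v (consv t x)) ^+ 2))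
  - n%:R * (1 + ln s) * M t.
have rE t : lsi_bound (fun x : 'rV[R]_n => v (consv t x)) (fun j x => k (lift ord0 j) (consv t x)) s = r t.
  rewrite /lsi_bound /r; congr (_ + _ * _ - _).
  by apply: eq_bigr => j _; apply: eq_Rintegral => x _; rewrite consvS.
have iKj j : L1 leb (fun t => \int[Leb n]_x (k (lift ord0 j) (consv t x) ^+ 2)).
  by have [_ k2 _] := hk (lift ord0 j); have [] := fubini_slice k2.
have iXj j : L1 leb (fun t => \int[Leb n]_x ((consv t x 0 (lift ord0 j) * v (consv t x)) ^+ 2)).
  by have [] := fubini_slice (xv2 (lift ord0 j)).
have iKs := L1_sum iKj; have iXs := L1_sum iXj.
have ir : L1 leb r by apply: L1B; [apply: L1D|]; exact: L1Z.
have er : IR r = 2 * s ^+ 2 * (\sum_(j < n) \int[Leb n.+1]_x (k (lift ord0 j) x ^+ 2))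
  + 2^-1 * (\sum_(j < n) \int[Leb n.+1]_x ((x 0 (lift ord0 j) * v x) ^+ 2))
  - n%:R * (1 + ln s) * m.
  rewrite /r RI_B; [|by apply: L1D; exact: L1Z|exact: L1Z].
  rewrite RI_D; [|exact: L1Z|exact: L1Z].
  rewrite !RI_Z// !RI_sum// eM; congr (_ * _ + _ * _ - _).
    by apply: eq_bigr => j _; have [_ k2 _] := hk (lift ord0 j); have [_ _] := fubini_slice k2.
  by apply: eq_bigr => j _; have [_ _] := fubini_slice (xv2 (lift ord0 j)).
have ment' : measurable_fun setT (fun x => (ent (v x ^+ 2) (m * gauss_density x))%:E).
  exact/measurable_EFinP.
have ge0' (x : 'rV[R]_n.+1) : (0 <= (ent (v x ^+ 2) (m * gauss_density x))%:E)%E.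
  by rewrite lee_fin ent_ge0.
rewrite tonelli_slice//.
apply: (@le_trans _ _ (IR (fun t => r t + E t))%:E).
  apply: ge0_integral_le_RI.
  - exact: (measurable_tonelli_slice ment' ge0').
  - by move=> t; apply: integral_ge0 => x _; rewrite lee_fin ent_ge0.
  - exact: L1D.
  apply: ae_mono2 (admissible_slice adm) iv => t admt ivt.
  have := IH _ _ admt; rewrite rE => /ent_chain.
  move=> /(_ m (gauss1 t) (measurable_slice t mv) ivt m0 (gauss1_gt0 t)).
  by under eq_integral do rewrite -gauss_density_consv.
rewrite RI_D// lee_fin er /lsi_bound !big_ord_recl -/m -(natr1 n).
move: l1; rewrite -/(IR E); move: (\sum_(i < n) _) (\sum_(i < n) _) (IR E).
move: (\int[Leb n.+1]_x (k ord0 x ^+ 2))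
  (\int[Leb n.+1]_x ((x 0 ord0 * v x) ^+ 2)).
by clear; move=> *; lra.
Qed.

End tensorization.

(** * Products of smooth functions *)

Section tensor.
Context {R : realType} {n : nat}.
Local Notation Leb := (@lebesgue_rV R).
Implicit Types F : 'I_n -> R -> R.

Definition derive_factor (i : 'I_n) F : 'I_n -> R -> R :=
  fun j => if j == i then derive1 (F j) else F j.

Lemma prodf_is_derive F i (x : 'rV[R]_n) : (forall j, smooth1 (F j)) ->
  is_derive x (delta_mx 0 i : 'rV[R]_n) (prodf F) (prodf (derive_factor i F) x).
Proof.
move=> sF.
pose C := \prod_(j < n | j != i) F j (x 0 j).
have qE : (fun h : R => h^-1 *: ((prodf F \o shift x) (h *: (delta_mx 0 i : 'rV[R]_n)) - prodf F x)) =
    (fun h : R => (h^-1 *: ((F i \o shift (x 0 i)) (h *: 1) - F i (x 0 i))) * C).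
  apply/funext => h; rewrite /= /prodf (bigD1 i)//= [X in _ *: (_ - X)](bigD1 i)//=.
  rewrite -/C !mxE !eqxx/=.
  rewrite (eq_bigr (fun j => F j (x 0 j))) -/C; last first.
    by move=> j /negbTE ji; rewrite !mxE ji andbF mulr0 add0r.
  by rewrite -mulrBl scalerAl.
have dF := smooth1_is_derive (x 0 i) (sF i).
have cF : (fun h : R => (h^-1 *: ((F i \o shift (x 0 i)) (h *: 1) - F i (x 0 i))) * C) @ 0^'
    --> derive1 (F i) (x 0 i) * C.
  apply: cvgMl; rewrite derive1E; exact: (@ex_derive _ _ _ _ _ _ _ dF).
have -> : prodf (derive_factor i F) x = derive1 (F i) (x 0 i) * C.
  rewrite /prodf (bigD1 i)//= /derive_factor eqxx; congr (_ * _).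
  by apply: eq_bigr => j /negbTE ->.
apply: DeriveDef.
  by apply/cvg_ex; exists (derive1 (F i) (x 0 i) * C); rewrite qE.
by apply/cvg_lim => //; rewrite qE.
Qed.

Lemma smooth1_derive_factor F i : (forall j, smooth1 (F j)) -> forall j, smooth1 (derive_factor i F j).
Proof. by move=> sF j; rewrite /derive_factor; case: ifP => // _; exact: smooth1_derive1. Qed.

Lemma partial_prodf F i : (forall j, smooth1 (F j)) ->
  partial i (prodf F) = prodf (derive_factor i F).
Proof.
move=> sF; apply/funext => x; have d := prodf_is_derive i x sF.
exact: (@derive_val _ _ _ _ _ _ _ d).
Qed.

Lemma prodf_continuous F : (forall j, smooth1 (F j)) -> continuous (prodf F).
Proof.
move=> sF x; rewrite /prodf /continuous_at.
pose P (s : seq 'I_n) (y : 'rV[R]_n) := \prod_(i <- s) F i (y 0 i).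
suff key s : {for x, continuous (P s)} by exact: key.
elim: s => [|j s IH].
  rewrite (_ : P [::] = cst 1); first exact: cst_continuous.
  by apply/funext => y; rewrite /P big_nil.
have -> : P (j :: s) = (fun y : 'rV[R]_n => F j (y 0 j) * P s y).
  by apply/funext => y; rewrite /P big_cons.
have cj : {for x, continuous (fun y : 'rV[R]_n => F j (y 0 j))}.
  apply: (@continuous_comp _ _ _ (fun y : 'rV[R]_n => y 0 j) (F j) x).
    exact: coord_continuous.
  exact: smooth1_continuous.
exact: (continuousM cj IH).
Qed.

Lemma smooth_prodf F : (forall j, smooth1 (F j)) -> smooth (prodf F).
Proof.
move=> sF s.
have [F' sF' ->] : exists2 F', (forall j, smooth1 (F' j)) & foldr partial (prodf F) s = prodf F'.
  elim: s => [|i s [F' sF' e]] /=; first by exists F.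
  by exists (derive_factor i F'); [exact: smooth1_derive_factor|rewrite e partial_prodf].
split; first exact: prodf_continuous.
by move=> i x; have d := prodf_is_derive i x sF'; exact: (@ex_derive _ _ _ _ _ _ _ d).
Qed.

Lemma test_prodf F : (forall j, test1 (F j)) -> test_function (prodf F).
Proof.
move=> tF; split; first by apply: smooth_prodf => j; exact: (tF j).1.
have /choice[A hA] : forall j, exists A : R, forall x, A <= `|x| -> F j x = 0.
  by move=> j; exact: (tF j).2.
pose B := [set v : 'rV[R]_n | forall j, `[- A j, A j]%classic (v ord0 j)].
have cB : compact B by exact (@rV_compact _ _ (fun j => `[- A j, A j]%classic) (fun j => @segment_compact _ _ _)).
have closedB : closed B by exact (compact_closed (@norm_hausdorff _ _) cB).
apply: (subclosed_compact (@closed_closure _ _) cB).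
rewrite [X in _ `<=` X]((closure_id B).1 closedB); apply: closureS => x /= hx j /=.
rewrite in_itv/= -ler_norml; rewrite leNgt; apply/negP => h.
move/negP: hx; apply; apply/eqP; rewrite /prodf (bigD1 j)//= hA ?mul0r//.
exact: ltW.
Qed.

End tensor.

(** * Integration against a density *)

Section density.
Local Open Scope ereal_scope.
Context d (T : measurableType d) (R : realType) (m nu : {measure set T -> \bar R}) (g : T -> R).
Hypothesis (mg : measurable_fun setT g) (g0 : (forall x, 0 <= g x)%R).
Hypothesis (hnu : forall A, measurable A -> nu A = \int[m]_(x in A) (g x)%:E).

Import HBNNSimple.

Let mgE : measurable_fun setT (EFin \o g).
Proof. exact/measurable_EFinP. Qed.

Let integral_density_indic A : measurable A ->
  \int[nu]_x (\1_A x)%:E = \int[m]_x ((\1_A x)%:E * (g x)%:E).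
Proof.
move=> mA; rewrite integral_indic// setIT hnu// integral_mkcond.
apply: eq_integral => x _; rewrite patchE indicE.
by case: (x \in A); rewrite ?mul1e// mul0e.
Qed.

Let integral_density_nnsfun (h : {nnsfun T >-> R}) :
  \int[nu]_x (h x)%:E = \int[m]_x ((h x)%:E * (g x)%:E).
Proof.
under [LHS]eq_integral do rewrite fimfunE -fsumEFin//.
rewrite [LHS]ge0_integral_fsum//; last 2 first.
  - by move=> r; exact/measurable_EFinP/measurableT_comp.
  - by move=> n x _; rewrite EFinM nnfun_muleindic_ge0.
under [RHS]eq_integral.
  move=> x xD; rewrite fimfunE -fsumEFin// muleC ge0_mule_fsumr; last first.
    by move=> r; rewrite EFinM nnfun_muleindic_ge0.
  over.
rewrite [RHS]ge0_integral_fsum//; last 2 first.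
  - by move=> r; apply: emeasurable_funM => //; apply/measurable_EFinP; apply/measurableT_comp => //.
  - move=> n x _; apply: mule_ge0; first by rewrite lee_fin.
    by rewrite EFinM nnfun_muleindic_ge0.
apply: eq_fsbigr => r _.
have [r0|r0] := ltP r 0%R.
  rewrite !integral0_eq// => x _.
    by rewrite preimage_nnfun0// indic0 mulr0 mule0.
  by rewrite preimage_nnfun0// indic0 mulr0.
have mi : measurable (h @^-1` [set r]) by exact: measurable_sfunP.
under eq_integral do rewrite EFinM.
rewrite ge0_integralZl//; last exact/measurable_EFinP.
under [RHS]eq_integral do rewrite EFinM muleCA (muleC (g _)%:E).
rewrite ge0_integralZl//.
- by rewrite integral_density_indic.
- by apply: emeasurable_funM => //; exact/measurable_EFinP.
- by move=> x _; rewrite mule_ge0// lee_fin.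
Qed.

(** Monotone approximation by simple functions. *)
Lemma integral_density (f : T -> \bar R) : measurable_fun setT f ->
  (forall x, 0 <= f x) -> \int[nu]_x f x = \int[m]_x (f x * (g x)%:E).
Proof.
move=> mf f0; pose f_ := nnsfun_approx measurableT mf.
transitivity (limn (fun n => \int[nu]_x (f_ n x)%:E)).
  rewrite -monotone_convergence//=.
  - apply: eq_integral => x _; apply/esym/cvg_lim => //=.
    exact: cvg_nnsfun_approx.
  - by move=> n; apply: measurableT_comp => //; exact: measurable_funTS.
  - by move=> n x _; rewrite lee_fin.
  - by move=> x _ a b ab; rewrite lee_fin//; exact/lefP/nd_nnsfun_approx.
rewrite (_ : \int[m]_x _ =
    limn (fun n => \int[m]_x ((f_ n x)%:E * (g x)%:E))); last first.
  rewrite -monotone_convergence//=.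
  - apply: eq_integral => x _; apply/esym/cvg_lim => //.
    by apply: cvgeZr => //; exact: cvg_nnsfun_approx.
  - by move=> n; apply: emeasurable_funM => //; exact/measurable_EFinP/measurable_funTS.
  - by move=> n x _; rewrite mule_ge0// lee_fin.
  - move=> x _ a b ab; rewrite lee_wpmul2r// ?lee_fin//; exact/lefP/nd_nnsfun_approx.
by congr (limn _); apply/funext => n /=; rewrite integral_density_nnsfun.
Qed.

End density.

(** * Transfer of weak gradients from the Gaussian to the Lebesgue measure *)

Section root_gauss.
Context {R : realType} {n : nat}.
Local Notation Leb := (@lebesgue_rV R).

(** The square root of the one-dimensional Gaussian density, up to its
    constant. *)
Definition root_gauss1 (t : R) : R := expR (- (1 / 4) * (t * t)).

Lemma smooth1_root_gauss1 : smooth1 root_gauss1.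
Proof.
apply: (@smooth1_comp _ (@expR R) (fun t => - (1 / 4) * (t * t))); first exact: smooth1_exp.
apply: smooth1_mul; first exact: smooth1_cst.
by apply: smooth1_mul; exact: smooth1_id.
Qed.

Lemma root_gauss1_derive (t : R) : is_derive t 1 root_gauss1 (- (t / 2) * root_gauss1 t).
Proof.
have d1 : is_derive t 1 (fun t : R => - (1 / 4) * (t * t)) (- (t / 2)).
  apply: (is_derive_eq (is_deriveZ (- (1 / 4)) (is_deriveM (is_derive_id t 1) (is_derive_id t 1)))).
  by rewrite -![_ *: _]/(_ * _); field.
apply: (is_derive_eq (@is_derive1_comp _ (@expR R) _ t _ _ (is_derive_expR _) d1)).
by rewrite mulrC.
Qed.

Definition root_gauss_cst : R := Num.sqrt ((2 * pi) `^ (- (n%:R / 2))).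

Lemma root_gauss_cst_gt0 : 0 < root_gauss_cst.
Proof. by rewrite sqrtr_gt0 powR_gt0// mulr_gt0// pi_gt0. Qed.

(** The square root of gauss_density, written as a product of functions of one
    variable so that it can be absorbed into product test functions. *)
Definition root_gauss (x : 'rV[R]_n) : R := root_gauss_cst * prodf (fun=> root_gauss1) x.

Lemma prodf_root_gauss1 (x : 'rV[R]_n) : prodf (fun=> root_gauss1) x = expR (- (1 / 4) * sqr_enorm x).
Proof.
rewrite /prodf /root_gauss1 -expR_sum; congr expR.
by rewrite /sqr_enorm mulr_sumr; apply: eq_bigr => i _; rewrite expr2.
Qed.

Lemma root_gauss_sq x : root_gauss x ^+ 2 = gauss_density x.
Proof.
rewrite /root_gauss prodf_root_gauss1 exprMn sqr_sqrtr ?powR_ge0//; congr (_ * _).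
by rewrite -expRM_natl; congr expR; field.
Qed.

Lemma measurable_root_gauss : measurable_fun setT root_gauss.
Proof.
apply: measurable_funM => //; apply: measurable_prodf => i.
by apply: measurable_of_continuous; apply: smooth1_continuous; exact: smooth1_root_gauss1.
Qed.

Let F (ka : n.-tuple test_index) (j : 'I_n) (t : R) : R := test_fam (tnth ka j) t * root_gauss1 t.

Let tF ka j : test1 (F ka j).
Proof. by apply: test1_mul; [exact: test1_test_fam|exact: smooth1_root_gauss1]. Qed.

Let prodfF ka x : prodf (F ka) x = test_prod ka x * prodf (fun=> root_gauss1) x.
Proof. by rewrite /prodf -big_split. Qed.

Let dF ka j t : derive1 (F ka j) t =
  derive1 (test_fam (tnth ka j)) t * root_gauss1 t - t / 2 * (test_fam (tnth ka j) t * root_gauss1 t).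
Proof.
have d1 := smooth1_is_derive t (@test1_test_fam R (tnth ka j)).1.
have d2 := root_gauss1_derive t.
rewrite derive1E (@derive_val _ _ _ _ _ _ _ (is_deriveM d1 d2)).
by rewrite -![_ *: _]/(_ * _); ring.
Qed.

Let updF ka i x : prodf (derive_factor i (F ka)) x =
  (dtest_prod i ka x - x 0 i / 2 * test_prod ka x) * prodf (fun=> root_gauss1) x.
Proof.
have D (H : 'I_n -> R -> R) :
    prodf H x = H i (x 0 i) * \prod_(j < n | j != i) H j (x 0 j).
  by rewrite /prodf (bigD1 i).
rewrite /dtest_prod /test_prod !D /derive_factor eqxx dF.
rewrite (eq_bigr (fun j => test_fam (tnth ka j) (x 0 j) * root_gauss1 (x 0 j))); last first.
  by move=> j /negbTE ->.
rewrite big_split/=.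
rewrite [in RHS](eq_bigr (fun j => test_fam (tnth ka j) (x 0 j))); last first.
  by move=> j /negbTE ->.
set P := \prod_(j < n | j != i) test_fam _ _; set Q := \prod_(j < n | j != i) root_gauss1 _.
by ring.
Qed.

(** Test the weak gradient of u on phi times the root of the Gaussian density,
    phi a test product; the derivative of the root produces the term - x_i /
    2. *)
Lemma weak_partial_root_gauss (u : 'rV[R]_n -> R) (G : 'rV[R]_n -> 'rV[R]_n) i :
  weak_gradient u G ->
  L1 (Leb n) (fun x => (u x * root_gauss x) ^+ 2) ->
  L1 (Leb n) (fun x => (G x 0 i * root_gauss x) ^+ 2) ->
  L1 (Leb n) (fun x => (x 0 i * (u x * root_gauss x)) ^+ 2) ->
  weak_partial i (fun x => u x * root_gauss x)
    (fun x => G x 0 i * root_gauss x - x 0 i / 2 * (u x * root_gauss x)).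
Proof.
move=> [[mu _] /(_ i)[[mG _] hG]] u2 G2 xu2 ka.
have mo := measurable_root_gauss.
have mx : measurable_fun setT (fun x : 'rV[R]_n => x 0 i) by exact: measurable_coord.
have muo : measurable_fun setT (fun x => u x * root_gauss x) by exact: measurable_funM.
have lu := L2_L1_plus_Loo muo u2.
have lG := L2_L1_plus_Loo (measurable_funM mG mo) G2.
have lxu := L2_L1_plus_Loo (measurable_funM mx muo) xu2.
have := hG _ (test_prodf (tF ka)).
rewrite partial_prodf; last by move=> j; exact: (tF ka j).1.
(* The test function below omits the constant root_gauss_cst, which is divided
   out. *)
have c0 : root_gauss_cst != 0 by rewrite gt_eqF// root_gauss_cst_gt0.
pose A x := (u x * root_gauss x) * dtest_prod i ka x - 2^-1 * ((x 0 i * (u x * root_gauss x)) * test_prod ka x).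
pose B x := G x 0 i * root_gauss x * test_prod ka x.
have iA : L1 (Leb n) A.
  apply: L1B; first by apply: L1_Mplus_cap => //; exact: L1_cap_Loo_dtest_prod.
  by apply: L1Z; apply: L1_Mplus_cap lxu _; exact: L1_cap_Loo_test_prod.
have iB : L1 (Leb n) B by apply: L1_Mplus_cap lG _; exact: L1_cap_Loo_test_prod.
rewrite (_ : (fun x => u x * prodf (derive_factor i (F ka)) x) = (fun x => root_gauss_cst^-1 * A x)); last first.
  by apply/funext => x; rewrite updF /A /root_gauss; field.
rewrite (_ : (fun x => G x 0 i * prodf (F ka) x) = (fun x => root_gauss_cst^-1 * B x)); last first.
  by apply/funext => x; rewrite prodfF /B /root_gauss; field.
rewrite !RI_Z// -mulrN => /(mulfI (invr_neq0 c0)) e.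
rewrite (_ : (fun x => _) = (fun x => A x + B x)); last first.
  by apply/funext => x; rewrite /A /B; field.
by rewrite RI_D// e addNr.
Qed.

End root_gauss.

(** * From entropy to L^p norms *)

Section entropy_to_Lp.
Context {R : realType} {d : nat}.
Local Notation Leb := (@lebesgue_rV R).
Local Notation mu := (@gauss_measure R d).

Lemma integral_gauss (f : 'rV[R]_d -> R) : measurable_fun setT f -> (forall x, 0 <= f x) ->
  (\int[mu]_x (f x)%:E = \int[Leb d]_x (f x * gauss_density x)%:E)%E.
Proof.
move=> mf f0; rewrite (@integral_density _ _ _ (Leb d) mu (@gauss_density R d)) //.
- exact: measurable_gauss_density.
- exact: gauss_density_ge0.
- exact/measurable_EFinP.
Qed.

Lemma L1_gauss (f : 'rV[R]_d -> R) : measurable_fun setT f -> (forall x, 0 <= f x) ->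
  (\int[mu]_x (f x)%:E < +oo)%E -> L1 (Leb d) (fun x => f x * gauss_density x).
Proof.
move=> mf f0; rewrite integral_gauss// => h; apply: L1_ltyP => //.
- by apply: measurable_funM => //; exact: measurable_gauss_density.
- by move=> x; rewrite mulr_ge0// gauss_density_ge0.
Qed.

Lemma Lp_normE (p : R) (u : 'rV[R]_d -> R) :
  Lp_norm mu p u = fine (\int[mu]_x (`|u x| `^ p)%:E)%E `^ p^-1.
Proof. by rewrite /Lp_norm unlock fine_poweR. Qed.

(** The tangent line of exp, which after integration is Jensen's inequality in
    which E bounds the average of ln y from above. *)
Lemma jensen_pointwise (q E y : R) : 0 < y ->
  y `^ (- q) >= expR (- (q * E)) * (1 + q * E - q * ln y).
Proof.
move=> y0; rewrite /powR gt_eqF//.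
have -> : - q * ln y = - (q * E) + (q * E - q * ln y) by ring.
rewrite expRD ler_pM2l ?expR_gt0// -addrA; exact: expR_ge1Dx.
Qed.

(** With y = u^2 / m and q = 1 - p / 2, |u|^p = m^(p/2) y y^(-q). Bound y^(-q)
    from below by the tangent inequality and integrate: y has Gaussian
    integral 1, and y ln y has integral at most E. *)
Lemma entropy_Lp (u : 'rV[R]_d -> R) (p E : R) : 1 <= p < 2 ->
  measurable_fun setT u ->
  L1 (Leb d) (fun x => u x ^+ 2 * gauss_density x) ->
  L1 (Leb d) (fun x => `|u x| `^ p * gauss_density x) ->
  let m := \int[Leb d]_x (u x ^+ 2 * gauss_density x) in 0 < m ->
  (\int[Leb d]_x (ent (u x ^+ 2 * gauss_density x) (m * gauss_density x))%:E <= (m * E)%:E)%E ->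
  m `^ (p / 2) * expR (- ((1 - p / 2) * E)) <= \int[Leb d]_x (`|u x| `^ p * gauss_density x).
Proof.
move=> /andP[p1 p2] mu_ i2 ip m m0 hE; set q := 1 - p / 2.
have q0 : 0 < q by rewrite /q; lra.
have [ig eg] := @gauss_density_RI R d.
have mg := @measurable_gauss_density R d.
pose e x := ent (u x ^+ 2 * gauss_density x) (m * gauss_density x).
have me : measurable_fun setT e.
  by apply: measurable_ent; apply: measurable_funM => //; exact: measurable_funX.
have ie : L1 (Leb d) e.
  apply: L1_ltyP => //; first by move=> x; exact: ent_ge0.
  by rewrite (le_lt_trans hE)// ltry.
move: hE; rewrite (L1_EFin ie) lee_fin => hE.
pose B := m `^ (p / 2) * expR (- (q * E)) / m.
pose L x := B * ((1 + q * E) * (u x ^+ 2 * gauss_density x)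
  - q * (e x + (u x ^+ 2 * gauss_density x - m * gauss_density x))).
have i3 : L1 (Leb d) (fun x => u x ^+ 2 * gauss_density x - m * gauss_density x).
  by apply: L1B => //; exact: L1Z.
have iL : L1 (Leb d) L.
  by apply: L1Z; apply: L1B; apply: L1Z => //; exact: L1D.
have B0 : 0 < B by rewrite divr_gt0// mulr_gt0 ?expR_gt0// powR_gt0.
apply: (@le_trans _ _ (\int[Leb d]_x L x)).
  rewrite /L RI_Z; last by apply: L1B; apply: L1Z => //; exact: L1D.
  rewrite RI_B; [|exact: L1Z|by apply: L1Z; exact: L1D].
  rewrite (RI_Z _ i2) (RI_Z _ (L1D ie i3)) (RI_D ie i3) (RI_B i2 (L1Z m ig)) (RI_Z m ig) eg -/m.
  rewrite mulr1 subrr addr0.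
  have -> : m `^ (p / 2) * expR (- (q * E)) = B * m by rewrite /B divfK// gt_eqF.
  rewrite ler_pM2l//.
  have : q * \int[Leb d]_x e x <= q * (m * E) by rewrite ler_pM2l.
  by lra.
apply: RI_le => // x; have gx := @gauss_density_gt0 R d x.
have mgx : 0 < m * gauss_density x by rewrite mulr_gt0.
rewrite /L /e entE//; last by rewrite mulr_ge0 ?sqr_ge0// ltW.
have [u0|u0] := eqVneq (u x) 0.
  rewrite u0 expr0n/= !mul0r mulr0 sub0r.
  rewrite (_ : - (q * _) = 0); last by ring.
  by rewrite mulr0 mulr_ge0 ?powR_ge0// ltW.
have u2 : 0 < u x ^+ 2 by rewrite exprn_even_gt0//= u0.
pose y := u x ^+ 2 / m.
have y0 : 0 < y by rewrite divr_gt0.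
have lny : ln (u x ^+ 2 * gauss_density x) - ln (m * gauss_density x) = ln y.
  by rewrite (lnM u2 gx) (lnM m0 gx) /y (ln_div u2 m0); ring.
rewrite lny.
have -> : `|u x| `^ p = m `^ (p / 2) * (y * y `^ (- q)).
  have -> : `|u x| `^ p = (u x ^+ 2) `^ (p / 2).
    rewrite -real_normK ?num_real// -powR_mulrn// -powRrM; congr (_ `^ _); by field.
  have -> : u x ^+ 2 = m * y by rewrite /y mulrCA divff ?mulr1// gt_eqF.
  rewrite powRM ?ltW//; congr (_ * _).
  rewrite -{2}(powRr1 (ltW y0)) -powRD; last by apply/implyP => _; rewrite gt_eqF.
  by congr (_ `^ _); rewrite /q; ring.
have eu : u x ^+ 2 = m * y by rewrite /y mulrCA divff ?mulr1// gt_eqF.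
have hj := jensen_pointwise q E y0.
rewrite eu.
rewrite [leLHS](_ : _ = m `^ (p / 2) * (y * (expR (- (q * E)) * (1 + q * E - q * ln y))) * gauss_density x); last first.
  by rewrite /B; field; rewrite gt_eqF.
rewrite ler_pM2r// ler_pM2l ?powR_gt0// ler_pM2l//.
Qed.

(** With a the L^p norm, the last hypothesis is the logarithm of the
    conclusion of entropy_Lp, where E has been replaced by its upper bound (D
    / 2) ln rho. *)
Lemma powR_ratio_le (D p m a rho l : R) : 0 < D -> 1 <= p < 2 ->
  0 < m -> 0 < a -> 0 < rho -> p * ln a = l ->
  p / 2 * ln m - (1 - p / 2) * (D / 2 * ln rho) <= l ->
  (a ^+ 2 / m) `^ (- (2 * p / (D * (2 - p)))) <= rho.
Proof.
move=> D0 /andP[p1 p2] m0 a0 rho0 <- h.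
have p0 : 0 < p by lra.
have q0 : 0 < 2 - p by lra.
have k0 : 0 < 2 * p / (D * (2 - p)) by rewrite divr_gt0 ?mulr_gt0.
have t0 : 0 < a ^+ 2 / m by rewrite divr_gt0// exprn_gt0.
rewrite -ler_ln ?posrE ?powR_gt0// ln_powR.
rewrite ln_div ?posrE ?exprn_gt0// lnXn// mulNr -mulrN.
have -> : ln rho = 2 * p / (D * (2 - p)) * ((2 - p) / p * (D / 2 * ln rho)).
  by field; rewrite !gt_eqF.
rewrite ler_pM2l// -(ler_pM2l p0).
have -> : p * ((2 - p) / p * (D / 2 * ln rho)) = (2 - p) * (D / 2 * ln rho).
  by field; rewrite gt_eqF.
rewrite -mulr_natl; lra.
Qed.

End entropy_to_Lp.

(** * Entropy and Fisher information *)

Section entropy_information.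
Context {R : realType} {d : nat}.
Local Notation Leb := (@lebesgue_rV R).

(** Apply lsi to v = u sqrt(gamma). The moment identity and the normalisation
    of the second moment evaluate the right-hand side as a function of s, I
    and m alone, which is then minimised in s. *)
Lemma entropy_information (u : 'rV[R]_d -> R) (G : 'rV[R]_d -> 'rV[R]_d) :
  (1 <= d)%N -> measurable_fun setT u -> weak_gradient u G ->
  L1 (Leb d) (fun x => u x ^+ 2 * gauss_density x) ->
  (forall i, L1 (Leb d) (fun x => x 0 i ^+ 2 * u x ^+ 2 * gauss_density x)) ->
  (forall i, L1 (Leb d) (fun x => G x 0 i ^+ 2 * gauss_density x)) ->
  let m := \int[Leb d]_x (u x ^+ 2 * gauss_density x) in
  let I := \sum_(i < d) \int[Leb d]_x (G x 0 i ^+ 2 * gauss_density x) in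
  0 < m -> \sum_(i < d) \int[Leb d]_x (x 0 i ^+ 2 * u x ^+ 2 * gauss_density x) = d%:R * m ->
  (\int[Leb d]_x (ent (u x ^+ 2 * gauss_density x) (m * gauss_density x))%:E
   <= (m * (d%:R / 2 * ln (1 + 4 * I / (d%:R * m))))%:E)%E.
Proof.
move=> d1 mu wg u2 xu2 G2 m I m0 mom.
have d0 : 0 < d%:R :> R by rewrite ltr0n.
pose V (x : 'rV[R]_d) : R := u x * root_gauss x.
pose K (i : 'I_d) (x : 'rV[R]_d) : R := G x 0 i * root_gauss x - x 0 i / 2 * V x.
have mo := @measurable_root_gauss R d.
have mG (i : 'I_d) : measurable_fun setT (fun x : 'rV[R]_d => G x 0 i) by have [_ /(_ i)[[]]] := wg.
have mx (i : 'I_d) : measurable_fun setT (fun x : 'rV[R]_d => x 0 i) by exact: measurable_coord.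
have V2 (x : 'rV[R]_d) : V x ^+ 2 = u x ^+ 2 * gauss_density x by rewrite /V exprMn root_gauss_sq.
have XV (i : 'I_d) (x : 'rV[R]_d) : (x 0 i * V x) ^+ 2 = x 0 i ^+ 2 * u x ^+ 2 * gauss_density x.
  by rewrite exprMn V2 mulrA.
have GV (i : 'I_d) (x : 'rV[R]_d) : (G x 0 i * root_gauss x) ^+ 2 = G x 0 i ^+ 2 * gauss_density x.
  by rewrite exprMn root_gauss_sq.
have mV : measurable_fun setT V by exact: measurable_funM.
have iV : L1 (Leb d) (fun x => V x ^+ 2) by under eq_fun do rewrite V2.
have iXV (i : 'I_d) : L1 (Leb d) (fun x => (x 0 i * V x) ^+ 2) by under eq_fun do rewrite XV.
have iGV (i : 'I_d) : L1 (Leb d) (fun x => (G x 0 i * root_gauss x) ^+ 2) by under eq_fun do rewrite GV.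
have mXV (i : 'I_d) : measurable_fun setT (fun x : 'rV[R]_d => x 0 i * V x) by exact: measurable_funM.
have mGV (i : 'I_d) : measurable_fun setT (fun x : 'rV[R]_d => G x 0 i * root_gauss x) by exact: measurable_funM.
have mK (i : 'I_d) : measurable_fun setT (K i).
  by apply: measurable_funB => //; apply: measurable_funM => //; exact: measurable_funM.
have wK (i : 'I_d) : weak_partial i V (K i) by exact: weak_partial_root_gauss.
have iGX (i : 'I_d) : L1 (Leb d) (fun x => (G x 0 i * root_gauss x) * (x 0 i * V x)) by exact: L1_Msq.
have K2 (i : 'I_d) (x : 'rV[R]_d) : K i x ^+ 2 = (G x 0 i * root_gauss x) ^+ 2 - (G x 0 i * root_gauss x) * (x 0 i * V x)
   + 4^-1 * (x 0 i * V x) ^+ 2 by rewrite /K; field.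
have iK (i : 'I_d) : L1 (Leb d) (fun x => K i x ^+ 2).
  under eq_fun do rewrite K2.
  by apply: L1D; [exact: L1B|exact: L1Z].
have adm : admissible V K by split.
have eV : \int[Leb d]_x (V x ^+ 2) = m by under eq_Rintegral do rewrite V2.
have eXV : \sum_(i < d) \int[Leb d]_x ((x 0 i * V x) ^+ 2) = d%:R * m.
  by rewrite -mom; apply: eq_bigr => i _; apply: eq_Rintegral => x _; rewrite XV.
have eK : \sum_(i < d) \int[Leb d]_x (K i x ^+ 2) = I + d%:R * m / 4.
  have e (i : 'I_d) : \int[Leb d]_x (K i x ^+ 2) = \int[Leb d]_x (G x 0 i ^+ 2 * gauss_density x)
      + 2^-1 * m - 4^-1 * \int[Leb d]_x ((x 0 i * V x) ^+ 2).
    have h := moment_identity mV (mK i) iV (iK i) (iXV i) (wK i); rewrite eV in h.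
    have iXK : L1 (Leb d) (fun x => x 0 i * V x * K i x) by exact: L1_Msq.
    rewrite (_ : (fun x => K i x ^+ 2) = (fun x => (G x 0 i ^+ 2 * gauss_density x
      - x 0 i * V x * K i x) - 4^-1 * (x 0 i * V x) ^+ 2)); last first.
      by apply/funext => x; rewrite K2 -GV /K; field.
    rewrite RI_B; [|exact: L1B|exact: L1Z].
    rewrite (RI_B (G2 i) iXK) h (RI_Z _ (iXV i)); ring.
  under eq_bigr do rewrite e.
  rewrite sumrB big_split/= sumr_const card_ord -mulr_sumr eXV -mulr_natl.
  by rewrite -/I; field.
have I0 : 0 <= I.
  apply: sumr_ge0 => i _; apply: RI_ge0 => x.
  by rewrite mulr_ge0 ?sqr_ge0// gauss_density_ge0.
pose rho := 1 + 4 * I / (d%:R * m).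
have rho0 : 0 < rho by rewrite ltr_pwDl// divr_ge0 ?mulr_ge0// ltW.
(* s^2 = 1 / rho minimises d m rho s^2 / 2 - d m ln s, the part of the bound
   that depends on s. *)
pose s := expR (- (ln rho / 2)).
have s2 : s ^+ 2 = rho^-1.
  by rewrite /s -expRM_natl -{2}(@lnK _ rho)// -expRN; congr expR; field.
have := lsi adm (expR_gt0 (- (ln rho / 2))).
rewrite eV /lsi_bound eV eXV eK -/s s2 /s expRK.
under eq_integral do rewrite V2.
move=> /le_trans; apply; rewrite lee_fin -/rho.
have -> : I + d%:R * m / 4 = d%:R * m / 4 * rho.
  by rewrite /rho; field; rewrite !gt_eqF.
rewrite le_eqVlt; apply/orP; left; apply/eqP.
by field; rewrite gt_eqF.
Qed.

End entropy_information.
Unset Implicit Arguments.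

Theorem corollary4 (R : realType) (d : nat) (p : R)
    (u : 'rV[R]_d -> R) (gradu : 'rV[R]_d -> 'rV[R]_d) :
  (1 <= d)%N -> 1 <= p < 2 ->
  sobolev_H1 (gauss_measure d) u -> weak_gradient u gradu ->
  ~ {ae gauss_measure d, forall x, u x = 0} ->
  (\int[gauss_measure d]_x (`|u x| ^+ 2 * sqr_enorm x)%:E
    = (d%:R * Lp_norm (gauss_measure d) 2 u ^+ 2)%:E)%E ->
  ((Lp_norm (gauss_measure d) 2 u ^+ 2 *
    varphi d p
      ((Lp_norm (gauss_measure d) 2 u ^+ 2 - Lp_norm (gauss_measure d) p u ^+ 2)
       / Lp_norm (gauss_measure d) 2 u ^+ 2))%:E
   <= \int[gauss_measure d]_x (sqr_enorm (gradu x))%:E)%E.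
Proof.
move=> d1 p12 [u2 _] wg unz mom.
have [p1 p2] := andP p12.
have d0 : 0 < d%:R :> R by rewrite ltr0n.
have [[mu _] hG] := wg.
have mG (i : 'I_d) : measurable_fun setT (fun x : 'rV[R]_d => gradu x 0 i) by have [[]] := hG i.
have mx (i : 'I_d) : measurable_fun setT (fun x : 'rV[R]_d => x 0 i) by exact: measurable_coord.
have mg := @measurable_gauss_density R d.
have mu2 : measurable_fun setT (fun x : 'rV[R]_d => u x ^+ 2) by exact: measurable_funX.
have se_ge0 (x : 'rV[R]_d) : 0 <= sqr_enorm x by apply: sumr_ge0 => i _; exact: sqr_ge0.
have iu : L1 (lebesgue_rV d) (fun x => u x ^+ 2 * gauss_density x).
  apply: L1_gauss => //; first by move=> x; exact: sqr_ge0.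
  exact: (integrable_lty measurableT (Lfun2_integrable_sqr u2)).
set m := \int[lebesgue_rV d]_x (u x ^+ 2 * gauss_density x).
have m_ge0 : 0 <= m.
  by apply: RI_ge0 => x; rewrite mulr_ge0 ?sqr_ge0 ?gauss_density_ge0.
have em : Lp_norm (gauss_measure d) 2 u ^+ 2 = m.
  rewrite Lp_normE; under eq_integral do rewrite powR_mulrn// real_normK ?num_real//.
  rewrite integral_gauss//; last by move=> x; exact: sqr_ge0.
  by rewrite (L1_EFin iu) /= -/m powR12_sqrt// sqr_sqrtr.
have m0 : 0 < m.
  rewrite lt0r m_ge0 andbT; apply/eqP => e0; apply: unz.
  have := RI0_ae iu (fun x => mulr_ge0 (sqr_ge0 _) (gauss_density_ge0 x)) e0.
  move=> [N [mN N0 hN]]; exists N; split => //.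
    rewrite /= /gauss_measure; apply: null_set_integral => //.
    by apply/measurable_EFinP; exact: measurable_funTS.
  move=> x /= ux; apply: hN => /= /eqP.
  rewrite mulf_eq0 sqrf_eq0 => /orP[/eqP//|/eqP g0].
  by have := @gauss_density_gt0 R d x; rewrite g0 ltxx.
rewrite em in mom *.
have mgr : measurable_fun setT (fun x : 'rV[R]_d => sqr_enorm (gradu x)).
  by apply: measurable_sum => i; exact: measurable_funX.
have [Ioo|] := eqVneq (\int[gauss_measure d]_x (sqr_enorm (gradu x))%:E)%E +oo%E.
  by rewrite Ioo leey.
rewrite -ltey => Ioo.
have iGs := L1_gauss mgr (fun x => se_ge0 _) Ioo.
have iG (i : 'I_d) : L1 (lebesgue_rV d) (fun x => gradu x 0 i ^+ 2 * gauss_density x).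
  apply: (L1_le _ iGs); first by apply: measurable_funM => //; exact: measurable_funX.
  move=> x; rewrite (ger0_norm (mulr_ge0 (sqr_ge0 _) (gauss_density_ge0 _))).
  rewrite ler_wpM2r ?gauss_density_ge0// /sqr_enorm (bigD1 i)//= lerDl.
  by apply: sumr_ge0 => j _; exact: sqr_ge0.
set I := \sum_(i < d) \int[lebesgue_rV d]_x (gradu x 0 i ^+ 2 * gauss_density x).
have eI : (\int[gauss_measure d]_x (sqr_enorm (gradu x))%:E = I%:E)%E.
  rewrite integral_gauss// (L1_EFin iGs); congr EFin.
  by under eq_Rintegral do rewrite /sqr_enorm mulr_suml; rewrite RI_sum.
rewrite eI lee_fin.
have mse : measurable_fun setT (fun x : 'rV[R]_d => `|u x| ^+ 2 * sqr_enorm x).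
  apply: measurable_funM; first by apply: measurable_funX; apply: measurableT_comp.
  by apply: measurable_sum => i; exact: measurable_funX.
have se0 (x : 'rV[R]_d) : 0 <= `|u x| ^+ 2 * sqr_enorm x by rewrite mulr_ge0 ?sqr_ge0.
have iXs : L1 (lebesgue_rV d) (fun x => `|u x| ^+ 2 * sqr_enorm x * gauss_density x).
  by apply: L1_gauss => //; rewrite mom ltry.
have iX (i : 'I_d) : L1 (lebesgue_rV d) (fun x => x 0 i ^+ 2 * u x ^+ 2 * gauss_density x).
  apply: (L1_le _ iXs).
    by apply: measurable_funM => //; apply: measurable_funM => //; exact: measurable_funX.
  move=> x; rewrite (ger0_norm (mulr_ge0 (mulr_ge0 (sqr_ge0 _) (sqr_ge0 _)) (gauss_density_ge0 _))).
  rewrite ler_wpM2r ?gauss_density_ge0// real_normK ?num_real// mulrC ler_wpM2l ?sqr_ge0//.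
  rewrite /sqr_enorm (bigD1 i)//= lerDl.
  by apply: sumr_ge0 => j _; exact: sqr_ge0.
have momE : \sum_(i < d) \int[lebesgue_rV d]_x (x 0 i ^+ 2 * u x ^+ 2 * gauss_density x) = d%:R * m.
  rewrite -RI_sum//; apply: EFin_inj; rewrite -mom integral_gauss// (L1_EFin iXs); congr EFin.
  apply: eq_Rintegral => x _; rewrite real_normK ?num_real// /sqr_enorm mulr_sumr mulr_suml.
  by apply: eq_bigr => i _; rewrite (mulrC (u x ^+ 2)).
have hent := entropy_information d1 mu wg iu iX iG m0 momE.
rewrite -/m -/I in hent.
set rho := 1 + 4 * I / (d%:R * m) in hent.
have I0 : 0 <= I.
  by apply: sumr_ge0 => i _; apply: RI_ge0 => x; rewrite mulr_ge0 ?sqr_ge0 ?gauss_density_ge0.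
have rho0 : 0 < rho by rewrite ltr_pwDl// divr_ge0 ?mulr_ge0// ltW.
have eIrho : m * (d%:R / 4 * (rho - 1)) = I by rewrite /rho; field; rewrite !gt_eqF.
set E := d%:R / 2 * ln rho in hent.
set a := Lp_norm _ p u.
have x1 : 1 - (m - a ^+ 2) / m = a ^+ 2 / m by field; rewrite gt_eqF.
rewrite -eIrho /varphi ler_pM2l// ler_pM2l ?divr_gt0// lerD2r x1.
have p0 : 0 < p by exact: lt_le_trans ltr01 p1.
have mup : measurable_fun setT (fun x : 'rV[R]_d => `|u x| `^ p).
  apply: (@measurableT_comp _ _ _ _ _ _ (fun y : R => y `^ p)); first exact: measurable_powR.
  exact: measurableT_comp.
have ea : a = fine (\int[gauss_measure d]_x (`|u x| `^ p)%:E)%E `^ p^-1 by rewrite /a Lp_normE.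
have [Poo|] := eqVneq (\int[gauss_measure d]_x (`|u x| `^ p)%:E)%E +oo%E.
  (* If |u|^p is not integrable, the formal norm a is 0, because fine sends
     +oo to 0; powR sends 0 to 0 as well. *)
  have a0 : a = 0 by rewrite ea Poo /= powR0// invr_neq0// gt_eqF.
  have k0 : 0 < 2 * p / (d%:R * (2 - p)).
    by rewrite divr_gt0 ?mulr_gt0// subr_gt0.
  by rewrite a0 expr0n/= mul0r powR0 ?oppr_eq0 ?gt_eqF// ltW.
rewrite -ltey => Poo.
have ip := L1_gauss mup (fun=> powR_ge0 _ _) Poo.
have hP := entropy_Lp p12 mu iu ip m0 hent.
rewrite integral_gauss// (L1_EFin ip)/= in ea.
set P := \int[lebesgue_rV d]_x (`|u x| `^ p * gauss_density x) in hP ea.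
have b0 : 0 < m `^ (p / 2) * expR (- ((1 - p / 2) * E)).
  by rewrite mulr_gt0 ?expR_gt0// powR_gt0.
have P0 : 0 < P by exact: lt_le_trans hP.
have a0 : 0 < a by rewrite ea powR_gt0.
have lP : p / 2 * ln m - (1 - p / 2) * E <= ln P.
  have := hP; rewrite -ler_ln ?posrE//; apply: le_trans.
  by rewrite lnM ?posrE ?expR_gt0 ?powR_gt0// ln_powR expRK.
apply: powR_ratio_le => //.
by rewrite ea ln_powR mulrA mulfV ?mul1r// gt_eqF.
Qed.
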